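(* Let $\Gamma=PGL(2;7)$. The joint spectral measure (over $\mathbb{T}^2$) for the non-conjugate embeddings of $\Gamma$ into the fundamental representations of $G_2$ is $$\mathrm{d}\varepsilon = \frac{1}{1344\pi^4} J^2 \, \mathrm{d}_7 \times \mathrm{d}_7 + \frac{1}{1152\pi^4} J^2 \, \mathrm{d}_6 \times \mathrm{d}_6 + \frac{1}{48} K' \, \mathrm{d}_4 \times \mathrm{d}_4 + \frac{1}{4} \, \mathrm{d}_3 \times \mathrm{d}_3 + \frac{1}{36} \beta \, \mathrm{d}_2 \times \mathrm{d}_2 - \frac{23}{504} \, \mathrm{d}_1 \times \mathrm{d}_1 - \frac{1}{12}\,\mathrm{d}^{(1)} + \frac{1}{48} \sum_{g \in D_{12}} \delta_{g(\mu,t)},$$ for $\mu$ a primitive 8-th root of unity, where for the embedding with $\varrho_1 = \Sigma_7^{\prime}$ we have $K' = 16-K$, $\beta = 4$ and $t=\mu^3$, whilst for the embedding with $\varrho_1 = \Sigma_1^{\prime} + \Sigma_6^{(1)}$ we have $K' = K$, $\beta = 7$ and $t=-1$, with $$K(\theta_1,\theta_2) = 4\big(\sin(2\pi(\theta_1+\theta_2))-\sin(2\pi(2\theta_1-\theta_2))-\sin(2\pi(2\theta_2-\theta_1))\big)^2 .$$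
   Context: $G_2$ is the compact simply connected simple Lie group of dimension 14, with fundamental representations $\rho_1$, $\rho_2$ of dimensions 7 and 14. Its maximal torus is identified with $\mathbb{T}^2$ so that, for $(\omega_1,\omega_2)=(e^{2\pi i\theta_1},e^{2\pi i\theta_2})\in\mathbb{T}^2$, $$\chi_{\rho_1} = 1 + \omega_1 + \omega_1^{-1} + \omega_2 + \omega_2^{-1} + \omega_1\omega_2^{-1} + \omega_1^{-1}\omega_2,$$ $$\chi_{\rho_2} = \chi_{\rho_1} + 1 + \omega_1\omega_2 + \omega_1^{-1}\omega_2^{-1} + \omega_1^2\omega_2^{-1} + \omega_1^{-2}\omega_2 + \omega_1\omega_2^{-2} + \omega_1^{-1}\omega_2^2 .$$ The Weyl group $D_{12}$ of $G_2$ (dihedral of order 12) is the subgroup of $GL(2,\mathbb{Z})$ generated by $T_2=\begin{pmatrix}0&-1\\-1&0\end{pmatrix}$ and $T_6=\begin{pmatrix}0&1\\-1&1\end{pmatrix}$, acting on $\mathbb{T}^2$ by $T(\omega_1,\omega_2)=(\omega_1^{a_{11}}\omega_2^{a_{12}},\omega_1^{a_{21}}\omega_2^{a_{22}})$ for $T=(a_{il})$. An embedding of a finite group $\Gamma$ in $G_2$ is an injective homomorphism $\iota:\Gamma\to G_2$; put $\varrho_j=\rho_j\circ\iota$, $j=1,2$. Let $\Delta_j$ be the adjacency matrix of the McKay graph of $\varrho_j$ (the matrix of tensoring with $\varrho_j$ on the irreducible representations of $\Gamma$), and $e_{\ast}$ the basis vector of the trivial representation. The joint spectral measure over $\mathbb{T}^2$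 of the embedding is the unique $D_{12}$-invariant probability measure $\varepsilon$ on $\mathbb{T}^2$ such that for all integers $m,n\geq 0$ $$\int_{\mathbb{T}^2}\chi_{\rho_1}^m\chi_{\rho_2}^n\,\mathrm{d}\varepsilon=\langle\Delta_1^m\Delta_2^n e_\ast,e_\ast\rangle=\sum_C\frac{|C|}{|\Gamma|}\chi_{\varrho_1}(C)^m\chi_{\varrho_2}(C)^n,$$ the sum being over the conjugacy classes $C$ of $\Gamma$. Notation for measures on $\mathbb{T}^2$: $\mathrm{d}_k$ is the uniform probability measure on the $k$-th roots of unity; $\mathrm{d}^{(n)}$ is the uniform probability measure on $\{(e^{2\pi i q_1/3n},e^{2\pi i q_2/3n}) : q_1,q_2\in\{0,1,\ldots,3n-1\},\ q_1+q_2\equiv 0 \bmod 3\}$; $\delta_x$ is the Dirac measure at $x$. A function multiplying a measure is a density, and functions on $\mathbb{T}^2$ are written in the coordinates $\theta_1,\theta_2$. The function $J$ is $$J = 8\pi^2\big(\cos 2\pi(2\theta_1+\theta_2)+\cos 2\pi(\theta_1-3\theta_2)+\cos 2\pi(3\theta_1-2\theta_2)-\cos 2\pi(\theta_1+2\theta_2)-\cos 2\pi(3\theta_1-\theta_2)-\cos 2\pi(2\theta_1-3\theta_2)\big).$$ $PGL(2;7)$, the projective general linear group of degree 2 over $\mathbb{F}_7$, has order 336 and two classes of involutions, of sizes 21 and 28. Among its irreducible representations (all real): $\Sigma_1'$ is the nontrivial one-dimensional representation (with kernel $PSL(2;7)$); $\Sigma_6^{(1)}$ is the 6-dimensional irreducible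 representation with character value $-2$ on the involution class of size 21; $\Sigma_7'$ is the 7-dimensional irreducible representation with character value $-1$ on the involution class of size 28. Up to conjugacy in $G_2$ there are two embeddings of $PGL(2;7)$ in $G_2$, with $\varrho_1=\Sigma_7'$ and $\varrho_1=\Sigma_1'+\Sigma_6^{(1)}$ respectively. *)

(* Defs.v *)
From HB Require Import structures.
From mathcomp Require Import all_boot all_order all_algebra.
From mathcomp Require Import all_fingroup all_solvable all_field all_character.
From mathcomp Require Import complex.
From mathcomp Require Import all_classical all_reals all_analysis.
From mathcomp Require Import ring.

Set Implicit Arguments.
Unset Strict Implicit.
Unset Printing Implicit Defensive.

Import Order.TTheory GRing.Theory Num.Theory.
Import numFieldNormedType.Exports.

Local Open Scope classical_set_scope.
Local Open Scope ring_scope.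
Local Open Scope complex_scope.

(* The compact group G_2 is the stabiliser in O(7) of the 3-form              *)
(* phi(u, v, w) = <u x v, w> on the imaginary octonions; equivalently it is   *)
(* the automorphism group of the octonions. Matrices act on row vectors, from *)
(* the right, as in mxrepresentation.                                         *)
Section G2.
Variable R : realType.

(* Structure constants of the imaginary octonions in the basis (e_i), i mod 7,*)
(* with e_i e_(i+1) = e_(i+3): phi_coef i j k is the coefficient of e_k in    *)
(* e_i x e_j. It is alternating and only depends on j - i and k - i.          *)
Definition phi_coef (i j k : 'I_7) : R :=
  let ds : seq ('I_7 * 'I_7) :=
    [:: (inord 1, inord 3); (inord 2, inord 6); (inord 4, inord 5)] in
  if (j - i, k - i) \in ds then 1
  else if (k - i, j - i) \in ds then -1 else 0.

Definition phi (u v w : 'rV[R]_7) : R :=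
  \sum_i \sum_j \sum_k phi_coef i j k * u 0 i * v 0 j * w 0 k.

Definition in_G2 (A : 'M[R]_7) : Prop :=
  A *m A^T = 1%:M /\
  forall u v w, phi (u *m A) (v *m A) (w *m A) = phi u v w.

(* (X . phi)(u, v, w), for X acting as a derivation.                          *)
Definition der_phi (X : 'M[R]_7) (u v w : 'rV[R]_7) : R :=
  phi (u *m X) v w + phi u (v *m X) w + phi u v (w *m X).

Definition dphi (i : 'I_7) (X : 'M[R]_7) : 'M[R]_7 :=
  \matrix_(j, k) der_phi X (delta_mx 0 i) (delta_mx 0 j) (delta_mx 0 k).

Lemma phi_linear1 v w : linear (fun u => phi u v w : R^o).
Proof.
move=> a x y; rewrite /phi scaler_sumr -big_split; apply: eq_bigr => i _ /=.
rewrite scaler_sumr -big_split; apply: eq_bigr => j _ /=.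
rewrite scaler_sumr -big_split; apply: eq_bigr => k _ /=.
by rewrite !mxE /GRing.scale /=; ring.
Qed.

Lemma phi_linear2 u w : linear (fun v => phi u v w : R^o).
Proof.
move=> a x y; rewrite /phi scaler_sumr -big_split; apply: eq_bigr => i _ /=.
rewrite scaler_sumr -big_split; apply: eq_bigr => j _ /=.
rewrite scaler_sumr -big_split; apply: eq_bigr => k _ /=.
by rewrite !mxE /GRing.scale /=; ring.
Qed.

Lemma phi_linear3 u v : linear (fun w => phi u v w : R^o).
Proof.
move=> a x y; rewrite /phi scaler_sumr -big_split; apply: eq_bigr => i _ /=.
rewrite scaler_sumr -big_split; apply: eq_bigr => j _ /=.
rewrite scaler_sumr -big_split; apply: eq_bigr => k _ /=.
by rewrite !mxE /GRing.scale /=; ring.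
Qed.

Lemma linear_row0 (f : 'rV[R]_7 -> R) : linear (f : _ -> R^o) ->
  (forall i, f (delta_mx 0 i) = 0) -> forall u, f u = 0.
Proof.
move=> lf f0 u.
pose g : {linear 'rV[R]_7 -> R^o} :=
  HB.pack (f : _ -> R^o) (GRing.isLinear.Build _ _ _ _ (f : _ -> R^o) lf).
rewrite -[f]/(g : _ -> _) [u]row_sum_delta linear_sum big1 // => i _.
by rewrite linearZ /= f0 scaler0.
Qed.

Lemma der_phi0 X : (forall i j k,
    der_phi X (delta_mx 0 i) (delta_mx 0 j) (delta_mx 0 k) = 0) ->
  forall u v w, der_phi X u v w = 0.
Proof.
move=> h u v w.
apply: (@linear_row0 (fun u => der_phi X u v w)) u => [a x y|i].
  by rewrite /der_phi mulmxDl -scalemxAl !phi_linear1 /GRing.scale /=; ring.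
apply: (@linear_row0 (fun v => der_phi X _ v w)) v => [a x y|j].
  by rewrite /der_phi mulmxDl -scalemxAl !phi_linear2 /GRing.scale /=; ring.
apply: (@linear_row0 (fun w => der_phi X _ _ w)) w => [a x y|k].
  by rewrite /der_phi mulmxDl -scalemxAl !phi_linear3 /GRing.scale /=; ring.
exact: h.
Qed.

Lemma dphi_is_linear i : linear (dphi i).
Proof.
move=> a X Y; apply/matrixP => j k; rewrite !mxE /der_phi !mulmxDr -!scalemxAr.
by rewrite phi_linear1 phi_linear2 phi_linear3 /GRing.scale /=; ring.
Qed.
HB.instance Definition _ i :=
  GRing.isLinear.Build R _ _ _ (dphi i) (dphi_is_linear i).

Definition sympart (X : 'M[R]_7) : 'M[R]_7 := X + X^T.

Lemma sympart_is_linear : linear sympart.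
Proof.
move=> a X Y; rewrite /sympart linearP /= scalerDr !addrA; congr (_ + _).
by rewrite addrAC.
Qed.
HB.instance Definition _ :=
  GRing.isLinear.Build R _ _ _ sympart sympart_is_linear.

(* The Lie algebra {X in so(7) | X . phi = 0}, as a row space in 'rV_(7 * 7)  *)
(* through mxvec.                                                             *)
Definition g2 : 'M[R]_(7 * 7) :=
  (kermx (lin_mx sympart) :&: \bigcap_(i < 7) kermx (lin_mx (dphi i)))%MS.

Lemma mem_g2 (X : 'M[R]_7) :
  (mxvec X <= g2)%MS <->
  X + X^T = 0 /\ forall u v w, der_phi X u v w = 0.
Proof.
rewrite sub_capmx; split.
  case/andP=> /sub_kermxP; rewrite mul_vec_lin => /eqP.
  rewrite mxvec_eq0 => /eqP hX /sub_bigcapmxP h; split=> //.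
  apply: der_phi0 => i j k; have /sub_kermxP := h i isT.
  rewrite mul_vec_lin => /eqP; rewrite mxvec_eq0 => /eqP.
  by move/matrixP/(_ j k); rewrite !mxE.
case=> hX h; apply/andP; split.
  by apply/sub_kermxP; rewrite mul_vec_lin /= /sympart hX linear0.
apply/sub_bigcapmxP => i _; apply/sub_kermxP; rewrite mul_vec_lin /=.
suff ->: dphi i X = 0 by rewrite linear0.
by apply/matrixP => j k; rewrite !mxE; exact: h.
Qed.

End G2.

Section Embedding.
Variables (R : realType) (gT : finGroupType) (G : {group gT}).

Record G2_embedding := MkG2Embedding {
  emb :> mx_representation R G 7;
  emb_G2 : {in G, forall x, in_G2 (emb x)};
  emb_inj : {in G &, injective emb} }.

Variable iota : G2_embedding.

(* X |-> g^-1 X g: the adjoint action, for the right-action convention.       *)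
Definition Ad_mx (x : gT) : 'M[R]_(7 * 7) :=
  lin_mx (mulmxr (iota x) \o mulmx (iota x^-1%g)).

Lemma Ad_mx_repr : mx_repr G Ad_mx.
Proof.
split=> [|x y Gx Gy]; apply/row_matrixP => i.
  rewrite !rowE mul_rV_lin /= invg1 repr_mx1 mulmx1 mul1mx vec_mxK.
  by rewrite mulmx1.
rewrite !rowE mulmxA !mul_rV_lin /= mxvecK invMg !repr_mxM ?groupV //.
by rewrite !mulmxA.
Qed.
Definition Ad_repr := MxRepresentation Ad_mx_repr.

Lemma g2_module : mxmodule Ad_repr (g2 R).
Proof.
apply/mxmoduleP => x Gx; apply/rV_subP => v /submxP[u ->].
rewrite mulmxA; set X' := u *m g2 R.
have: (X' <= g2 R)%MS by apply: submxMl.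
rewrite -[X']vec_mxK; set X := vec_mx X'.
case/mem_g2 => skX dX; rewrite /= mul_vec_lin /=; apply/mem_g2.
have [oA pA] := emb_G2 iota Gx.
have VA : iota x^-1%g = (iota x)^T.
  have := repr_mxK iota Gx 1%:M; rewrite mul1mx => h.
  by rewrite -[LHS]mul1mx -(mulmx1C oA) -mulmxA h mulmx1.
have KV z : z = z *m iota x^-1%g *m iota x.
  by rewrite -mulmxA VA (mulmx1C oA) mulmx1.
split.
  transitivity ((iota x)^T *m (X + X^T) *m iota x).
    by rewrite VA mulmxDr mulmxDl !trmx_mul trmxK !mulmxA.
  by rewrite skX mulmx0 mul0mx.
move=> a b c; rewrite -[RHS](dX (a *m iota x^-1%g) (b *m iota x^-1%g)
  (c *m iota x^-1%g)) /der_phi !mulmxA.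
by rewrite {2 3}[a]KV {1 3}[b]KV {1 2}[c]KV !pA.
Qed.

(* rho_1 and rho_2 (the adjoint representation, on the complexification of    *)
(* g_2) restricted to the finite group.                                       *)
Definition varrho1 : mx_representation R[i] G 7 :=
  map_repr (real_complex R) iota.
Definition varrho2 : mx_representation R[i] G (\rank (g2 R)) :=
  map_repr (real_complex R) (submod_repr g2_module).

End Embedding.

Section McKay.
Variables (F : decFieldType) (gT : finGroupType) (G : {group gT}).

Definition irreps : irrType F G := DecSocleType (regular_repr F G).

(* Multiplicity of the irreducible representation i in rG (compare            *)
(* standard_irr_coef, which is stated for algC only).                         *)
Definition irr_mult n (rG : mx_representation F G n) (i : irreps) : nat :=
  \sum_(W : DecSocleType rG | irr_comp irreps (socle_repr W) == i)
    socle_mult W.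

Definition mckay n (rG : mx_representation F G n) : 'M[F]_#|irreps| :=
  \matrix_(a, b)
    (irr_mult (prod_repr rG (irr_repr (enum_val a))) (enum_val b))%:R.

Definition triv_irrep : 'I_#|irreps| := enum_rank [1 irreps]%irr.

End McKay.

Section Torus.
Variable R : realType.

Record circle := Circle {
  cval :> R[i];
  cval_norm : `|cval| == 1 }.

HB.instance Definition _ := [isSub for cval].
HB.instance Definition _ := [Choice of circle by <:].
HB.instance Definition _ := isPointed.Build circle
  (Circle (introT eqP (normr1 R[i]))).

(* Borel sigma-algebra, pulled back from R^2.                                 *)
Definition circle_coord (z : circle) : R * R :=
  (complex.Re (cval z), complex.Im (cval z)).
HB.instance Definition _ := Measurable.copy circle
  (g_sigma_algebra_preimageType circle_coord).

Definition torus : Type := (circle * circle)%type.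
HB.instance Definition _ := Measurable.on torus.

Lemma expi_norm (x : R) : `|cos (2 * pi * x) +i* sin (2 * pi * x)| == 1.
Proof. by rewrite normc_def /= cos2Dsin2 sqrtr1. Qed.

(* e^(2 pi i x), and an inverse of it with values in [0, 1[.                  *)
Definition expi (x : R) : circle := Circle (expi_norm x).
Definition angle (z : circle) : R :=
  xget 0 [set x | 0 <= x < 1 /\ expi x = z].

Lemma monomial_norm (a b : int) (w : torus) :
  `|cval w.1 ^ a * cval w.2 ^ b| == 1.
Proof.
have h (z : circle) (n : int) : `|cval z ^ n| = 1.
  by case: n => n; rewrite /exprz ?normfV normrX (eqP (cval_norm z)) expr1n
    ?invr1.
by rewrite normrM !h mulr1.
Qed.
Definition monomial (a b : int) (w : torus) : circle :=
  Circle (monomial_norm a b w).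

Definition act (g : 'M[int]_2) (w : torus) : torus :=
  (monomial (g 0 0) (g 0 1) w, monomial (g 1 0) (g 1 1) w).

End Torus.

Section SpectralMeasure.
Variable R : realType.
Implicit Types (w : torus R) (A : set (torus R)) (F : R -> R -> R).

Definition mx2 (a b c d : int) : 'M[int]_2 :=
  \matrix_(i, j) nth 0 (nth [::] [:: [:: a; b]; [:: c; d]] i) j.

(* The subgroup of GL(2, Z) generated by T_2 and T_6.                         *)
Inductive D12 : set 'M[int]_2 :=
| D12_T2 : D12 (mx2 0 (-1) (-1) 0)
| D12_T6 : D12 (mx2 0 1 (-1) 1)
| D12_one : D12 1%:M
| D12_mul g h : D12 g -> D12 h -> D12 (g *m h)
| D12_inv g : D12 g -> D12 (invmx g).

Definition chi1 w : R[i] :=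
  let: (w1, w2) := (cval w.1, cval w.2) in
  1 + w1 + w1^-1 + w2 + w2^-1 + w1 * w2^-1 + w1^-1 * w2.

Definition chi2 w : R[i] :=
  let: (w1, w2) := (cval w.1, cval w.2) in
  chi1 w + 1 + w1 * w2 + w1^-1 * w2^-1 + w1 ^+ 2 * w2^-1 + w1 ^- 2 * w2
  + w1 * w2 ^- 2 + w1^-1 * w2 ^+ 2.

Definition cintegral (mu : {measure set (torus R) -> \bar R})
    (f : torus R -> R[i]) : R[i] :=
  Rintegral mu setT (fun w => complex.Re (f w))
  +i* Rintegral mu setT (fun w => complex.Im (f w)).

Section Embedding.
Variables (gT : finGroupType) (G : {group gT}) (iota : G2_embedding R G).

(* <Delta_1^m Delta_2^n e_*, e_*> is a diagonal entry of the matrix.           *)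
Definition mckay_moment (m n : nat) : R[i] :=
  (mckay (varrho1 iota) ^+ m *m mckay (varrho2 iota) ^+ n)
    (triv_irrep _ G) (triv_irrep _ G).

Definition class_moment (m n : nat) : R[i] :=
  \sum_(C in classes G) #|C|%:R / #|G|%:R
    * \tr (varrho1 iota (repr C)) ^+ m * \tr (varrho2 iota (repr C)) ^+ n.

Definition has_spectral_moments (eps : probability (torus R) R) : Prop :=
  (forall g, D12 g -> forall A, measurable A -> eps (act g @^-1` A) = eps A) /\
  (forall m n, cintegral eps (fun w => chi1 w ^+ m * chi2 w ^+ n)
               = mckay_moment m n
            /\ mckay_moment m n = class_moment m n).

(* "The" joint spectral measure: uniqueness is part of the definition.        *)
Definition is_joint_spectral_measure (eps : probability (torus R) R) : Prop :=
  has_spectral_moments eps /\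
  (forall eps', has_spectral_moments eps' ->
     forall A, measurable A -> eps' A = eps A).

End Embedding.

(* The uniform probability measure on the k-th roots of unity.                *)
Definition d_ (k : nat) : set (circle R) -> \bar R :=
  mscale (k%:R^-1 : R)%:nng
    (msum (fun q => \d_(expi (q%:R / k%:R)) : measure _ R) k).

HB.instance Definition _ k := Measure.on (d_ k).

Lemma d_finite k : fin_num_fun (d_ k).
Proof.
move=> A mA; rewrite /d_ /mscale /= fin_numM //.
by rewrite /msum; apply/sum_fin_numP => q _ _; exact: fin_num_measure.
Qed.
HB.instance Definition _ k := Measure_isFinite.Build _ _ _ (d_ k) (@d_finite k).

(* F . d_k x d_k for a density F in the coordinates theta. All densities below*)
(* are Z^2-periodic, so the choice made in angle is irrelevant.               *)
Definition dd (k : nat) F A : \bar R :=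
  (\int[(d_ k \x d_ k)%E]_(w in A) (F (angle w.1) (angle w.2))%:E)%E.

Definition d3_index (n : nat) : pred ('I_(3 * n) * 'I_(3 * n)) :=
  fun q => (3 %| q.1 + q.2)%N.
(* The measure d^(n).                                                         *)
Definition d3 (n : nat) A : \bar R :=
  ((#|@d3_index n|%:R^-1)%:E * \sum_(q | @d3_index n q)
    \d_((expi (q.1%:R / (3 * n)%:R), expi (q.2%:R / (3 * n)%:R)) : torus R) A)%E.

Definition J (t1 t2 : R) : R :=
  8 * pi ^+ 2 * (cos (2 * pi * (2 * t1 + t2)) + cos (2 * pi * (t1 - 3 * t2))
               + cos (2 * pi * (3 * t1 - 2 * t2)) - cos (2 * pi * (t1 + 2 * t2))
               - cos (2 * pi * (3 * t1 - t2)) - cos (2 * pi * (2 * t1 - 3 * t2))).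

Definition K (t1 t2 : R) : R :=
  4 * (sin (2 * pi * (t1 + t2)) - sin (2 * pi * (2 * t1 - t2))
       - sin (2 * pi * (2 * t2 - t1))) ^+ 2.

Definition epsPGL27 (K' : R -> R -> R) (beta : R) (mu t : circle R) A : \bar R :=
  ((1 / (1344 * pi ^+ 4))%:E * dd 7 (fun x y => J x y ^+ 2)%R A
   + (1 / (1152 * pi ^+ 4))%:E * dd 6 (fun x y => J x y ^+ 2)%R A
   + (1 / 48)%:E * dd 4 K' A
   + (1 / 4)%:E * (d_ 3 \x d_ 3) A
   + (1 / 36 * beta)%:E * (d_ 2 \x d_ 2) A
   - (23 / 504)%:E * (d_ 1 \x d_ 1) A
   - (1 / 12)%:E * d3 1 A
   + (1 / 48)%:E * \sum_(g \in D12) (\d_(act g (mu, t)) A : \bar R))%E.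

End SpectralMeasure.

Section PGL27.
Local Notation GL27 := {'GL_2['F_7]}.

(* The centre of GL_2 is the subgroup of scalar matrices.                     *)
Definition PGL27 : {group coset_of 'Z([set: GL27]%SET)} :=
  ([set: GL27] / 'Z([set: GL27]%SET))%G.

Definition PSL27 : {set coset_of 'Z([set: GL27]%SET)} :=
  ([set u : GL27 | \det (GLval u) == 1%R]%SET / 'Z([set: GL27]%SET))%g.

Variable R : realType.

Definition is_Sigma1' (rG : mx_representation R[i] PGL27 1) : Prop :=
  ~~ (PGL27 \subset rker rG) /\ rker rG = PSL27.

(* Sigma_6^(1)                                                                *)
Definition is_Sigma61 (rG : mx_representation R[i] PGL27 6) : Prop :=
  mx_irreducible rG /\
  forall x, x \in PGL27 -> #[x]%g = 2%N -> #|(x ^: PGL27)%g| = 21%N ->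
    \tr (rG x) = - 2.

Definition is_Sigma7' (rG : mx_representation R[i] PGL27 7) : Prop :=
  mx_irreducible rG /\
  forall x, x \in PGL27 -> #[x]%g = 2%N -> #|(x ^: PGL27)%g| = 28%N ->
    \tr (rG x) = - 1.

Definition varrho1_is_Sigma7' (iota : G2_embedding R PGL27) : Prop :=
  exists2 s7, is_Sigma7' s7 & mx_rsim (varrho1 iota) s7.

Definition varrho1_is_Sigma1'_Sigma61 (iota : G2_embedding R PGL27) : Prop :=
  exists s1 s6, [/\ is_Sigma1' s1, is_Sigma61 s6 &
    mx_rsim (varrho1 iota)
      (dadd_grepr (Representation s1) (Representation s6))].

End PGL27.

(* Main.v *)
From HB Require Import structures.
From mathcomp Require Import all_boot all_order all_algebra.
From mathcomp Require Import all_fingroup all_solvable all_field all_character.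
From mathcomp Require Import complex all_classical all_reals all_analysis.
From mathcomp Require Import measurable_realfun.
From mathcomp Require Import ring lra zify.
Require Import Defs.

Set Implicit Arguments.
Unset Strict Implicit.
Unset Printing Implicit Defensive.
Import Order.TTheory GRing.Theory Num.Theory.
Import numFieldNormedType.Exports.
Local Open Scope ring_scope.

(** Why the formula holds.  Both sides are finitely supported measures on the
torus, and the claim splits into three independent facts.

Group side.  By the spectral description of the McKay matrices the moment
<Delta_1^m Delta_2^n e, e> is the average over the group of
chi_1(x)^m chi_2(x)^n ([mckay_moment_average]).  So everything depends only on
the classes of PGL(2, 7) and on the values of the two characters there.  The
classes come from a computation in a model of PGL(2, 7) by normalised 2 x 2
matrices ([sum_PGL27]).  No character table is used: the degree and, beyond degree 1, one
value on an involution, together with the integrality of eigenvalue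
multiplicities, the orthogonality to the trivial character and the norm
relation, leave a small Diophantine system with a single solution
([degree7_values], [degree6_values], [degree1_values]).  The second character is
obtained from the first: G_2 acts on so(7) as the sum of g_2 and of the
7-dimensional representation, hence
chi_2(x) = (chi_1(x)^2 - chi_1(x^2)) / 2 - chi_1(x) ([mxtrace_varrho2]).

Torus side.  Choose for each class C a point w_C of the torus where (chi1, chi2)
takes the values of the two characters on C.  The measure which gives each C the
mass |C| / 336, spread evenly over the Weyl orbit of w_C, is invariant and has
the right moments.  It is the only such measure ([finite_spectral_unique]): the
pair (chi1, chi2) is real valued and separates Weyl orbits ([chi_separates]), so
a nonnegative polynomial in the two characters which vanishes exactly on the
finite support shows that any other solution lives on the same support, where
every invariant function agrees with a polynomial in the characters.

Comparison.  The densities J^2 on the sixth and seventh roots of unity, and K on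
the fourth, take rational values (up to powers of pi).  Once these are known,
the formula for epsilon becomes an equality of integer combinations of Dirac
masses on the grids (Z/12)^2 and (Z/7)^2, decided by evaluation
([same_weights12], [same_weights7]); the classes of elements of order 8
contribute the orbit of (mu, t) on both sides ([epsPGL27_orbits]). *)

(** * A computational model of PGL(2, 7) *)

(** The field with 7 elements as an enumerated type: the sweeps over all of
PGL(2, 7) below run inside the kernel, where the arithmetic of 'F_7 does not
evaluate in reasonable time. *)
Inductive F7 := f0 | f1 | f2 | f3 | f4 | f5 | f6.
Definition nat_of_F7 x : nat :=
  match x with f0 => 0 | f1 => 1 | f2 => 2 | f3 => 3 | f4 => 4 | f5 => 5 | f6 => 6 end.
Definition F7_of_nat (n : nat) : F7 := nth f0 [:: f0; f1; f2; f3; f4; f5; f6] n.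
Definition S7 x := match x with
  f0 => f1 | f1 => f2 | f2 => f3 | f3 => f4 | f4 => f5 | f5 => f6 | f6 => f0 end.
Definition add7 x y := match x with
  | f0 => y | f1 => S7 y | f2 => S7 (S7 y) | f3 => S7 (S7 (S7 y))
  | f4 => S7 (S7 (S7 (S7 y))) | f5 => S7 (S7 (S7 (S7 (S7 y))))
  | f6 => S7 (S7 (S7 (S7 (S7 (S7 y))))) end.
Definition opp7 x := match x with
  f0 => f0 | f1 => f6 | f2 => f5 | f3 => f4 | f4 => f3 | f5 => f2 | f6 => f1 end.
Definition mul7 x y := match x with
  | f0 => f0 | f1 => y | f2 => add7 y y | f3 => add7 y (add7 y y)
  | f4 => opp7 (add7 y (add7 y y)) | f5 => opp7 (add7 y y) | f6 => opp7 y end.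
Definition inv7 x := match x with
  f0 => f0 | f1 => f1 | f2 => f4 | f3 => f5 | f4 => f2 | f5 => f3 | f6 => f6 end.
Definition eq7 x y := match x, y with
  | f0, f0 | f1, f1 | f2, f2 | f3, f3 | f4, f4 | f5, f5 | f6, f6 => true
  | _, _ => false end.

(** A point of PGL(2, 7) is represented by the matrix of its class whose first
nonzero entry in the first row is 1 ([qok]); [qnorm] rescales to that form, so
that [qmul] is the group law. *)
Record quad := Quad { qa : F7; qb : F7; qc : F7; qd : F7 }.
Definition qeq s t :=
  [&& eq7 (qa s) (qa t), eq7 (qb s) (qb t), eq7 (qc s) (qc t) & eq7 (qd s) (qd t)].
Lemma eq7P x y : reflect (x = y) (eq7 x y).
Proof. by apply: (iffP idP) => [|->]; case: x => //; case: y. Qed.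
HB.instance Definition _ := hasDecEq.Build F7 eq7P.
Lemma qeqP s t : reflect (s = t) (qeq s t).
Proof.
apply: (iffP and4P) => [|->]; last by split; apply/eq7P.
by case: s t => [a b c d] [a' b' c' d'] /= [/eq7P-> /eq7P-> /eq7P-> /eq7P->].
Qed.
HB.instance Definition _ := hasDecEq.Build quad qeqP.

Definition qraw s t :=
  let: Quad a b c d := s in let: Quad a' b' c' d' := t in
  Quad (add7 (mul7 a a') (mul7 b c')) (add7 (mul7 a b') (mul7 b d'))
       (add7 (mul7 c a') (mul7 d c')) (add7 (mul7 c b') (mul7 d d')).
Definition qscale l s :=
  let: Quad a b c d := s in Quad (mul7 l a) (mul7 l b) (mul7 l c) (mul7 l d).
Definition qdet s := add7 (mul7 (qa s) (qd s)) (opp7 (mul7 (qb s) (qc s))).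
Definition qlead s := match qa s with f0 => qb s | a => a end.
Definition qnorm s := qscale (inv7 (qlead s)) s.
Definition qmul s t := qnorm (qraw s t).
Definition q1 := Quad f1 f0 f0 f1.
Definition qok s := eq7 (qlead s) f1 && ~~ eq7 (qdet s) f0.
Definition enum_F7 := [:: f0; f1; f2; f3; f4; f5; f6].
Definition enum_quad : seq quad :=
  seq.filter qok [seq Quad ab.1 ab.2 cd.1 cd.2 | ab <- [seq (a, b) | a <- enum_F7, b <- enum_F7],
                                   cd <- [seq (a, b) | a <- enum_F7, b <- enum_F7]].
Definition qexp s n := iter n (qmul s) q1.
Definition qconj s r := has (fun t => qeq (qmul s t) (qmul t r)) enum_quad.
(** Elements of order 8, 6 and 7.  Together with 1, the powers of the first two
and the third meet every conjugacy class. *)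
Definition qh := Quad f0 f1 f1 f1.
Definition qk := Quad f0 f1 f1 f2.
Definition qu := Quad f0 f1 f3 f3.
Definition qreps : seq quad :=
  [:: q1; qexp qh 4; qexp qk 3; qexp qk 2; qexp qh 2; qexp qk 1; qexp qu 1; qexp qh 1; qexp qh 3].
(** The position in [qreps] of the class of [s].  The invariant tr^2 / det
separates the classes of PGL(2, 7) except at tr = 0, where the two classes of
involutions are told apart by whether det is a square, and at tr^2 = 4 det,
where the identity and the elements of order 7 meet. *)
Definition qkey s : nat :=
  let t := add7 (qa s) (qd s) in
  match mul7 (mul7 t t) (inv7 (qdet s)) with
  | f0 => match qdet s with f1 | f2 | f4 => 1 | _ => 2 end
  | f1 => 3 | f2 => 4 | f3 => 5 | f4 => if qeq s q1 then 0 else 6 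
  | f5 => 8 | f6 => 7 end.

Definition F7_val x : 'F_7 := (nat_of_F7 x)%:R.
Lemma F7_valD x y : F7_val (add7 x y) = F7_val x + F7_val y.
Proof. by apply/val_inj; case: x; case: y. Qed.
Lemma F7_valM x y : F7_val (mul7 x y) = F7_val x * F7_val y.
Proof. by apply/val_inj; case: x; case: y. Qed.
Lemma F7_valN x : F7_val (opp7 x) = - F7_val x.
Proof. by apply/val_inj; case: x. Qed.
Lemma F7_val_eq0 x : (F7_val x == 0) = eq7 x f0.
Proof. by case: x. Qed.
Lemma F7_val_inj : injective F7_val.
Proof. by move=> x y /(congr1 val); case: x; case: y. Qed.
Lemma F7_valV x : F7_val (inv7 x) = (F7_val x)^-1.
Proof.
case: (boolP (F7_val x == 0)) => [x0|x0]; first by rewrite (eqP x0) invr0; case: x x0.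
by apply: (mulIf x0); rewrite mulVf //; apply/val_inj; case: x x0.
Qed.
Lemma F7_val_surj (z : 'F_7) : exists x, F7_val x = z.
Proof.
exists (F7_of_nat z); apply/val_inj.
by case: z; do 7?[case=> //].
Qed.
Definition mxq s : 'M['F_7]_2 := \matrix_(i, j)
  F7_val (if i == 0 then if j == 0 then qa s else qb s else if j == 0 then qc s else qd s).

Lemma mx2P (A B : 'M['F_7]_2) :
  [/\ A 0 0 = B 0 0, A 0 1 = B 0 1, A 1 0 = B 1 0 & A 1 1 = B 1 1] -> A = B.
Proof.
case=> h1 h2 h3 h4; apply/matrixP => i j.
have h (k : 'I_2) : k = 0 \/ k = 1 by case: k; case=> [|[|//]] hk; [left|right]; apply/val_inj.
by case: (h i) => ->; case: (h j) => ->.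
Qed.
Lemma mxq_raw s t : mxq (qraw s t) = mxq s *m mxq t.
Proof.
case: s t => [a b c d] [a' b' c' d']; apply: mx2P.
by split; rewrite !mxE big_ord_recl big_ord1 !mxE /= F7_valD !F7_valM.
Qed.
Lemma mxq_scale l s : mxq (qscale l s) = F7_val l *: mxq s.
Proof. by case: s => [a b c d]; apply: mx2P; split; rewrite !mxE /= F7_valM. Qed.
Lemma det_mxq s : \det (mxq s) = F7_val (qdet s).
Proof.
rewrite (expand_det_row _ 0) big_ord_recl big_ord1 /cofactor !det_mx11 !mxE /=.
by rewrite F7_valD F7_valN !F7_valM expr0 expr1 mul1r mulN1r mulrN.
Qed.
Lemma mxq_inj : injective mxq.
Proof.
move=> [a b c d] [a' b' c' d'] /matrixP h.
have := (h 0 0, h 0 1, h 1 0, h 1 1); rewrite !mxE /= => -[[[]]].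
by do 4!move=> /F7_val_inj ->.
Qed.

Lemma coset_eq_mulV (gT : finGroupType) (H : {group gT}) x y :
  x \in 'N(H)%g -> y \in 'N(H)%g -> coset H x = coset H y -> (x * y^-1)%g \in H.
Proof. by move=> Nx Ny /(rcoset_kercosetP Nx Ny); rewrite mem_rcoset. Qed.

Section ScalarCosets.
Variable F : finFieldType.
Local Notation GL := {'GL_2[F]}.
Local Notation Z := ('Z([set: GL]%SET))%g.

Lemma norm_centerGL (g : GL) : g \in 'N(Z)%g.
Proof.
by have /fintype.subsetP := normal_norm (center_normal [set: GL]%G); apply; rewrite inE.
Qed.

Lemma scalar_center (z : GL) c : GLval z = c%:M -> z \in Z.
Proof.
move=> zc; apply/centerP; rewrite inE; split=> // y _; apply/val_inj.
by change (GLval z *m GLval y = GLval y *m GLval z); rewrite zc scalar_mxC.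
Qed.

(** Proportional matrices have the same class modulo the centre: this and its
variants below let one work with matrices rather than with cosets, whose
membership proofs do not compute. *)
Lemma coset_scale (g h : GL) c : GLval g = c *: GLval h -> coset Z g = coset Z h.
Proof.
move=> e; rewrite -[g](mulgKV h) morphM ?norm_centerGL //= coset_id ?mul1g //.
apply: (@scalar_center _ c); rewrite GL_MxE e GL_VxE -scalemxAl mulmxV ?scalemx1 //.
exact: GL_unitmx.
Qed.

Lemma coset_scaleM (g h k : GL) c :
  GLval k = c *: (GLval g *m GLval h) -> coset Z k = (coset Z g * coset Z h)%g.
Proof.
rewrite -GL_MxE => /coset_scale ->; by rewrite morphM ?norm_centerGL.
Qed.

Lemma coset_scale_eq (g h : GL) (A B : 'M[F]_2) c :
  GLval g = A -> GLval h = B -> A = c *: B -> coset Z g = coset Z h.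
Proof. by move=> <- <-; exact: coset_scale. Qed.

Lemma coset_scaleM_eq (g h k : GL) (A B C : 'M[F]_2) c :
  GLval g = A -> GLval h = B -> GLval k = C -> C = c *: (A *m B) ->
  coset Z k = (coset Z g * coset Z h)%g.
Proof. by move=> <- <- <-; exact: coset_scaleM. Qed.

Lemma coset_eq_center (g h : GL) : coset Z g = coset Z h -> (g * h^-1)%g \in Z.
Proof.
exact: (@coset_eq_mulV _ ('Z([set: GL]%G))%G g h (norm_centerGL g) (norm_centerGL h)).
Qed.

Lemma center_comm (z g : GL) : z \in Z -> GLval z *m GLval g = GLval g *m GLval z.
Proof. by move=> /centerP[_ cz]; rewrite -!GL_MxE cz ?inE. Qed.

Lemma GLval_insubd (A : 'M[F]_2) : \det A != 0 -> GLval (insubd (1%g : GL) A) = A.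
Proof. by move=> h; rewrite /GLval /insubd insubT //= ?[_ \is a _]unitmxE ?unitfE. Qed.

Lemma coset_insubd (g : GL) : coset Z (insubd (1%g : GL) (GLval g)) = coset Z g.
Proof.
congr (coset Z _); apply/val_inj; apply: GLval_insubd.
by have := GL_unitmx g; rewrite unitmxE unitfE.
Qed.

Lemma mulGL_scale (g h : GL) c : GLval (g * h^-1)%g = c%:M -> GLval g = c *: GLval h.
Proof. by move=> hc; rewrite -[g](mulgKV h) GL_MxE hc mul_scalar_mx. Qed.

Lemma det_GL (g : GL) : \det (GLval g) != 0.
Proof. by have := GL_unitmx g; rewrite unitmxE unitfE. Qed.

Lemma mem_coset_center (g : GL) : coset Z g \in ([set: GL] / Z)%g.
Proof. by apply: mem_morphim; rewrite ?norm_centerGL ?inE. Qed.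

Lemma coset_center_surj x : x \in ([set: GL] / Z)%g -> exists g : GL, x = coset Z g.
Proof. by case/morphimP => g _ _ ->; exists g. Qed.
End ScalarCosets.

Local Notation GL27 := {'GL_2['F_7]}.
Local Notation Z27 := ('Z([set: GL27]%SET))%g.
Definition qG s : GL27 := insubd (1%g : GL27) (mxq s).
Definition pi7 s : coset_of Z27 := coset Z27 (qG s).

Lemma qGE s : ~~ eq7 (qdet s) f0 -> GLval (qG s) = mxq s.
Proof. by move=> h; apply: GLval_insubd; rewrite det_mxq F7_val_eq0. Qed.

Lemma qG_scaleM s t r l : ~~ eq7 (qdet s) f0 -> ~~ eq7 (qdet t) f0 -> ~~ eq7 (qdet r) f0 ->
  r = qscale l (qraw s t) -> pi7 r = (pi7 s * pi7 t)%g.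
Proof.
move=> ds dt dr e; apply: (coset_scaleM_eq (qGE ds) (qGE dt) (qGE dr) (c := F7_val l)).
by rewrite e mxq_scale mxq_raw.
Qed.
Lemma qmat_surj (A : 'M['F_7]_2) : exists s, mxq s = A.
Proof.
have [a ha] := F7_val_surj (A 0 0); have [b hb] := F7_val_surj (A 0 1).
have [c hc] := F7_val_surj (A 1 0); have [d hd] := F7_val_surj (A 1 1).
by exists (Quad a b c d); apply: mx2P; split; rewrite !mxE.
Qed.

Lemma qlead_neq0 s : ~~ eq7 (qdet s) f0 -> ~~ eq7 (qlead s) f0.
Proof. by apply: contra; case: s => [[]// []// []// []]. Qed.

Lemma qok_norm s : ~~ eq7 (qdet s) f0 -> qok (qnorm s).
Proof.
move=> ds; have ls := qlead_neq0 ds.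
have vl : F7_val (qlead s) != 0 by rewrite F7_val_eq0.
have dn : ~~ eq7 (qdet (qnorm s)) f0.
  by rewrite -F7_val_eq0 -det_mxq mxq_scale detZ det_mxq mulf_neq0 ?F7_val_eq0 // expf_neq0 // F7_valV invr_neq0.
rewrite /qok dn andbT; apply/eq7P.
suff -> : qlead (qnorm s) = mul7 (inv7 (qlead s)) (qlead s).
  by apply: F7_val_inj; rewrite F7_valM F7_valV mulVf.
by case: s {dn ds ls vl} => [[] [] c d].
Qed.

Lemma pi7_norm s : ~~ eq7 (qdet s) f0 -> pi7 (qnorm s) = pi7 s.
Proof.
move=> ds; have /andP[_ dn] := qok_norm ds.
exact: coset_scale_eq (qGE dn) (qGE ds) (mxq_scale _ _).
Qed.

Lemma qdet_raw s t : qok s -> qok t -> ~~ eq7 (qdet (qraw s t)) f0.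
Proof.
case/andP=> _ ds /andP[_ dt].
by rewrite -F7_val_eq0 -det_mxq mxq_raw det_mulmx !det_mxq mulf_neq0 // F7_val_eq0.
Qed.

Lemma qok_mul s t : qok s -> qok t -> qok (qmul s t).
Proof. by move=> os ot; exact: qok_norm (qdet_raw os ot). Qed.

Lemma pi7M s t : qok s -> qok t -> pi7 (qmul s t) = (pi7 s * pi7 t)%g.
Proof.
move=> os ot; have /andP[_ dm] := qok_mul os ot.
have [/andP[_ ds] /andP[_ dt]] := (os, ot).
exact: qG_scaleM ds dt dm (erefl _).
Qed.

Lemma pi7_1 : pi7 q1 = 1%g.
Proof.
apply: coset_id; apply: (@scalar_center _ _ 1).
rewrite (@qGE q1 isT).
by apply: mx2P; split; rewrite !mxE.
Qed.

Lemma pi7_surj x : x \in PGL27 -> exists2 s, qok s & pi7 s = x.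
Proof.
case/coset_center_surj => g ->; have [s hs] := qmat_surj (GLval g).
have ds : ~~ eq7 (qdet s) f0 by rewrite -F7_val_eq0 -det_mxq hs; exact: det_GL.
exists (qnorm s); first exact: qok_norm.
by rewrite (pi7_norm ds) /pi7 /qG hs; exact: coset_insubd.
Qed.

Lemma pi7_mem s : pi7 s \in PGL27.
Proof. exact: mem_coset_center. Qed.

(** A matrix commuting with the two elementary transvections is scalar. *)
Lemma center_scalar (z : GL27) : z \in Z27 -> exists c, GLval z = c%:M.
Proof.
move=> cz; have [s hs] := qmat_surj (GLval z).
have com t : ~~ eq7 (qdet t) f0 -> qraw s t = qraw t s.
  move=> dt; apply: mxq_inj; have := center_comm (qG t) cz.
  by rewrite (qGE dt) -hs !mxq_raw.
have e1 := com (Quad f1 f1 f0 f1) isT; have e2 := com (Quad f1 f0 f1 f1) isT.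
exists (F7_val (qa s)); rewrite -hs; case: s e1 e2 {hs com} => a b c d e1 e2.
have [-> -> ->] : [/\ b = f0, c = f0 & d = a].
  by move: e1 e2; clear; case: a; case: b => //; case: c => //; case: d.
by apply: mx2P; split; rewrite !mxE.
Qed.

Lemma pi7_inj s t : qok s -> qok t -> pi7 s = pi7 t -> s = t.
Proof.
case/andP=> /eq7P ls ds /andP[/eq7P lt dt] /coset_eq_center/center_scalar[c hc].
have [l vl] := F7_val_surj c.
have h : s = qscale l t.
  apply: mxq_inj; rewrite mxq_scale -(qGE ds) -(qGE dt) vl.
  exact: mulGL_scale hc.
have l1 : l = f1.
  move: ls lt; rewrite h; clear; case: t => a b c d; rewrite /qlead /=.
  by case: a; case: b => //; case: l.
by rewrite h l1; case: t {h lt dt hc}.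
Qed.

Lemma mem_enum_quad s : (s \in enum_quad) = qok s.
Proof.
rewrite mem_filter andb_idr // => _; case: s => a b c d.
have memL x : x \in enum_F7 by case: x.
by apply: (allpairs_f (fun ab cd : F7 * F7 => Quad ab.1 ab.2 cd.1 cd.2)
  (x := (a, b)) (y := (c, d))); apply: allpairs_f.
Qed.

Lemma enum_quad_uniq : uniq enum_quad. Proof. by vm_compute. Qed.

(** Conjugacy of each element with its representative, by search for a
conjugating element. *)
Lemma qrep_conj : all (fun s => qconj s (nth q1 qreps (qkey s))) enum_quad.
Proof. by vm_compute. Qed.

Lemma qkey_perm : perm_eq (map qkey enum_quad)
  (nseq 1 0 ++ nseq 21 1 ++ nseq 28 2 ++ nseq 56 3 ++ nseq 42 4 ++ nseq 56 5 ++
   nseq 48 6 ++ nseq 42 7 ++ nseq 42 8)%N.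
Proof. by vm_compute. Qed.

Lemma conjg_commP (gT : finGroupType) (x y t : gT) :
  (x * t = t * y)%g -> x = (y ^ t^-1)%g.
Proof. by move=> e; apply: (mulIg t); rewrite e /conjg invgK -mulgA mulgKV. Qed.

Opaque enum_quad qmul qok qdet.

(** The results of the sweeps are transported along an abstract surjection [pi].
The carrier of PGL(2, 7) is a type of cosets of a centre in GL(2, 7), which must
not be unfolded by conversion; keeping it abstract ensures that. *)
Section Transport.
Variables (gT : finGroupType) (G : {group gT}) (pi : quad -> gT).
Hypotheses (piM : forall s t, qok s -> qok t -> pi (qmul s t) = (pi s * pi t)%g)
  (pi1 : pi q1 = 1%g) (pi_mem : forall s, pi s \in G)
  (pi_surj : forall x, x \in G -> exists2 s, qok s & pi s = x)
  (pi_inj : forall s t, qok s -> qok t -> pi s = pi t -> s = t).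
Arguments piM {s t}.
Arguments pi_inj {s t}.

Lemma qok_exp s n : qok s -> qok (qexp s n).
Proof. by move=> os; elim: n => //= n ih; apply: qok_mul. Qed.

Lemma piX s n : qok s -> pi (qexp s n) = (pi s ^+ n)%g.
Proof.
move=> os; elim: n => [|n ih]; first exact: pi1.
by rewrite expgS -ih -piM // qok_exp.
Qed.

Lemma mem_map_pi x : (x \in map pi enum_quad) = (x \in G).
Proof.
apply/mapP/idP => [[s _ ->]|/pi_surj[s os <-]]; first exact: pi_mem.
by exists s; rewrite ?mem_enum_quad.
Qed.

Lemma uniq_map_pi : uniq (map pi enum_quad).
Proof.
have inj : {in enum_quad &, injective pi} by move=> s t; rewrite !mem_enum_quad => os ot; exact: (pi_inj os ot).
exact: etrans (map_inj_in_uniq inj) enum_quad_uniq.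
Qed.

Lemma card_model_pred (P : pred (gT)) :
  #|[set x in G | P x]| = count (fun s => P (pi s)) enum_quad.
Proof.
rewrite -(count_map pi P) -size_filter -(card_uniqP (filter_uniq P uniq_map_pi)).
by apply: eq_card => x; rewrite inE mem_filter mem_map_pi andbC.
Qed.

Lemma card_model : #|G| = 336%N.
Proof.
transitivity #|[set x in G | true]|; first by apply: eq_card => x; rewrite inE andbT.
by rewrite card_model_pred count_predT.
Qed.

Lemma conj_pi s r : qok r -> qconj s r -> qok s ->
  exists2 y, y \in G & pi s = (pi r ^ y)%g.
Proof.
move=> or /hasP[t]; rewrite mem_enum_quad => ot /qeqP e os.
exists ((pi t)^-1)%g; first by rewrite groupV pi_mem.
by apply: conjg_commP; exact: etrans (esym (piM os ot)) (etrans (congr1 pi e) (piM ot or)).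
Qed.

(** The class size is the index of the centraliser, and the centraliser is
counted in the model. *)
Lemma card_class_pi s : qok s ->
  (#|(pi s ^: G)%g| * count (fun t => qmul s t == qmul t s) enum_quad)%N = 336%N.
Proof.
move=> os; rewrite -index_cent1 -card_model -(Lagrange (subsetIl G 'C[pi s]%g)) mulnC; congr (_ * _)%N.
rewrite -(eq_in_count (a1 := fun t => pi t \in 'C[pi s]%g)) -?card_model_pred.
  by apply: eq_card => x; rewrite !inE.
move=> t; rewrite mem_enum_quad => ot.
have e : (pi s * pi t == pi t * pi s)%g = (qmul s t == qmul t s).
  rewrite -(piM os ot) -(piM ot os); apply/eqP/eqP => [|-> //].
  exact: pi_inj (qok_mul os ot) (qok_mul ot os).
by apply/cent1P/idP => [/esym/eqP|]; rewrite -e // => /eqP/esym.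
Qed.

Local Notation gh := (pi qh).
Local Notation gk := (pi qk).
Local Notation gu := (pi qu).

(** The class equation of PGL(2, 7), in the form needed later: how to average a
class function. *)
Lemma sum_model (V : zmodType) (F : gT -> V) :
  {in G &, forall x y, F (x ^ y)%g = F x} ->
  \sum_(x in G) F x =
  F 1%g + F (gh ^+ 4)%g *+ 21 + F (gk ^+ 3)%g *+ 28 + F (gk ^+ 2)%g *+ 56 + F (gh ^+ 2)%g *+ 42
  + F gk *+ 56 + F gu *+ 48 + F gh *+ 42 + F (gh ^+ 3)%g *+ 42.
Proof.
move=> FJ; pose Fr (i : nat) := F (pi (nth q1 qreps i)).
have reps_ok i : qok (nth q1 qreps i) by do 9!(case: i => [|i]; first by vm_compute); rewrite nth_default //; vm_compute.
transitivity (\sum_(i <- map qkey enum_quad) Fr i).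
  transitivity (\sum_(x <- map pi enum_quad) F x).
    by rewrite (big_uniq _ uniq_map_pi); apply: eq_bigl => x; rewrite mem_map_pi.
  rewrite !big_map !big_seq; apply: eq_bigr => s Ls.
  have [y Gy ->] := conj_pi (reps_ok _) (allP qrep_conj s Ls) (etrans (esym (mem_enum_quad s)) Ls).
  by rewrite FJ ?pi_mem.
rewrite (perm_big _ qkey_perm) !big_cat !big_nseq !iter_addr_0.
rewrite /Fr /nth /qreps pi1.
have [oh ok ou] : [/\ qok qh, qok qk & qok qu] by split; vm_compute.
rewrite !(piX _ oh) !(piX _ ok) !(piX _ ou) !expg1 mulr1n.
(* Abstract multiples, which reassociation would unfold. *)
move: (F _ *+ 21) (F _ *+ 28) (F (gk ^+ 2)%g *+ 56) (F (gh ^+ 2)%g *+ 42)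
  (F gk *+ 56) (F gu *+ 48) (F gh *+ 42) (F _ *+ 42) => ? ? ? ? ? ? ? ?.
by rewrite /= !addrA.
Qed.

Lemma order2_pi s : qok s -> s != q1 -> qexp s 2 = q1 -> #[pi s]%g = 2%N.
Proof.
move=> os s1 s2; apply: nt_prime_order => //; first by rewrite -piX // s2 pi1.
by apply: contraNneq s1; rewrite -pi1 => /pi_inj->.
Qed.

Lemma involution21 : #[(gh ^+ 4)%g]%g = 2%N /\ #|((gh ^+ 4)%g ^: G)%g| = 21%N.
Proof.
have oh : qok qh by vm_compute.
rewrite -(piX _ oh); have o4 := qok_exp 4 oh.
split; first by apply: (order2_pi o4); vm_compute.
have := card_class_pi o4.
set c := count _ _; have -> : c = 16%N by vm_compute.
by move/eqP; rewrite -[336%N]/(21 * 16)%N eqn_pmul2r // => /eqP.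
Qed.

Lemma involution28 : #[(gk ^+ 3)%g]%g = 2%N /\ #|((gk ^+ 3)%g ^: G)%g| = 28%N.
Proof.
have ok : qok qk by vm_compute.
rewrite -(piX _ ok); have o3 := qok_exp 3 ok.
split; first by apply: (order2_pi o3); vm_compute.
have := card_class_pi o3.
set c := count _ _; have -> : c = 12%N by vm_compute.
by move/eqP; rewrite -[336%N]/(28 * 12)%N eqn_pmul2r // => /eqP.
Qed.

Lemma generators_order : [/\ gh ^+ 8 = 1, gk ^+ 6 = 1 & gu ^+ 7 = 1]%g.
Proof.
have e s n : qok s -> qexp s n = q1 -> (pi s ^+ n = 1)%g.
  by move=> os e; rewrite -(piX n os) e pi1.
by split; apply: e; vm_compute.
Qed.

Lemma conj_piX s n : qok s -> qconj (qexp s n) s ->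
  exists2 y, y \in G & (pi s ^+ n = pi s ^ y)%g.
Proof.
move=> os h; have [y Gy e] := conj_pi os h (qok_exp n os).
by exists y; rewrite -?piX.
Qed.

End Transport.

Definition gh := pi7 qh.
Definition gk := pi7 qk.
Definition gu := pi7 qu.
Lemma gh_mem : gh \in PGL27. Proof. exact: pi7_mem. Qed.
Lemma gk_mem : gk \in PGL27. Proof. exact: pi7_mem. Qed.
Lemma gu_mem : gu \in PGL27. Proof. exact: pi7_mem. Qed.

Lemma card_PGL27 : #|PGL27| = 336%N.
Proof. exact: (@card_model _ PGL27 pi7 pi7_mem pi7_surj (@pi7_inj)). Qed.

Lemma sum_PGL27 (V : zmodType) (F : coset_of 'Z([set: {'GL_2['F_7]}]%SET) -> V) :
  {in PGL27 &, forall x y, F (x ^ y)%g = F x} ->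
  \sum_(x in PGL27) F x =
  F 1%g + F (gh ^+ 4)%g *+ 21 + F (gk ^+ 3)%g *+ 28 + F (gk ^+ 2)%g *+ 56 + F (gh ^+ 2)%g *+ 42
  + F gk *+ 56 + F gu *+ 48 + F gh *+ 42 + F (gh ^+ 3)%g *+ 42.
Proof. exact: (@sum_model _ PGL27 pi7 (@pi7M) pi7_1 pi7_mem pi7_surj (@pi7_inj)). Qed.

Lemma inv21_PGL27 : #[(gh ^+ 4)%g]%g = 2%N /\ #|((gh ^+ 4)%g ^: PGL27)%g| = 21%N.
Proof. exact: (@involution21 _ PGL27 pi7 (@pi7M) pi7_1 pi7_mem pi7_surj (@pi7_inj)). Qed.
Lemma inv28_PGL27 : #[(gk ^+ 3)%g]%g = 2%N /\ #|((gk ^+ 3)%g ^: PGL27)%g| = 28%N.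
Proof. exact: (@involution28 _ PGL27 pi7 (@pi7M) pi7_1 pi7_mem pi7_surj (@pi7_inj)). Qed.
Lemma orders_PGL27 : [/\ gh ^+ 8 = 1, gk ^+ 6 = 1 & gu ^+ 7 = 1]%g.
Proof. exact: (@generators_order _ pi7 (@pi7M) pi7_1). Qed.
Lemma conj_PGL27 : [/\ exists2 y, y \in PGL27 & (gh ^+ 7 = gh ^ y)%g,
  exists2 y, y \in PGL27 & (gk ^+ 5 = gk ^ y)%g &
  exists2 y, y \in PGL27 & (gu ^+ 3 = gu ^ y)%g].
Proof.
by split; apply: (@conj_piX _ PGL27 pi7 (@pi7M) pi7_1 pi7_mem); vm_compute.
Qed.

(** * Class functions and eigenvalue multiplicities *)
Section Representations.
Variables (C : numClosedFieldType) (gT : finGroupType) (G : {group gT}).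

Lemma pchar'_group : ([pchar C]^'.-group G)%g.
Proof. by apply/pgroupP=> p _; rewrite inE /= pchar_num. Qed.

Lemma mxtrace_delta n (i j : 'I_n) : \tr (delta_mx i j : 'M[C]_n) = (i == j)%:R.
Proof.
rewrite /mxtrace (bigD1 i) //= mxE eqxx big1 ?addr0 // => k ki.
by rewrite mxE (negPf ki).
Qed.

(** For P = C B with B, C of full rank, P P = P forces B C = 1. *)
Lemma mxtrace_idempotent n (P : 'M[C]_n) : P *m P = P -> \tr P = (\rank P)%:R.
Proof.
move=> PP; rewrite -{1}(mulmx_base P) mxtrace_mulC.
suff -> : row_base P *m col_base P = 1%:M by rewrite mxtrace1.
apply: (row_free_inj (row_base_free P)); rewrite mul1mx.
have /row_fullP[B BK] := col_base_full P.
have {}PP : (col_base P *m row_base P) *m (col_base P *m row_base P) = col_base P *m row_base P.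
  by rewrite mulmx_base.
move: (col_base P) (row_base P) BK PP => A D BK /(congr1 (mulmx B)).
by rewrite !mulmxA BK !mul1mx.
Qed.

Variables (n : nat) (rG : mx_representation C G n).

Lemma mxtrace_repr_conj x y : x \in G -> y \in G -> \tr (rG (x ^ y)%g) = \tr (rG x).
Proof.
move=> Gx Gy; rewrite /conjg !repr_mxM ?groupM ?groupV // mxtrace_mulC.
by rewrite -mulmxA -repr_mxM ?groupV // mulgV repr_mx1 mulmx1.
Qed.

(** The image of the sum over the group consists of fixed vectors, and an
irreducible representation with a nonzero fixed vector is trivial. *)
Lemma sum_repr_irr : mx_irreducible rG -> (exists2 x, x \in G & rG x != 1%:M) ->
  \sum_(x in G) rG x = 0.
Proof.
move=> irrG [y Gy ny]; set e := \sum_(x in G) rG x.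
have eG x : x \in G -> e *m rG x = e.
  move=> Gx; rewrite mulmx_suml [RHS](reindex_inj (mulIg x)) /=.
  apply: eq_big => z; first by rewrite groupMr.
  by move=> Gz; rewrite repr_mxM.
have sub : (e <= rfix_mx rG G)%MS by apply/rfix_mxP.
apply/eqP; apply: contraNT ny => ne; apply/eqP.
have /mx_irrP[_ /(_ _ (rfix_mx_module rG))] := irrG.
case/(_ _)/row_fullP => [|B hB]; first by apply: contraNneq ne => f0; rewrite -submx0 -f0.
by rewrite -[rG y]mul1mx -hB -mulmxA rfix_mx_id.
Qed.

Lemma sum_mxtrace_irr : mx_irreducible rG -> (exists2 x, x \in G & rG x != 1%:M) ->
  \sum_(x in G) \tr (rG x) = 0.
Proof. by move=> i h; rewrite -raddf_sum /= sum_repr_irr // linear0. Qed.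

(** Schur orthogonality for one irreducible representation: averaging X over the
group gives an intertwiner, hence the scalar tr X / n, and the sum is assembled
from the cases where X is an elementary matrix. *)
Lemma norm_mxtrace_irr : mx_irreducible rG ->
  \sum_(x in G) \tr (rG x^-1%g) * \tr (rG x) = #|G|%:R.
Proof.
move=> irrG; have absG : mx_absolutely_irreducible rG.
  exact: group_closure_closed_field.
have n0 : n%:R != 0 :> C by rewrite pnatr_eq0 -lt0n; case/andP: absG.
pose Y X := \sum_(x in G) rG x^-1%g *m X *m rG x.
have Ysc X : Y X = (#|G|%:R * \tr X / n%:R)%:M.
  have : is_scalar_mx (Y X).
    apply: (mx_abs_irr_cent_scalar absG); apply/centgmxP => y Gy.
    rewrite mulmx_suml mulmx_sumr [RHS](reindex_inj (mulIg y)) /=.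
    apply: eq_big => [z|z Gz]; first by rewrite groupMr.
    rewrite invMg !repr_mxM ?groupV // !mulmxA -[rG y *m rG _]repr_mxM ?groupV //.
    by rewrite mulgV repr_mx1 mul1mx.
  case/is_scalar_mxP => a Ya; rewrite Ya; congr (_%:M).
  have : \tr (Y X) = #|G|%:R * \tr X.
    rewrite raddf_sum /= (eq_bigr (fun=> \tr X)) ?sumr_const ?mulr_natl // => x Gx.
    by rewrite mxtrace_mulC mulmxA -repr_mxM ?groupV // mulgV repr_mx1 mul1mx.
  by rewrite Ya mxtrace_scalar => <-; rewrite -[a *+ n]mulr_natr mulfK.
transitivity (\sum_(i < n) \sum_(j < n) (Y (delta_mx i j)) i j).
  transitivity (\sum_(x in G) \sum_(i < n) \sum_(j < n)
      (rG x^-1%g *m delta_mx i j *m rG x) i j); last first.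
    rewrite exchange_big; apply: eq_bigr => i _; rewrite exchange_big.
    by apply: eq_bigr => j _; rewrite summxE.
  apply: eq_bigr => x Gx; rewrite /mxtrace mulr_suml; apply: eq_bigr => i _.
  rewrite mulr_sumr; apply: eq_bigr => j _.
  rewrite mxE (bigD1 j) //= mxE (bigD1 i) //= mxE !eqxx mulr1.
  rewrite big1 ?addr0 => [|k ki]; last by rewrite mxE (negPf ki) mulr0.
  rewrite big1 ?addr0 // => k kj.
  by rewrite mxE big1 ?mul0r // => l _; rewrite mxE (negPf kj) andbF mulr0.
have e i : \sum_(j < n) Y (delta_mx i j) i j = #|G|%:R / n%:R.
  rewrite (bigD1 i) //= big1 ?addr0 => [|j ji].
    by rewrite Ysc mxE eqxx mxtrace_delta eqxx mulr1.
  by rewrite Ysc mxE mxtrace_delta eq_sym (negPf ji) mulr0 mul0r mul0rn.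
transitivity (\sum_(i < n) (#|G|%:R / n%:R : C)); first by apply: eq_bigr => i _; exact: e.
rewrite sumr_const card_ord; move: n0 (#|G|%:R : C) => n0 c.
by rewrite -[_ *+ n]mulr_natr divfK.
Qed.

(** The sum is N times the multiplicity of z^-1 as an eigenvalue of x, because
N^-1 times the sum of the z^k x^k is the projection onto that eigenspace; its
trace is its rank, so no diagonalisation is needed. *)
Lemma eigen_multiplicity x N (z : C) : x \in G -> (x ^+ N = 1)%g -> (0 < N)%N ->
  z ^+ N = 1 ->
  exists m : nat, \sum_(k < N) z ^+ k * \tr (rG (x ^+ k)%g) = (N * m)%:R.
Proof.
move=> Gx xN N0 zN; pose A k := z ^+ k *: rG (x ^+ k)%g.
have AD k l : A k *m A l = A (k + l)%N.
  by rewrite /A -scalemxAl -scalemxAr scalerA -exprD -repr_mxM ?groupX // -expgD.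
have AN : A N = 1%:M by rewrite /A xN repr_mx1 zN scale1r.
pose S := \sum_(k < N) A k.
have A1S : A 1%N *m S = S.
  case: (N) N0 @S AN => // M _ S AN.
  rewrite mulmx_sumr big_ord_recr /= AD add1n AN [S in RHS]big_ord_recl addrC.
  by congr (_ + _); [rewrite /A expr0 scale1r repr_mx1 | apply: eq_bigr => k _; rewrite AD add1n].
have AkS k : A k *m S = S.
  elim: k => [|k ih]; first by rewrite /A expr0 scale1r repr_mx1 mul1mx.
  by rewrite -addn1 -AD -mulmxA A1S.
have SS : S *m S = N%:R *: S.
  by rewrite {1}/S mulmx_suml (eq_bigr (fun=> S)) // sumr_const card_ord scaler_nat.
have N0' : N%:R != 0 :> C by rewrite pnatr_eq0 -lt0n.
exists (\rank (N%:R^-1 *: S)).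
rewrite natrM -mxtrace_idempotent; last first.
  by rewrite -scalemxAl -scalemxAr SS (scalerA _ N%:R) mulVf // scale1r.
rewrite linearZ /= mulrA divff // mul1r raddf_sum /=.
by apply: eq_bigr => k _; rewrite linearZ.
Qed.

End Representations.

(** * Moments of the McKay graphs *)
Section McKayMoments.
Variables (C : numClosedFieldType) (gT : finGroupType) (G : {group gT}).
Local Notation irr := (irreps C G).

Lemma mxtrace_irr_mult n (rG : mx_representation C G n) x : x \in G ->
  \tr (rG x) = \sum_(i : irr) (irr_mult rG i)%:R * \tr (irr_repr i x).
Proof.
move=> Gx; have C'G := pchar'_group C G.
pose sG := DecSocleType rG.
have S1 : (Socle sG :=: 1%:M)%MS.
  by rewrite (reducible_Socle1 sG (mx_Maschke_pchar rG C'G)).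
rewrite -(mxtrace_submod1 (Socle_module sG) S1) // mxtrace_Socle //.
rewrite (partition_big (fun W : sG => irr_comp irr (socle_repr W)) xpredT) //=.
apply: eq_bigr => i _; rewrite /irr_mult natr_sum mulr_suml.
apply: eq_bigr => W /eqP <-; rewrite mulr_natl; congr (_ *+ _).
apply: mxtrace_rsim => //; apply: rsim_irr_comp_pchar => //; exact: socle_irr.
Qed.

Lemma sum_mxtrace_irr_repr (i : irr) :
  \sum_(x in G) \tr (irr_repr i x) = (if i == [1 irr]%irr then #|G|%:R else 0).
Proof.
have C'G := pchar'_group C G.
case: eqP => [->|/eqP i1].
  rewrite (eq_bigr (fun=> 1)) ?sumr_const // => x Gx.
  by rewrite irr1_repr // mxtrace1 degree_irr1.
apply: sum_mxtrace_irr; first exact: socle_irr.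
apply/exists_inP; apply: contraNT i1; rewrite negb_exists_in => /forall_inP triv.
have {}triv x : x \in G -> irr_repr i x = 1%:M by move=> /triv; rewrite negbK => /eqP.
have ker : G \subset rker (irr_repr i).
  by apply/fintype.subsetP => x Gx; apply/rkerP; split; last exact: triv.
have sub : (socle_base i <= [1 irr]%irr)%MS.
  rewrite irr1_rfix -rfix_mx_rstabC ?subxx //.
  exact: (etrans (congr1 (fun A : {set gT} => G \subset A) (esym (rker_submod (socle_module i)))) ker).
rewrite -(irr_reprK_pchar C'G i); apply/eqP.
exact: irr_comp_id_pchar (socle_simple i) sub.
Qed.

(** For each group element x, the vector of the values at x of the irreducible
characters is an eigenvector of the McKay matrix of r with eigenvalue tr r(x).
Summed over the group these vectors give #|G| times the basis vector of the
trivial representation, by orthogonality. *)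
Lemma mckay_moment_average n1 n2 (r1 : mx_representation C G n1) (r2 : mx_representation C G n2) a b :
  (mckay r1 ^+ a *m mckay r2 ^+ b) (triv_irrep C G) (triv_irrep C G) =
  #|G|%:R^-1 * \sum_(x in G) \tr (r1 x) ^+ a * \tr (r2 x) ^+ b.
Proof.
pose X x : 'cV[C]_#|irr| := \col_i \tr (irr_repr (enum_val i) x).
have eig n (r : mx_representation C G n) x k : x \in G ->
    mckay r ^+ k *m X x = \tr (r x) ^+ k *: X x.
  move=> Gx; have e1 : mckay r *m X x = \tr (r x) *: X x.
    apply/colP => i; rewrite !mxE.
    transitivity (\tr (prod_repr r (irr_repr (enum_val i)) x)); last exact: mxtrace_prod.
    rewrite mxtrace_irr_mult // [RHS](reindex (fun j : 'I_#|irr| => enum_val j)) /=;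
      last exact: onW_bij _ (enum_val_bij _).
    by apply: eq_bigr => j _; rewrite !mxE.
  elim: k => [|k ih]; first by rewrite expr0 mul1mx scale1r.
  by rewrite exprS -mulmxA ih -scalemxAr e1 scalerA exprSr.
have e0 : delta_mx (triv_irrep C G) ord0 = #|G|%:R^-1 *: \sum_(x in G) X x.
  apply/colP => i; rewrite !mxE summxE.
  under eq_bigr do rewrite mxE.
  rewrite sum_mxtrace_irr_repr; case: (i =P _) => [->|ne].
    rewrite /triv_irrep enum_rankK; do 2!case: eqP => // _.
    by rewrite mulVf // pnatr_eq0 -lt0n cardG_gt0.
  rewrite ifN ?mulr0 //; apply: contra_not_neq ne => e.
  by rewrite /triv_irrep -e enum_valK.
set M := _ *m _; transitivity ((M *m (delta_mx (triv_irrep C G) ord0 : 'cV_#|irr|)) (triv_irrep C G) ord0).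
  have dE j : (delta_mx (triv_irrep C G) ord0 : 'cV[C]_#|irr|) j ord0 = (j == triv_irrep C G)%:R.
    by rewrite mxE; rewrite eqxx andbT.
  rewrite [RHS]mxE (bigD1 (triv_irrep C G)) //= dE eqxx mulr1 big1 ?addr0 // => j jn.
  by rewrite dE (negPf jn) mulr0.
rewrite e0 -scalemxAr mulmx_sumr mxE summxE; congr (_ * _); apply: eq_bigr => x Gx.
rewrite /M -mulmxA eig // -scalemxAr eig // scalerA !mxE enum_rankK irr1_repr //.
by rewrite mxtrace1 degree_irr1 mulr1 mulrC.
Qed.
End McKayMoments.

(** * Characters of PGL(2, 7) from one value *)
Opaque gh gk gu.

Section RootsOfUnity.
Variable C : numClosedFieldType.

Lemma exists_prim8 : exists z : C, z ^+ 4 = -1.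
Proof. by exists (4.-root (-1)); rewrite rootCK. Qed.

Lemma exists_prim3 : exists z : C, z ^+ 2 = - 1 - z.
Proof.
have [z hz] := @solve_monicpoly C 2 (fun=> -1) isT; exists z.
by rewrite hz !big_ord_recl big_ord0; ring.
Qed.

Lemma exists_prim7 : exists z : C, z ^+ 6 = - (1 + z + z ^+ 2 + z ^+ 3 + z ^+ 4 + z ^+ 5).
Proof.
have [z hz] := @solve_monicpoly C 6 (fun=> -1) isT; exists z.
by rewrite hz !big_ord_recl big_ord0 /= /bump /=; ring.
Qed.

(** Integrality of character values at elements of small order.  The hypotheses
say that x is conjugate to suitable powers of itself, so that eigenvalues of x
come with their Galois conjugates; combining a few eigenvalue multiplicities then
expresses the values through integers, with the congruences that the Diophantine
analysis uses. *)
Section Multiplicities.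
Variables (gT : finGroupType) (G : {group gT}) (n : nat) (rG : mx_representation C G n).
Local Notation chi x := (\tr (rG x)).
Variable x : gT.
Hypothesis Gx : x \in G.
Let chi1 : chi 1%g = n%:R.
Proof. by rewrite repr_mx1 mxtrace1. Qed.

Lemma mxtrace_order2 : (x ^+ 2 = 1)%g -> exists a : int, n%:R - chi x = (2 * a)%:~R.
Proof.
move=> x2; have [|m] := eigen_multiplicity rG Gx x2 isT (z := -1); first by ring.
rewrite !big_ord_recl big_ord0 /= expg0 expg1 chi1 => e; exists m.
have -> : n%:R - chi x = (2 * m)%:R by rewrite -e; ring.
by ring.
Qed.

Lemma mxtrace_order3 : (x ^+ 3 = 1)%g -> chi (x ^+ 2)%g = chi x ->
  exists a : int, n%:R - chi x = (3 * a)%:~R.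
Proof.
move=> x3 h2; have [z z2] := exists_prim3.
have z3 : z ^+ 3 = 1 by rewrite exprS z2 mulrBr mulrN1 -expr2 z2; ring.
have [m] := eigen_multiplicity rG Gx x3 isT z3.
rewrite !big_ord_recl big_ord0 /= expg0 expg1 chi1 h2 expr0 expr1 z2 => e; exists m.
have -> : n%:R - chi x = (3 * m)%:R by rewrite -e; ring.
by ring.
Qed.

Lemma mxtrace_order4 : (x ^+ 4 = 1)%g -> chi (x ^+ 3)%g = chi x ->
  exists a b : int, chi x = a%:~R /\ n%:R - chi x = (2 * b)%:~R.
Proof.
move=> x4 h3.
have i4 : 'i ^+ 4 = 1 :> C by rewrite (exprM _ 2 2) sqrCi; ring.
have m4 : (-1) ^+ 4 = 1 :> C by ring.
have [m0] := eigen_multiplicity rG Gx x4 isT (expr1n _ 4).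
have [m1] := eigen_multiplicity rG Gx x4 isT i4.
have [m2] := eigen_multiplicity rG Gx x4 isT m4.
rewrite !big_ord_recl !big_ord0 /= /bump /= !expg0 !expg1 chi1 !h3 => e2 e1 e0.
rewrite -!/(bump _ _) /= in e0 e1 e2.
have E0 : (4 * m0)%:R = n%:R + 2 * chi x + chi (x ^+ 2)%g by rewrite -e0; ring.
have E2 : (4 * m2)%:R = n%:R - 2 * chi x + chi (x ^+ 2)%g by rewrite -e2; ring.
have E1 : (4 * m1)%:R = n%:R - chi (x ^+ 2)%g.
  by rewrite -e1 exprSr (exprS _ 2) sqrCi; ring.
have h4 : 4 != 0 :> C by rewrite pnatr_eq0.
exists (m0%:Z - m2%:Z), (m2%:Z + m1%:Z); split; apply: (mulfI h4).
  rewrite -[RHS]/(4 * (m0%:Z - m2%:Z)%:~R).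
  have -> : 4 * (m0%:Z - m2%:Z)%:~R = (4 * m0)%:R - (4 * m2)%:R :> C by ring.
  by rewrite E0 E2; ring.
have -> : 4 * (2 * (m2%:Z + m1%:Z))%:~R = 2 * ((4 * m2)%:R + (4 * m1)%:R) :> C by ring.
by rewrite E1 E2; ring.
Qed.

(** The integers come from the multiplicities m0, m1, m2, m3 of eigenvalues of
orders 1, 6, 3, 2. *)
Lemma mxtrace_order6 : (x ^+ 6 = 1)%g -> chi (x ^+ 5)%g = chi x -> chi (x ^+ 4)%g = chi (x ^+ 2)%g ->
  exists a b : int, chi x = a%:~R /\ chi x - chi (x ^+ 2)%g = (2 * b)%:~R.
Proof.
move=> x6 h5 h4; have [z z2] := exists_prim3.
have z3 : z ^+ 3 = 1 by rewrite exprS z2 mulrBr mulrN1 -expr2 z2; ring.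
have z4 : z ^+ 4 = z by rewrite exprS z3 mulr1.
have z5 : z ^+ 5 = z ^+ 2 by rewrite exprS z4 expr2.
have z6 : z ^+ 6 = 1 by rewrite (exprM _ 3 2) z3 expr1n.
have nz6 : (- z) ^+ 6 = 1 by rewrite exprNn z6; ring.
have m6 : (-1) ^+ 6 = 1 :> C by ring.
have [m0] := eigen_multiplicity rG Gx x6 isT (expr1n _ 6).
have [m1] := eigen_multiplicity rG Gx x6 isT nz6.
have [m2] := eigen_multiplicity rG Gx x6 isT z6.
have [m3] := eigen_multiplicity rG Gx x6 isT m6.
rewrite !big_ord_recl !big_ord0 /= /bump /= !expg0 !expg1 chi1 !h5 !h4 => e3 e2 e1 e0.
have E0 : (6 * m0)%:R = n%:R + 2 * chi x + 2 * chi (x ^+ 2)%g + chi (x ^+ 3)%g by rewrite -e0; ring.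
have E3 : (6 * m3)%:R = n%:R - 2 * chi x + 2 * chi (x ^+ 2)%g - chi (x ^+ 3)%g by rewrite -e3; ring.
have E2 : (6 * m2)%:R = n%:R - chi x - chi (x ^+ 2)%g + chi (x ^+ 3)%g.
  by rewrite -e2 z5 z4 z3 z2; ring.
have E1 : (6 * m1)%:R = n%:R + chi x - chi (x ^+ 2)%g - chi (x ^+ 3)%g.
  by rewrite -e1; ring: z2.
have h6 : 6 != 0 :> C by rewrite pnatr_eq0.
exists (m0%:Z - m3%:Z + m1%:Z - m2%:Z), (m1%:Z - m3%:Z); split; apply: (mulfI h6).
  have -> : 6 * (m0%:Z - m3%:Z + m1%:Z - m2%:Z)%:~R =
    (6 * m0)%:R - (6 * m3)%:R + (6 * m1)%:R - (6 * m2)%:R :> C by ring.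
  by rewrite E0 E1 E2 E3; ring.
have -> : 6 * (2 * (m1%:Z - m3%:Z))%:~R = 2 * ((6 * m1)%:R - (6 * m3)%:R) :> C by ring.
by rewrite E1 E3; ring.
Qed.

Lemma mxtrace_order7 : (x ^+ 7 = 1)%g -> (forall k, (0 < k < 7)%N -> chi (x ^+ k)%g = chi x) ->
  exists a : int, n%:R - chi x = (7 * a)%:~R.
Proof.
move=> x7 h; have [z z6] := exists_prim7.
have z7 : z ^+ 7 = 1 by rewrite exprSr z6; ring: z6.
have [m] := eigen_multiplicity rG Gx x7 isT z7.
rewrite !big_ord_recl big_ord0 /= /bump /= !expg0 chi1 !h // => e; exists m.
have -> : n%:R - chi x = (7 * m)%:R by rewrite -e z6; ring.
by ring.
Qed.

(** Here x is only assumed conjugate to its inverse, and the values at x and x^3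
are Galois conjugates in Z[sqrt 2]; the square root s of 2 is z - z^3, for z a
primitive eighth root of unity. *)
Lemma mxtrace_order8 : (x ^+ 8 = 1)%g -> chi (x ^+ 7)%g = chi x -> chi (x ^+ 5)%g = chi (x ^+ 3)%g ->
  chi (x ^+ 6)%g = chi (x ^+ 2)%g ->
  exists (s : C) (p q : int), [/\ s ^+ 2 = 2, chi x = p%:~R + s * q%:~R &
    chi (x ^+ 3)%g = p%:~R - s * q%:~R].
Proof.
move=> x8 h7 h5 h6; have [z z4] := exists_prim8.
have z5 : z ^+ 5 = - z by rewrite exprS z4 mulrN1.
have z6 : z ^+ 6 = - z ^+ 2 by rewrite exprS z5 mulrN expr2.
have z7 : z ^+ 7 = - z ^+ 3 by rewrite exprS z6 mulrN -exprS.
have z8 : z ^+ 8 = 1 by rewrite (exprM _ 4 2) z4; ring.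
have y8 : (z ^+ 3) ^+ 8 = 1 by rewrite exprAC z8 expr1n.
have m8 : (-1) ^+ 8 = 1 :> C by ring.
have [m0] := eigen_multiplicity rG Gx x8 isT (expr1n _ 8).
have [m1] := eigen_multiplicity rG Gx x8 isT z8.
have [m3] := eigen_multiplicity rG Gx x8 isT y8.
have [m4] := eigen_multiplicity rG Gx x8 isT m8.
rewrite !big_ord_recl !big_ord0 /= /bump /= !expg0 !expg1 chi1 !h7 !h6 !h5 => e4 e3 e1 e0.
pose t := z - z ^+ 3.
have t2 : t ^+ 2 = 2 by rewrite /t; ring: z4.
have E0 : (8 * m0)%:R = n%:R + 2 * chi x + 2 * chi (x ^+ 2)%g + 2 * chi (x ^+ 3)%g + chi (x ^+ 4)%g.
  by rewrite -e0; ring.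
have E4 : (8 * m4)%:R = n%:R - 2 * chi x + 2 * chi (x ^+ 2)%g - 2 * chi (x ^+ 3)%g + chi (x ^+ 4)%g.
  by rewrite -e4; ring.
have E1 : (8 * m1)%:R = n%:R - chi (x ^+ 4)%g + t * (chi x - chi (x ^+ 3)%g).
  by rewrite -e1 z7 z6 z5 z4 /t; ring.
have E3 : (8 * m3)%:R = n%:R - chi (x ^+ 4)%g - t * (chi x - chi (x ^+ 3)%g).
  rewrite -e3 -!exprM !mulnE /=.
  have zE k : z ^+ (8 + k) = z ^+ k by rewrite exprD z8 mul1r.
  rewrite -[9%N]/(8 + 1)%N -[12%N]/(8 + 4)%N -[15%N]/(8 + 7)%N -[18%N]/(8 + (8 + 2))%N -[21%N]/(8 + (8 + 5))%N.
  by rewrite !zE z7 z6 z5 z4 /t; ring.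
have h8 : 8 != 0 :> C by rewrite pnatr_eq0.
exists t, (m0%:Z - m4%:Z), (m1%:Z - m3%:Z); split=> //; apply: (mulfI h8).
  have -> : 8 * ((m0%:Z - m4%:Z)%:~R + t * (m1%:Z - m3%:Z)%:~R) =
    (8 * m0)%:R - (8 * m4)%:R + t * ((8 * m1)%:R - (8 * m3)%:R) :> C by ring.
  by rewrite E0 E1 E3 E4; ring: t2.
have -> : 8 * ((m0%:Z - m4%:Z)%:~R - t * (m1%:Z - m3%:Z)%:~R) =
  (8 * m0)%:R - (8 * m4)%:R - t * ((8 * m1)%:R - (8 * m3)%:R) :> C by ring.
by rewrite E0 E1 E3 E4; ring: t2.
Qed.
End Multiplicities.

Lemma intr_natB (m : nat) (a : int) : (m%:Z - a)%:~R = m%:R - a%:~R :> C.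
Proof. by ring. Qed.

Lemma expg_compl (gT : finGroupType) (y : gT) m N :
  (m <= N)%N -> (y ^+ N = 1)%g -> ((y ^+ m)^-1 = y ^+ (N - m))%g.
Proof. by move=> lm yN; apply/eqP; rewrite eq_invg_mul -expgD subnKC // yN. Qed.

Section CharactersPGL27.
(* The group enters only through its class data. *)
Variables (gT : finGroupType) (G : {group gT}) (gh gk gu : gT).
Hypotheses (gh_mem : gh \in G) (gk_mem : gk \in G) (gu_mem : gu \in G).
Hypotheses (h8 : (gh ^+ 8 = 1)%g) (k6 : (gk ^+ 6 = 1)%g) (u7 : (gu ^+ 7 = 1)%g).
Hypotheses (ch : exists2 y, y \in G & (gh ^+ 7 = gh ^ y)%g)
  (ck : exists2 y, y \in G & (gk ^+ 5 = gk ^ y)%g)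
  (cu : exists2 y, y \in G & (gu ^+ 3 = gu ^ y)%g).
Hypothesis cardG : #|G| = 336%N.
Hypothesis sumG : forall F : gT -> C, {in G &, forall x y, F (x ^ y)%g = F x} ->
  \sum_(x in G) F x =
  F 1%g + F (gh ^+ 4)%g *+ 21 + F (gk ^+ 3)%g *+ 28 + F (gk ^+ 2)%g *+ 56 + F (gh ^+ 2)%g *+ 42
  + F gk *+ 56 + F gu *+ 48 + F gh *+ 42 + F (gh ^+ 3)%g *+ 42.
Variables (n : nat) (rG : mx_representation C G n).
Local Notation chi x := (\tr (rG x)).

Lemma mxtrace_power_conj x a m N : x \in G -> (x ^+ N = 1)%g ->
  (exists2 y, y \in G & (x ^+ a = x ^ y)%g) ->
  chi (x ^+ m)%g = chi (x ^+ (a * m %% N))%g.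
Proof.
move=> Gx xN [y Gy e]; rewrite (expg_mod _ xN) expgM e -conjXg.
by rewrite mxtrace_repr_conj ?groupX.
Qed.

Lemma mxtrace_PGL27_inv x : x \in [:: 1%g; gh ^+ 4; gk ^+ 3; gk ^+ 2; gh ^+ 2; gk; gu; gh; gh ^+ 3]%g ->
  chi x^-1%g = chi x.
Proof.
have H := mxtrace_power_conj _ gh_mem h8 ch; have K := mxtrace_power_conj _ gk_mem k6 ck.
have U := mxtrace_power_conj _ gu_mem u7 cu.
have inv := @expg_compl (gT).
have h1 : gh = (gh ^+ 1)%g by rewrite expg1.
have k1 : gk = (gk ^+ 1)%g by rewrite expg1.
have u1 : gu = (gu ^+ 1)%g by rewrite expg1.
rewrite in_cons => /predU1P[->|]; first by rewrite invg1.
rewrite in_cons => /predU1P[->|]; first by rewrite (inv _ _ 8).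
rewrite in_cons => /predU1P[->|]; first by rewrite (inv _ _ 6).
rewrite in_cons => /predU1P[->|]; first by rewrite (inv _ _ 6) // [RHS]K.
rewrite in_cons => /predU1P[->|]; first by rewrite (inv _ _ 8) // [RHS]H.
rewrite in_cons => /predU1P[->|]; first by rewrite k1 (inv _ _ 6) // [RHS]K.
rewrite in_cons => /predU1P[->|]; first by rewrite u1 (inv _ _ 7) // [RHS]U [RHS]U [RHS]U.
rewrite in_cons => /predU1P[->|]; first by rewrite h1 (inv _ _ 8) // [RHS]H.
by rewrite mem_seq1 => /eqP->; rewrite (inv _ _ 8) // [RHS]H.
Qed.

(** The integers u, v, c3, c4, c6, c7, p, q encode a nontrivial irreducible
character.  The linear relation is the orthogonality to the trivial character and
the quadratic one is the norm relation. *)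
Lemma irr_PGL27_constraints : mx_irreducible rG -> (exists2 x, x \in G & rG x != 1%:M) ->
  exists u v c3 c4 c6 c7 p q : int, exists s : C, exists a b d e f g : int,
  [/\ [/\ chi (gh ^+ 4)%g = u%:~R, chi (gk ^+ 3)%g = v%:~R, chi (gk ^+ 2)%g = c3%:~R,
      chi (gh ^+ 2)%g = c4%:~R & chi gk = c6%:~R],
      [/\ chi gu = c7%:~R, chi gh = p%:~R + s * q%:~R &
         chi (gh ^+ 3)%g = p%:~R - s * q%:~R],
      [/\ n%:Z - u = 2 * a, n%:Z - v = 2 * b & n%:Z - c3 = 3 * d] /\
      [/\ n%:Z - c4 = 2 * e, c6 - c3 = 2 * f & n%:Z - c7 = 7 * g],
      n%:Z + 21 * u + 28 * v + 56 * c3 + 42 * c4 + 56 * c6 + 48 * c7 + 84 * p = 0 &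
      n%:Z ^+ 2 + 21 * u ^+ 2 + 28 * v ^+ 2 + 56 * c3 ^+ 2 + 42 * c4 ^+ 2 + 56 * c6 ^+ 2 +
      48 * c7 ^+ 2 + 84 * (p ^+ 2 + 2 * q ^+ 2) = 336].
Proof.
move=> irrG nt.
have H := mxtrace_power_conj _ gh_mem h8 ch; have K := mxtrace_power_conj _ gk_mem k6 ck.
have U := mxtrace_power_conj _ gu_mem u7 cu.
have X (x : gT) i j : (x ^+ i ^+ j = x ^+ (i * j))%g by rewrite expgM.
have [a Ea] : exists a : int, n%:R - chi (gh ^+ 4)%g = (2 * a)%:~R.
  by apply: mxtrace_order2; rewrite ?groupX ?gh_mem // X.
have [b Eb] : exists a : int, n%:R - chi (gk ^+ 3)%g = (2 * a)%:~R.
  by apply: mxtrace_order2; rewrite ?groupX ?gk_mem // X.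
have [d Ed] : exists a : int, n%:R - chi (gk ^+ 2)%g = (3 * a)%:~R.
  by apply: mxtrace_order3; rewrite ?groupX ?gk_mem ?X // [RHS]K.
have [c4 [e [E4 Ee]]] : exists a b : int, chi (gh ^+ 2)%g = a%:~R /\ n%:R - chi (gh ^+ 2)%g = (2 * b)%:~R.
  by apply: mxtrace_order4; rewrite ?groupX ?gh_mem ?X // [RHS]H.
have [c6 [f [E6 Ef]]] : exists a b : int, chi gk = a%:~R /\ chi gk - chi (gk ^+ 2)%g = (2 * b)%:~R.
  by apply: mxtrace_order6; rewrite ?gk_mem // -1?[in RHS](expg1 gk) [RHS]K.
have [g Eg] : exists a : int, n%:R - chi gu = (7 * a)%:~R.
  apply: mxtrace_order7; rewrite ?gu_mem // => k /andP[k0 k7].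
  have U1 : chi (gu ^+ 1)%g = chi (gu ^+ 3)%g := U 1%N.
  have U3 : chi (gu ^+ 3)%g = chi (gu ^+ 2)%g := U 3%N.
  have U2 : chi (gu ^+ 2)%g = chi (gu ^+ 6)%g := U 2%N.
  have U6 : chi (gu ^+ 6)%g = chi (gu ^+ 4)%g := U 6%N.
  have U4 : chi (gu ^+ 4)%g = chi (gu ^+ 5)%g := U 4%N.
  rewrite -[in RHS](expg1 gu).
  by case: k k0 k7 => [|[|[|[|[|[|[|]]]]]]] //= _ _; rewrite ?U1 ?U3 ?U2 ?U6 ?U4.
have [s [p [q [s2 Ep Eq]]]] : exists (s : C) (p q : int), [/\ s ^+ 2 = 2,
    chi gh = p%:~R + s * q%:~R & chi (gh ^+ 3)%g = p%:~R - s * q%:~R].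
  apply: mxtrace_order8; rewrite ?gh_mem //.
exists (n%:Z - 2 * a), (n%:Z - 2 * b), (n%:Z - 3 * d), c4, c6, (n%:Z - 7 * g), p, q, s, a, b, d, e, f, g.
have Hu : chi (gh ^+ 4)%g = (n%:Z - 2 * a)%:~R by rewrite intr_natB -Ea subKr.
have Hv : chi (gk ^+ 3)%g = (n%:Z - 2 * b)%:~R by rewrite intr_natB -Eb subKr.
have H3 : chi (gk ^+ 2)%g = (n%:Z - 3 * d)%:~R by rewrite intr_natB -Ed subKr.
have H7 : chi gu = (n%:Z - 7 * g)%:~R by rewrite intr_natB -Eg subKr.
have H1 : chi 1%g = n%:R by rewrite repr_mx1 mxtrace1.
split=> //.
- split; split; try by ring.
  + by apply: (@intr_inj C); rewrite -Ee E4; ring.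
  + by apply: (@intr_inj C); rewrite -Ef E6 H3; ring.
- have := sum_mxtrace_irr irrG nt; rewrite sumG; last first.
    by move=> x y Gx Gy; apply: mxtrace_repr_conj.
  rewrite H1 Hu Hv H3 H7 E4 E6 Ep Eq => e0.
  by apply: (@intr_inj C); rewrite [RHS]/= -[RHS]e0; ring.
have := norm_mxtrace_irr irrG; rewrite (sumG (F := fun x => chi x^-1%g * chi x)); last first.
  by move=> x y Gx Gy; rewrite -conjVg !mxtrace_repr_conj ?groupV.
rewrite !mxtrace_PGL27_inv ?inE ?eqxx ?orbT //.
rewrite H1 Hu Hv H3 H7 E4 E6 Ep Eq cardG => e0.
apply: (@intr_inj C); rewrite -[RHS]/(336%:R) -[RHS]e0; ring: s2.
Qed.
End CharactersPGL27.
End RootsOfUnity.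

Lemma sqr_int_le1 (x : int) : x ^+ 2 < 4 -> -1 <= x <= 1.
Proof. by rewrite expr2 => h; nia. Qed.
Lemma sqr_int_le2 (x : int) : x ^+ 2 < 9 -> -2 <= x <= 2.
Proof. by rewrite expr2 => h; nia. Qed.
Lemma sqr_int_le3 (x : int) : x ^+ 2 < 16 -> -3 <= x <= 3.
Proof. by rewrite expr2 => h; nia. Qed.

(** Class sizes bound each value: |C| chi(C)^2 cannot exceed the group order. *)
Lemma norm_equation_bounds (N u v c3 c4 c6 c7 p q : int) :
  N + 21 * u ^+ 2 + 28 * v ^+ 2 + 56 * c3 ^+ 2 + 42 * c4 ^+ 2 + 56 * c6 ^+ 2 +
      48 * c7 ^+ 2 + 84 * (p ^+ 2 + 2 * q ^+ 2) = 336 -> 0 < N ->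
  [/\ -3 <= u <= 3, -3 <= v <= 3, -2 <= c3 <= 2 & -2 <= c4 <= 2] /\
  [/\ -2 <= c6 <= 2, -2 <= c7 <= 2, -1 <= p <= 1 & -1 <= q <= 1].
Proof.
have P x : 0 <= x ^+ 2 :> int by exact: sqr_ge0.
have := (P u, P v, (P c3, P c4), (P c6, P c7), (P p, P q)).
move=> [[[[U V] [C3 C4]] [C6 C7]] [Pp Pq]] e N0.
by split; split; (apply: sqr_int_le1 || apply: sqr_int_le2 || apply: sqr_int_le3); 
  move: U V C3 C4 C6 C7 Pp Pq e;
  move: (u ^+ 2) (v ^+ 2) (c3 ^+ 2) (c4 ^+ 2) (c6 ^+ 2) (c7 ^+ 2) (p ^+ 2) (q ^+ 2) => *; lia.
Qed.

(** In degrees 7 and 6 the value at one class of involutions singles out a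
solution; in degree 1 there is only one.  The congruence modulo 7 and the bounds
fix the value at elements of order 7, after which few cases remain. *)
Lemma degree7_values (u c3 c4 c6 c7 p q a d e f g : int) :
  7 - u = 2 * a -> 7 - c3 = 3 * d -> 7 - c4 = 2 * e -> c6 - c3 = 2 * f -> 7 - c7 = 7 * g ->
  7 + 21 * u + 28 * -1 + 56 * c3 + 42 * c4 + 56 * c6 + 48 * c7 + 84 * p = 0 ->
  7 ^+ 2 + 21 * u ^+ 2 + 28 * (-1) ^+ 2 + 56 * c3 ^+ 2 + 42 * c4 ^+ 2 + 56 * c6 ^+ 2 +
      48 * c7 ^+ 2 + 84 * (p ^+ 2 + 2 * q ^+ 2) = 336 ->
  [/\ [/\ u = -1, c3 = 1, c4 = -1 & c6 = -1], c7 = 0, p = 1 & q = 0].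
Proof.
move=> hu h3 h4 h6 h7 hs hn; have := norm_equation_bounds hn isT.
case=> [[bu _ b3 b4] [b6 b7 bp bq]].
have e7 : c7 = 0 by clear hn hs; lia.
have {}hn : 3 * u ^+ 2 + 8 * c3 ^+ 2 + 6 * c4 ^+ 2 + 8 * c6 ^+ 2 + 12 * (p ^+ 2 + 2 * q ^+ 2) = 37.
  move: hn; rewrite e7; clear; lia.
have {}hs : 3 * u + 8 * c3 + 6 * c4 + 8 * c6 + 12 * p = 3 by clear hn; lia.
rewrite e7; move: hn hs.
have {b4}h4' : c4 = 1 \/ c4 = -1 by lia.
have {bu}hu' : u = 1 \/ u = -1 \/ u = 3 \/ u = -3 by lia.
have {b3 b6}h36 : c3 = 1 /\ c6 = 1 \/ c3 = 1 /\ c6 = -1 \/ c3 = -2 /\ c6 = 0 \/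
  c3 = -2 /\ c6 = 2 \/ c3 = -2 /\ c6 = -2 by lia.
have {bp}hp : p = 0 \/ p = 1 \/ p = -1 by lia.
have {bq}hq : q = 0 \/ q = 1 \/ q = -1 by lia.
clear hu h3 h4 h6 h7 b7.
by case: h36 => [|[|[|[|]]]] [-> ->]; case: h4' => ->; case: hu' => [->|[->|[->|->]]];
  case: hp => [->|[->|->]]; case: hq => [->|[->|->]] => /eqP hn /eqP hs.
Qed.

Lemma degree6_values (v c3 c4 c6 c7 p q b d e f g : int) :
  6 - v = 2 * b -> 6 - c3 = 3 * d -> 6 - c4 = 2 * e -> c6 - c3 = 2 * f -> 6 - c7 = 7 * g ->
  6 + 21 * -2 + 28 * v + 56 * c3 + 42 * c4 + 56 * c6 + 48 * c7 + 84 * p = 0 ->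
  6 ^+ 2 + 21 * (-2) ^+ 2 + 28 * v ^+ 2 + 56 * c3 ^+ 2 + 42 * c4 ^+ 2 + 56 * c6 ^+ 2 +
      48 * c7 ^+ 2 + 84 * (p ^+ 2 + 2 * q ^+ 2) = 336 ->
  [/\ [/\ v = 0, c3 = 0, c4 = 2 & c6 = 0], c7 = -1, p = 0 & q = 0].
Proof.
move=> hv h3 h4 h6 h7 hs hn; have := norm_equation_bounds hn isT.
case=> [[_ bv b3 b4] [b6 b7 bp bq]].
have e7 : c7 = -1 by clear hn hs; lia.
have h3' : c3 = 0 by clear hn hs; lia.
have {}hn : 2 * v ^+ 2 + 3 * c4 ^+ 2 + 4 * c6 ^+ 2 + 6 * (p ^+ 2 + 2 * q ^+ 2) = 12.
  move: hn; rewrite e7 h3'; clear; lia.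
have {}hs : 2 * v + 3 * c4 + 4 * c6 + 6 * p = 6 by clear hn; lia.
rewrite e7; move: hn hs.
have {b4}h4' : c4 = 0 \/ c4 = 2 \/ c4 = -2 by lia.
have {bv}hv' : v = 0 \/ v = 2 \/ v = -2 by lia.
have {b6}h6' : c6 = 0 \/ c6 = -2 \/ c6 = 2 by lia.
have {bp}hp : p = 0 \/ p = 1 \/ p = -1 by lia.
have {bq}hq : q = 0 \/ q = 1 \/ q = -1 by lia.
clear hv b3 h3 h4 h7 b7 h6; rewrite h3'.
by case: h4' => [->|[->|->]]; case: hv' => [->|[->|->]]; case: h6' => [->|[->|->]];
  case: hp => [->|[->|->]]; case: hq => [->|[->|->]] => /eqP hn /eqP hs.
Qed.

Lemma degree1_values (u v c3 c4 c6 c7 p q a b d e f g : int) :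
  1 - u = 2 * a -> 1 - v = 2 * b -> 1 - c3 = 3 * d -> 1 - c4 = 2 * e -> c6 - c3 = 2 * f ->
  1 - c7 = 7 * g ->
  1 + 21 * u + 28 * v + 56 * c3 + 42 * c4 + 56 * c6 + 48 * c7 + 84 * p = 0 ->
  1 ^+ 2 + 21 * u ^+ 2 + 28 * v ^+ 2 + 56 * c3 ^+ 2 + 42 * c4 ^+ 2 + 56 * c6 ^+ 2 +
      48 * c7 ^+ 2 + 84 * (p ^+ 2 + 2 * q ^+ 2) = 336 ->
  [/\ [/\ u = 1, v = -1 & c3 = 1], [/\ c4 = 1, c6 = -1 & c7 = 1], p = -1 & q = 0].
Proof.
move=> hu hv h3 h4 h6 h7 hs hn; have := norm_equation_bounds hn isT.
case=> [[bu bv b3 b4] [b6 b7 bp bq]].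
have e7 : c7 = 1 by clear hn hs; lia.
have {}hn : 3 * u ^+ 2 + 4 * v ^+ 2 + 8 * c3 ^+ 2 + 6 * c4 ^+ 2 + 8 * c6 ^+ 2 +
    12 * (p ^+ 2 + 2 * q ^+ 2) = 41.
  move: hn; rewrite e7; clear; lia.
have {}hs : 7 + 3 * u + 4 * v + 8 * c3 + 6 * c4 + 8 * c6 + 12 * p = 0 by clear hn; lia.
rewrite e7; move: hn hs.
have {b4}h4' : c4 = 1 \/ c4 = -1 by lia.
have {bu}hu' : u = 1 \/ u = -1 \/ u = 3 \/ u = -3 by lia.
have {bv}hv' : v = 1 \/ v = -1 \/ v = 3 \/ v = -3 by lia.
have {b3 b6}h36 : c3 = 1 /\ c6 = 1 \/ c3 = 1 /\ c6 = -1 \/ c3 = -2 /\ c6 = 0 \/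
  c3 = -2 /\ c6 = 2 \/ c3 = -2 /\ c6 = -2 by lia.
have {bp}hp : p = 0 \/ p = 1 \/ p = -1 by lia.
have {bq}hq : q = 0 \/ q = 1 \/ q = -1 by lia.
clear hu hv h3 h4 h6 h7 b7; move=> hn hs.
(* Dropping to the squares first leaves only signs to enumerate. *)
have [u2 v2 p2 q2] : [/\ u ^+ 2 = 1, v ^+ 2 = 1, p ^+ 2 = 1 & q ^+ 2 = 0].
  have u12 : u ^+ 2 = 1 \/ u ^+ 2 = 9 by case: hu' => [->|[->|[->|->]]]; [left|left|right|right].
  have v12 : v ^+ 2 = 1 \/ v ^+ 2 = 9 by case: hv' => [->|[->|[->|->]]]; [left|left|right|right].
  have p12 : p ^+ 2 = 0 \/ p ^+ 2 = 1 by case: hp => [->|[->|->]]; [left|right|right].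
  have q12 : q ^+ 2 = 0 \/ q ^+ 2 = 1 by case: hq => [->|[->|->]]; [left|right|right].
  have c12 : c4 ^+ 2 = 1 by case: h4' => ->.
  have c36 : c3 ^+ 2 = 1 /\ c6 ^+ 2 = 1 \/ c3 ^+ 2 = 4 /\ 0 <= c6 ^+ 2.
    by case: h36 => [|[|[|[|]]]] [-> ->]; [left|left|right|right|right].
  move: u12 v12 p12 q12 c12 c36 hn; clear.
  move: (u ^+ 2) (v ^+ 2) (c3 ^+ 2) (c4 ^+ 2) (c6 ^+ 2) (p ^+ 2) (q ^+ 2) => U V C3 C4 C6 P Q *.
  by split; lia.
have {}hu' : u = 1 \/ u = -1 by move: u2; case: hu' => [->|[->|[->|->]]] => // _; [left|right].
have {}hv' : v = 1 \/ v = -1 by move: v2; case: hv' => [->|[->|[->|->]]] => // _; [left|right].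
have {}hp : p = 1 \/ p = -1 by move: p2; case: hp => [->|[->|->]] => // _; [left|right].
have q0 : q = 0 by move/eqP: q2; rewrite sqrf_eq0 => /eqP.
move: hn hs; rewrite q0.
by case: h36 => [|[|[|[|]]]] [-> ->]; case: h4' => ->; case: hu' => ->; case: hv' => ->;
  case: hp => -> => /eqP hn /eqP hs.
Qed.

(** * The adjoint character of G_2 *)

(** The octonion structure constants as integers, so that the tensor identities
below are decided by evaluation. *)
Definition oct (a b c : nat) : int :=
  let d1 := ((b + (7 - a) %% 7) %% 7)%N in let d2 := ((c + (7 - a) %% 7) %% 7)%N in
  match d1, d2 with
  | 1, 3 | 2, 6 | 4, 5 => 1
  | 3, 1 | 6, 2 | 5, 4 => -1
  | _, _ => 0
  end.

Definition sum7 (f : nat -> int) : int := f 0 + (f 1 + (f 2 + (f 3 + (f 4 + (f 5 + f 6))))).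
Lemma sum7E (f : nat -> int) : \sum_(i < 7) f (i : nat) = sum7 f.
Proof. by rewrite !big_ord_recl big_ord0 addr0. Qed.

Definition oct_values : seq (seq (seq int)) := Eval vm_compute in
  [seq [seq [seq oct a b c | c <- iota 0 7] | b <- iota 0 7] | a <- iota 0 7].
Definition oct_table a b c : int := nth 0 (nth [::] (nth [::] oct_values a) b) c.

Definition kronecker (a b : nat) : int := if eqn a b then 1 else 0.
(** The coefficient of X_ij in the value at (e_a, e_b, e_c) of the derivative of
the 3-form along X. *)
Definition der_coef a b c i j : int :=
  kronecker a i * oct_table j b c + kronecker b i * oct_table a j c + kronecker c i * oct_table a b j.
(** On skew matrices the derivative of the 3-form depends only on the vector of
contractions of X with the 3-form, through the tensor tabulated here: it is the
embedding of the 7-dimensional representation in the alternating 3-forms. *)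
Definition der_weight a b c k : int := sum7 (fun i => sum7 (fun j => der_coef a b c i j * oct_table k i j)).
Definition all7 (P : nat -> bool) := all P (iota 0 7).
Definition weight_values := Eval vm_compute in
  [seq [seq [seq [seq der_weight a b c k | k <- iota 0 7] | c <- iota 0 7] | b <- iota 0 7] | a <- iota 0 7].
Definition weight_table a b c k : int := nth 0 (nth [::] (nth [::] (nth [::] weight_values a) b) c) k.

(** Three quadratic identities between structure constants: the contraction
maps onto the 7-dimensional representation, the derivative of the 3-form factors
through it, and that factorisation is injective. *)
Lemma oct_orth_check : all7 (fun k => all7 (fun l =>
  sum7 (fun i => sum7 (fun j => oct_table k i j * oct_table l i j)) == 6 * kronecker k l)).
Proof. by vm_compute. Qed.
Lemma der_check : all7 (fun a => all7 (fun b => all7 (fun c => all7 (fun i => all7 (fun j =>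
  3 * (der_coef a b c i j - der_coef a b c j i) == sum7 (fun k => weight_table a b c k * oct_table k i j)))))).
Proof. by vm_compute. Qed.
Lemma w_orth_check : all7 (fun k => all7 (fun l =>
  sum7 (fun a => sum7 (fun b => sum7 (fun c => weight_table a b c k * weight_table a b c l))) == 216 * kronecker k l)).
Proof. by vm_compute. Qed.

Lemma oct_skew_check : all7 (fun k => all7 (fun i => all7 (fun j => oct_table k j i == - oct_table k i j))).
Proof. by vm_compute. Qed.
Lemma oct_table_check : all7 (fun a => all7 (fun b => all7 (fun c =>
  let d1 := ((b + (7 - a) %% 7) %% 7)%N in let d2 := ((c + (7 - a) %% 7) %% 7)%N in
  oct_table a b c == (if [|| (d1 == 1) && (d2 == 3), (d1 == 2) && (d2 == 6) | (d1 == 4) && (d2 == 5)]%N then 1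
    else if [|| (d2 == 1) && (d1 == 3), (d2 == 2) && (d1 == 6) | (d2 == 4) && (d1 == 5)]%N then -1
    else 0)))).
Proof. by vm_compute. Qed.

Lemma all7P (P : nat -> bool) (i : 'I_7) : all7 P -> P i.
Proof. by move=> /allP; apply; rewrite mem_iota ltn_ord. Qed.

Section Projector.
Variable R : realType.
Local Notation c i j k := ((oct_table i j k)%:~R : R).

Lemma phi_coefE (i j k : 'I_7) : phi_coef R i j k = c i j k.
Proof.
have /eqP -> := all7P k (all7P j (all7P i oct_table_check)).
rewrite /phi_coef !inE !xpair_eqE -!val_eqE /= !inordK //.
by case: ifP => _ //; case: ifP.
Qed.

Lemma oct_skew (k i j : 'I_7) : c k j i = - c k i j.
Proof. by have /eqP -> := all7P j (all7P i (all7P k oct_skew_check)); rewrite rmorphN. Qed.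

Lemma kroneckerE (a b : 'I_7) : kronecker a b = (a == b)%:R.
Proof. by rewrite /kronecker; have -> : eqn a b = (a == b) by []; case: eqP. Qed.

Lemma intr_sum7 (f : nat -> int) : (sum7 f)%:~R = \sum_(i < 7) (f i)%:~R :> R.
Proof. by rewrite -sum7E rmorph_sum. Qed.

Lemma oct_orth (k l : 'I_7) : \sum_(i < 7) \sum_(j < 7) c k i j * c l i j = 6 * (k == l)%:R.
Proof.
have /eqP := all7P l (all7P k oct_orth_check); rewrite kroneckerE => /(congr1 (fun z : int => z%:~R : R)).
rewrite intr_sum7 => e; transitivity ((6 * (k == l)%:R : int)%:~R : R); last by ring.
rewrite -e; apply: eq_bigr => i _; rewrite intr_sum7; apply: eq_bigr => j _.
by rewrite rmorphM.
Qed.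

Lemma der_w (a b d i j : 'I_7) :
  3 * ((der_coef a b d i j)%:~R - (der_coef a b d j i)%:~R) = \sum_(k < 7) (weight_table a b d k)%:~R * c k i j.
Proof.
have /eqP := all7P j (all7P i (all7P d (all7P b (all7P a der_check)))).
move=> /(congr1 (fun z : int => z%:~R : R)); rewrite intr_sum7 => e.
transitivity ((3 * (der_coef a b d i j - der_coef a b d j i))%:~R : R); first by ring.
by rewrite e; apply: eq_bigr => k _; rewrite rmorphM.
Qed.

Lemma w_orth (k l : 'I_7) : \sum_(a < 7) \sum_(b < 7) \sum_(d < 7)
  (weight_table a b d k)%:~R * (weight_table a b d l)%:~R = 216 * (k == l)%:R :> R.
Proof.
have /eqP := all7P l (all7P k w_orth_check); rewrite kroneckerE => /(congr1 (fun z : int => z%:~R : R)).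
rewrite intr_sum7 => e; transitivity ((216 * (k == l)%:R : int)%:~R : R); last by ring.
rewrite -e; apply: eq_bigr => a _; rewrite intr_sum7; apply: eq_bigr => b _.
by rewrite intr_sum7; apply: eq_bigr => d _; rewrite rmorphM.
Qed.

(** The equivariant map from 7 x 7 matrices to vectors given by the 3-form. *)
Definition contr (X : 'M[R]_7) (k : 'I_7) : R := \sum_(i < 7) \sum_(j < 7) c k i j * X i j.
Definition Phi (k : 'I_7) : 'M[R]_7 := \matrix_(i, j) c k i j.

Lemma phi_delta (u v w : 'rV[R]_7) a b : 
  [/\ phi u (delta_mx 0 a) (delta_mx 0 b) = \sum_(i < 7) c i a b * u 0 i,
      phi (delta_mx 0 a) v (delta_mx 0 b) = \sum_(i < 7) c a i b * v 0 i &
      phi (delta_mx 0 a) (delta_mx 0 b) w = \sum_(i < 7) c a b i * w 0 i].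
Proof.
have s1 (F : 'I_7 -> R) t : \sum_i F i * (delta_mx 0 t : 'rV[R]_7) 0 i = F t.
  rewrite (bigD1 t) //= mxE !eqxx mulr1 big1 ?addr0 // => i it.
  by rewrite mxE eqxx (negPf it) mulr0.
split; rewrite /phi.
- apply: eq_bigr => i _; rewrite -[RHS](s1 (fun j => c i j b * u 0 i)); apply: eq_bigr => j _.
  rewrite -[X in X * _](s1 (fun k => c i j k * u 0 i)) mulr_suml; apply: eq_bigr => k _.
  by rewrite phi_coefE; ring.
- rewrite exchange_big; apply: eq_bigr => j _; rewrite -[RHS](s1 (fun i => c i j b * v 0 j)).
  apply: eq_bigr => i _; rewrite -[X in X * _](s1 (fun k => c i j k * v 0 j)) mulr_suml.
  by apply: eq_bigr => k _; rewrite phi_coefE; ring.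
under eq_bigr do rewrite exchange_big /=.
rewrite exchange_big; apply: eq_bigr => k _; rewrite -[RHS](s1 (fun i => c i b k * w 0 k)).
apply: eq_bigr => i _; rewrite -[X in X * _](s1 (fun j => c i j k * w 0 k)) mulr_suml.
by apply: eq_bigr => j _; rewrite phi_coefE; ring.
Qed.

Lemma der_phiE (X : 'M[R]_7) a b d :
  der_phi X (delta_mx 0 a) (delta_mx 0 b) (delta_mx 0 d) =
  \sum_(i < 7) \sum_(j < 7) (der_coef a b d i j)%:~R * X i j.
Proof.
have s1 (F : 'I_7 -> R) t : \sum_i (t == i)%:R * F i = F t.
  rewrite (bigD1 t) //= eqxx mul1r big1 ?addr0 // => i it.
  by rewrite eq_sym (negPf it) mul0r.
rewrite /der_phi; have [-> _ _] := phi_delta (delta_mx 0 a *m X) 0 0 b d.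
have [_ -> _] := phi_delta 0 (delta_mx 0 b *m X) 0 a d.
have [_ _ ->] := phi_delta 0 0 (delta_mx 0 d *m X) a b.
rewrite -!rowE; transitivity (\sum_(i < 7) ((a == i)%:R * (\sum_(j < 7) c j b d * X i j) +
  (b == i)%:R * (\sum_(j < 7) c a j d * X i j) + (d == i)%:R * (\sum_(j < 7) c a b j * X i j))).
  by rewrite !big_split /= !s1; congr (_ + _ + _); apply: eq_bigr => j _; rewrite mxE.
apply: eq_bigr => i _; rewrite !mulr_sumr -!big_split; apply: eq_bigr => j _ /=.
rewrite /der_coef !kroneckerE !(rmorphD, rmorphM) /= !rmorph_nat; ring.
Qed.

Lemma der_contr (X : 'M[R]_7) a b d : X^T = - X ->
  6 * der_phi X (delta_mx 0 a) (delta_mx 0 b) (delta_mx 0 d) =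
  \sum_(k < 7) (weight_table a b d k)%:~R * contr X k.
Proof.
move=> skX; have sk i j : X j i = - X i j by have /matrixP/(_ i j) := skX; rewrite !mxE.
have e : \sum_(i < 7) \sum_(j < 7) (der_coef a b d i j)%:~R * X i j =
    - (\sum_(i < 7) \sum_(j < 7) (der_coef a b d j i)%:~R * X i j).
  rewrite exchange_big -sumrN; apply: eq_bigr => i _; rewrite -sumrN; apply: eq_bigr => j _ /=.
  by rewrite (sk i j) mulrN.
rewrite der_phiE.
transitivity (\sum_(i < 7) \sum_(j < 7)
    3 * ((der_coef a b d i j)%:~R - (der_coef a b d j i)%:~R) * X i j).
  transitivity (3 * (\sum_(i < 7) \sum_(j < 7) (der_coef a b d i j)%:~R * X i j
       - \sum_(i < 7) \sum_(j < 7) (der_coef a b d j i)%:~R * X i j)).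
    by rewrite e; ring.
  rewrite -sumrB mulr_sumr; apply: eq_bigr => i _; rewrite -sumrB mulr_sumr.
  by apply: eq_bigr => j _; ring.
under [RHS]eq_bigr do rewrite mulr_sumr.
rewrite [RHS]exchange_big; apply: eq_bigr => i _.
under [RHS]eq_bigr do rewrite mulr_sumr.
rewrite [RHS]exchange_big; apply: eq_bigr => j _ /=.
by rewrite der_w mulr_suml; apply: eq_bigr => k _; rewrite mulrA.
Qed.

(** g_2 is the kernel of the contraction inside so(7).  This replaces the 343
linear conditions of the definition by 7, and makes the complement explicit. *)
Lemma mem_g2_contr (X : 'M[R]_7) :
  (mxvec X <= g2 R)%MS <-> X^T = - X /\ forall k, contr X k = 0.
Proof.
split=> [/mem_g2[sk d0]|[sk c0]].
  have {}sk : X^T = - X by apply/eqP; rewrite -addr_eq0 addrC sk.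
  split=> // l; have h (a b d : 'I_7) : \sum_(k < 7) (weight_table a b d k)%:~R * contr X k = 0 :> R.
    by rewrite -der_contr // d0 mulr0.
  have : \sum_(k < 7) (\sum_(a < 7) \sum_(b < 7) \sum_(d < 7)
      (weight_table a b d l)%:~R * (weight_table a b d k)%:~R) * contr X k = 0.
    transitivity (\sum_(a < 7) \sum_(b < 7) \sum_(d < 7) (weight_table a b d l)%:~R *
        \sum_(k < 7) (weight_table a b d k)%:~R * contr X k).
      under [LHS]eq_bigr do rewrite mulr_suml.
      rewrite [LHS]exchange_big; apply: eq_bigr => a _; under [LHS]eq_bigr do rewrite mulr_suml.
      rewrite [LHS]exchange_big; apply: eq_bigr => b _; under [LHS]eq_bigr do rewrite mulr_suml.
      rewrite [LHS]exchange_big; apply: eq_bigr => d _; rewrite mulr_sumr.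
      by apply: eq_bigr => k _; rewrite mulrA.
    by do 3!(apply: big1 => ? _); rewrite h mulr0.
  rewrite (bigD1 l) //= w_orth eqxx big1 => [|k kl]; last first.
    by rewrite w_orth eq_sym (negPf kl) mulr0 mul0r.
  by rewrite addr0 mulr1 => /eqP; rewrite mulf_eq0 pnatr_eq0 /= => /eqP.
apply/mem_g2; split; first by rewrite sk subrr.
apply: der_phi0 => a b d; have h6 : 6 != 0 :> R by rewrite pnatr_eq0.
apply: (mulfI h6); rewrite der_contr // mulr0 big1 // => k _.
by rewrite c0 mulr0.
Qed.

(** The projection of all matrices onto g_2: skew part, minus its component in
the copy of the 7-dimensional representation spanned by the [Phi k]. *)
Definition g2proj (X : 'M[R]_7) : 'M[R]_7 :=
  2^-1 *: (X - X^T) - 6^-1 *: \sum_(k < 7) contr X k *: Phi k.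

Lemma contr_is_linear k : linear ((fun X => contr X k) : _ -> R^o).
Proof.
move=> a X Y; rewrite /contr scaler_sumr -big_split; apply: eq_bigr => i _ /=.
rewrite scaler_sumr -big_split; apply: eq_bigr => j _ /=.
by rewrite !mxE /GRing.scale /=; ring.
Qed.

Lemma contr0 k : contr 0 k = 0.
Proof. by rewrite /contr big1 // => i _; rewrite big1 // => j _; rewrite mxE mulr0. Qed.
Lemma contrD X Y k : contr (X + Y) k = contr X k + contr Y k.
Proof. by have := contr_is_linear k 1 X Y; rewrite !scale1r. Qed.
Lemma contrZ a X k : contr (a *: X) k = a * contr X k.
Proof. by have := contr_is_linear k a X 0; rewrite contr0 !addr0. Qed.
Lemma contrB X Y k : contr (X - Y) k = contr X k - contr Y k.
Proof. by rewrite contrD -scaleN1r contrZ mulN1r. Qed.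

Lemma g2proj_is_linear : linear g2proj.
Proof.
move=> a X Y; rewrite /g2proj.
have -> : \sum_(k < 7) contr (a *: X + Y) k *: Phi k =
    a *: (\sum_(k < 7) contr X k *: Phi k) + \sum_(k < 7) contr Y k *: Phi k.
  rewrite scaler_sumr -big_split; apply: eq_bigr => k _ /=.
  by rewrite contr_is_linear scalerDl scalerA.
by apply/matrixP => i j; rewrite !mxE !summxE; ring.
Qed.
HB.instance Definition _ := GRing.isLinear.Build R _ _ _ g2proj g2proj_is_linear.

Lemma contr_tr X k : contr X^T k = - contr X k.
Proof.
rewrite /contr exchange_big -sumrN; apply: eq_bigr => i _; rewrite -sumrN.
by apply: eq_bigr => j _; rewrite mxE oct_skew mulNr.
Qed.

Lemma contr_Phi k l : contr (Phi k) l = 6 * (l == k)%:R.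
Proof. by rewrite -oct_orth; do 2!(apply: eq_bigr => ? _); rewrite mxE. Qed.

Lemma g2proj_mem X : (mxvec (g2proj X) <= g2 R)%MS.
Proof.
apply/mem_g2_contr; split.
  have PhiT k : (Phi k)^T = - Phi k by apply/matrixP => i j; rewrite !mxE oct_skew.
  rewrite /g2proj linearB !linearZ /= linearB /= trmxK linear_sum /=.
  rewrite (eq_bigr (fun k => - (contr X k *: Phi k))) => [|k _]; last first.
    by rewrite linearZ /= PhiT scalerN.
  by rewrite sumrN; apply/matrixP => i j; rewrite !mxE; ring.
move=> l; rewrite /g2proj contrB !contrZ contrB contr_tr.
rewrite (big_morph (fun Y => contr Y l) (fun Y Z => contrD Y Z l) (contr0 l)).
rewrite (bigD1 l) //= big1 => [|k kl].
  by rewrite contrZ contr_Phi eqxx mulr1 addr0; field.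
by rewrite contrZ contr_Phi eq_sym (negPf kl) !mulr0.
Qed.

Lemma g2proj_id X : (mxvec X <= g2 R)%MS -> g2proj X = X.
Proof.
case/mem_g2_contr => sk c0; rewrite /g2proj big1 ?scaler0 ?subr0 => [|k _]; last first.
  by rewrite c0 scale0r.
rewrite sk opprK scalerDr -scalerDl; have -> : 2^-1 + 2^-1 = 1 :> R by field.
by rewrite scale1r.
Qed.

Lemma mxtrace_lin_mx m (f : {linear 'M[R]_m -> 'M[R]_m}) :
  \tr (lin_mx f) = \sum_(i < m) \sum_(j < m) f (delta_mx i j) i j.
Proof.
rewrite /mxtrace (reindex _ (curry_mxvec_bij _ _)) /=.
rewrite [RHS]pair_bigA /=; apply: eq_bigr => -[i j] _ /=.
by rewrite mxE /= vec_mx_delta mxvecE.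
Qed.

(** The trace of conjugation by A composed with the projection.  The skew part
contributes the exterior square character, and the [Phi k], which A transforms
as it does the basis vectors since it preserves the 3-form, contribute tr A. *)
Lemma mxtrace_conj_g2proj (A : 'M[R]_7) : in_G2 A ->
  \sum_(i < 7) \sum_(j < 7) (A^T *m g2proj (delta_mx i j) *m A) i j =
  2^-1 * (\tr A ^+ 2 - \tr (A *m A)) - \tr A.
Proof.
case=> oA pA.
have AA i j : (A *m A^T) i j = (i == j)%:R by rewrite oA mxE.
(* Invariance of the 3-form under A, read on the basis. *)
have PhiA k : A^T *m Phi k *m A = \sum_(l < 7) A k l *: Phi l.
  have inv a b d : \sum_(l < 7) \sum_(i < 7) \sum_(j < 7) c l i j * A a l * A b i * A d j = c a b d.
    have := pA (delta_mx 0 a) (delta_mx 0 b) (delta_mx 0 d).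
    have [_ _ ->] := phi_delta 0 0 (delta_mx 0 d) a b.
    rewrite (bigD1 d) //= mxE !eqxx mulr1 big1 ?addr0 => [<-|i id]; last first.
      by rewrite mxE (negPf id) andbF mulr0.
    rewrite /phi -!rowE; apply: eq_bigr => l _; apply: eq_bigr => i _; apply: eq_bigr => j _.
    by rewrite phi_coefE !mxE.
  have e : Phi k = A *m (\sum_(l < 7) A k l *: Phi l) *m A^T.
    apply/matrixP => b d; rewrite !mxE -inv exchange_big /=.
    under eq_bigr do rewrite exchange_big /=.
    rewrite exchange_big /=; apply: eq_bigr => j _.
    rewrite !mxE mulr_suml; apply: eq_bigr => i _.
    rewrite summxE mulr_sumr mulr_suml; apply: eq_bigr => l _.
    by rewrite !mxE; ring.
  by rewrite e !mulmxA (mulmx1C oA) mul1mx -mulmxA (mulmx1C oA) mulmx1.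
transitivity (\sum_(i < 7) \sum_(j < 7) (2^-1 * (A i i * A j j - A j i * A i j) -
    6^-1 * \sum_(k < 7) c k i j * (A^T *m Phi k *m A) i j)).
  have ed i j k l : (A^T *m delta_mx i j *m A) k l = A i k * A j l.
    rewrite mxE (bigD1 j) //= [X in _ + X]big1 => [|m mj]; last first.
      by rewrite mxE big1 ?mul0r // => q _; rewrite !mxE (negPf mj) andbF mulr0.
    rewrite addr0 mxE (bigD1 i) //= !mxE !eqxx mulr1 big1 ?addr0 // => m mi.
    by rewrite !mxE (negPf mi) mulr0.
  apply: eq_bigr => i _; apply: eq_bigr => j _; rewrite /g2proj.
  rewrite mulmxBr mulmxBl -!scalemxAr -!scalemxAl mulmxBr mulmxBl trmx_delta.
  rewrite mulmx_sumr mulmx_suml.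
  have eS : (\sum_(k < 7) A^T *m (contr (delta_mx i j) k *: Phi k) *m A) i j =
      \sum_(k < 7) c k i j * (A^T *m Phi k *m A) i j.
    rewrite summxE; apply: eq_bigr => k _; rewrite -scalemxAr -scalemxAl [LHS]mxE; congr (_ * _).
    rewrite /contr (bigD1 i) //= (bigD1 j) //= mxE !eqxx mulr1 !big1 ?addr0 // => [m mi|m mj].
      by rewrite big1 // => q _; rewrite mxE (negPf mi) mulr0.
    by rewrite mxE (negPf mj) andbF mulr0.
  rewrite -eS -(ed i j i j) -(ed j i i j).
  move: (A^T *m delta_mx i j *m A) (A^T *m delta_mx j i *m A) (\sum_(k < 7) _) => M1 M2 S.
  by rewrite !mxE.
have t1 : \sum_(i < 7) \sum_(j < 7) A i i * A j j = \tr A ^+ 2.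
  by rewrite expr2 /mxtrace mulr_suml; apply: eq_bigr => i _; rewrite mulr_sumr.
have t2 : \sum_(i < 7) \sum_(j < 7) A j i * A i j = \tr (A *m A).
  rewrite exchange_big /mxtrace; apply: eq_bigr => i _; rewrite mxE.
  by apply: eq_bigr => j _.
have t3 : \sum_(i < 7) \sum_(j < 7) \sum_(k < 7) c k i j * (A^T *m Phi k *m A) i j = 6 * \tr A.
  transitivity (\sum_(k < 7) \sum_(i < 7) \sum_(j < 7) c k i j * (A^T *m Phi k *m A) i j).
    under eq_bigr do rewrite exchange_big /=.
    by rewrite exchange_big.
  rewrite mulr_sumr; apply: eq_bigr => k _; rewrite PhiA.
  transitivity (\sum_(l < 7) A k l * \sum_(i < 7) \sum_(j < 7) c k i j * c l i j).
    under [RHS]eq_bigr do rewrite mulr_sumr.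
    rewrite [RHS]exchange_big; apply: eq_bigr => i _; under [RHS]eq_bigr do rewrite mulr_sumr.
    rewrite [RHS]exchange_big; apply: eq_bigr => j _; rewrite summxE mulr_sumr.
    by apply: eq_bigr => l _; rewrite !mxE; ring.
  rewrite (bigD1 k) //= oct_orth eqxx big1 => [|l lk]; last first.
    by rewrite oct_orth eq_sym (negPf lk) !mulr0.
  by rewrite mulr1 addr0 mulrC.
rewrite -t1 -t2; have h6 : \tr A = 6^-1 * (6 * \tr A) by field.
rewrite {1}h6 -t3 !mulr_sumr -!sumrB mulr_sumr -sumrB; apply: eq_bigr => i _.
rewrite -sumrB !mulr_sumr -sumrB; apply: eq_bigr => j _.
by [].
Qed.
End Projector.

(** A trace on a submodule is a trace on the whole module after composition with
a projection onto it, which avoids choosing a basis of g_2. *)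
Lemma mxtrace_submod_proj (F : fieldType) (gT : finGroupType) (G : {group gT}) n
    (rG : mx_representation F G n) (U P : 'M[F]_n) (modU : mxmodule rG U) x :
  x \in G -> (P <= U)%MS -> U *m P = U -> \tr (submod_mx modU x) = \tr (rG x *m P).
Proof.
move=> Gx PU UP; rewrite /submod_mx.
have idP m (W : 'M[F]_(m, n)) : (W <= U)%MS -> W *m P = W by case/submxP=> D ->; rewrite -mulmxA UP.
have BU : (val_submod (1%:M : 'M[F]_(\rank U)) *m rG x <= U)%MS.
  by rewrite (submx_trans (submxMr _ (val_submodP _))) // (mxmoduleP modU).
have PDB : P *m in_submod U 1%:M *m val_submod 1%:M = P.
  by rewrite -in_submodE -val_submodE in_submodK.
rewrite -(idP _ _ BU) in_submodE; move: PDB.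
move: (val_submod _) (in_submod U _) => B D PDB.
by rewrite -(mulmxA _ P D) mxtrace_mulC mulmxA PDB mxtrace_mulC.
Qed.

(** The exterior square of the 7-dimensional representation of G_2 is so(7), the
sum of the adjoint representation and of the 7-dimensional one. *)
Lemma mxtrace_varrho2 (R : realType) (gT : finGroupType) (G : {group gT})
    (iota : G2_embedding R G) x : x \in G ->
  \tr (varrho2 iota x) =
  2^-1 * (\tr (varrho1 iota x) ^+ 2 - \tr (varrho1 iota (x ^+ 2)%g)) - \tr (varrho1 iota x).
Proof.
move=> Gx; have oG := emb_G2 iota Gx; pose f : {rmorphism R -> R[i]} := real_complex R.
have tE n (M : 'M[R]_n) : \tr (map_mx (real_complex R) M) = f (\tr M) by exact: trace_map_mx.
rewrite /varrho1 /varrho2 !map_reprE !tE /=.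
rewrite expgS expg1 repr_mxM // -[2^-1]/(2%:R^-1) -(rmorph_nat f 2) -fmorphV.
rewrite -rmorphXn -rmorphB -rmorphM -rmorphB; congr (f _).
rewrite -(mxtrace_conj_g2proj oG).
have pS : (lin_mx (@g2proj R) <= g2 R)%MS.
  by apply/rV_subP => v /submxP[u ->]; rewrite mul_rV_lin g2proj_mem.
have pid : g2 R *m lin_mx (@g2proj R) = g2 R.
  apply/row_matrixP => i; rewrite row_mul mul_rV_lin /= g2proj_id ?vec_mxK //.
  exact: row_sub.
rewrite (mxtrace_submod_proj (g2_module iota) Gx pS pid).
have [oA _] := oG.
have VA : iota x^-1%g = (iota x)^T.
  have := repr_mxK iota Gx 1%:M; rewrite mul1mx => h.
  by rewrite -[LHS]mul1mx -(mulmx1C oA) -mulmxA h mulmx1.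
rewrite mxtrace_mulC /= /Ad_mx.
have -> : lin_mx (@g2proj R) *m lin_mx (mulmxr (iota x) \o mulmx (iota x^-1%g)) =
    lin_mx (mulmxr (iota x) \o mulmx (iota x^-1%g) \o @g2proj R).
  apply/row_matrixP => i; rewrite !rowE mulmxA !mul_rV_lin /=.
  by rewrite mxvecK.
rewrite mxtrace_lin_mx; apply: eq_bigr => i _; apply: eq_bigr => j _ /=.
by rewrite VA.
Qed.

(** * Moments of the two embeddings *)
Lemma class_moment_average (R : realType) (gT : finGroupType) (G : {group gT})
    (iota : G2_embedding R G) m n : class_moment iota m n =
  #|G|%:R^-1 * \sum_(x in G) \tr (varrho1 iota x) ^+ m * \tr (varrho2 iota x) ^+ n.
Proof.
rewrite (@sum_by_classes _ G _ (fun x => \tr (varrho1 iota x) ^+ m * \tr (varrho2 iota x) ^+ n)).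
  by rewrite mulr_sumr; apply: eq_bigr => xG _; rewrite !mulrA (mulrC _^-1).
by move=> x y Gx Gy; rewrite !mxtrace_repr_conj.
Qed.

(** Class sizes with the values of the two fundamental characters, merged by
element order 1, 2, 3, 4, 6, 7, 8: the merged classes share these values.  The
boolean selects the embedding, true for the irreducible one. *)
Definition character_table (b : bool) : seq (nat * (int * int)) :=
  [:: (1%N, (7, 14)); (49%N, (-1, -2)); (56%N, (1, -1)); (42%N, (if b then -1 else 3, 2));
      (56%N, (-1, 1)); (48%N, (0, 0)); (84%N, (if b then 1 else -1, 0))].

Section CharacterTable.
Variable R : realType.
Local Notation C := R[i].
Variables (gT : finGroupType) (G : {group gT}) (gh gk gu : gT).
Hypotheses (gh_mem : gh \in G) (gk_mem : gk \in G) (gu_mem : gu \in G).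
Hypotheses (h8 : (gh ^+ 8 = 1)%g) (k6 : (gk ^+ 6 = 1)%g) (u7 : (gu ^+ 7 = 1)%g).
Hypotheses (ch : exists2 y, y \in G & (gh ^+ 7 = gh ^ y)%g)
  (ck : exists2 y, y \in G & (gk ^+ 5 = gk ^ y)%g)
  (cu : exists2 y, y \in G & (gu ^+ 3 = gu ^ y)%g).
Hypothesis cardG : #|G| = 336%N.
Hypothesis sumG : forall F : gT -> C, {in G &, forall x y, F (x ^ y)%g = F x} ->
  \sum_(x in G) F x =
  F 1%g + F (gh ^+ 4)%g *+ 21 + F (gk ^+ 3)%g *+ 28 + F (gk ^+ 2)%g *+ 56 + F (gh ^+ 2)%g *+ 42
  + F gk *+ 56 + F gu *+ 48 + F gh *+ 42 + F (gh ^+ 3)%g *+ 42.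

(** The class representatives are gh^4, gk^3, gk^2, gh^2, gk, gu, gh and gh^3; the
values at the last two, of order 8, coincide for the characters in question. *)
Definition has_values n (rG : mx_representation C G n) (u v c3 c4 c6 c7 c8 : int) :=
  [/\ [/\ \tr (rG (gh ^+ 4)%g) = u%:~R, \tr (rG (gk ^+ 3)%g) = v%:~R, \tr (rG (gk ^+ 2)%g) = c3%:~R &
      \tr (rG (gh ^+ 2)%g) = c4%:~R], \tr (rG gk) = c6%:~R, \tr (rG gu) = c7%:~R,
      \tr (rG gh) = c8%:~R & \tr (rG (gh ^+ 3)%g) = c8%:~R].

Lemma nontrivial_at n (rG : mx_representation C G n) x : x \in G -> \tr (rG x) != n%:R ->
  exists2 y, y \in G & rG y != 1%:M.
Proof. by move=> Gx h; exists x => //; apply: contraNneq h => ->; rewrite mxtrace1. Qed.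

Lemma values7 (rG : mx_representation C G 7) : mx_irreducible rG -> \tr (rG (gk ^+ 3)%g) = -1 ->
  has_values rG (-1) (-1) 1 (-1) (-1) 0 1.
Proof.
move=> irrG v1.
have nt : exists2 y, y \in G & rG y != 1%:M.
  apply: (@nontrivial_at _ _ (gk ^+ 3)%g); rewrite ?groupX // v1.
  by rewrite -subr_eq0 -opprD oppr_eq0 -(natrD _ 1 7) pnatr_eq0.
have [u [v [c3 [c4 [c6 [c7 [p [q [s [a [b [d [e [f [g H]]]]]]]]]]]]]]] :=
  irr_PGL27_constraints gh_mem gk_mem gu_mem h8 k6 u7 ch ck cu cardG sumG irrG nt.
case: H => [[tu tv t3 t4 t6] [t7 th th3] [[hu hv h3] [h4 h6 h7]] hs hn].
have ev : v = -1 by apply: (@intr_inj C); rewrite -tv v1.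
rewrite ev in hs hn; have [[eu e3 e4 e6] e7 ep eq] := degree7_values hu h3 h4 h6 h7 hs hn.
by rewrite /has_values tu tv t3 t4 t6 t7 th th3 eu ev e3 e4 e6 e7 ep eq mulr0 addr0 subr0.
Qed.

Lemma values6 (rG : mx_representation C G 6) : mx_irreducible rG -> \tr (rG (gh ^+ 4)%g) = -2 ->
  has_values rG (-2) 0 0 2 0 (-1) 0.
Proof.
move=> irrG v1.
have nt : exists2 y, y \in G & rG y != 1%:M.
  apply: (@nontrivial_at _ _ (gh ^+ 4)%g); rewrite ?groupX // v1.
  by rewrite -subr_eq0 -opprD oppr_eq0 -(natrD _ 2 6) pnatr_eq0.
have [u [v [c3 [c4 [c6 [c7 [p [q [s [a [b [d [e [f [g H]]]]]]]]]]]]]]] :=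
  irr_PGL27_constraints gh_mem gk_mem gu_mem h8 k6 u7 ch ck cu cardG sumG irrG nt.
case: H => [[tu tv t3 t4 t6] [t7 th th3] [[hu hv h3] [h4 h6 h7]] hs hn].
have eu : u = -2 by apply: (@intr_inj C); rewrite -tu v1.
rewrite eu in hs hn; have [[ev e3 e4 e6] e7 ep eq] := degree6_values hv h3 h4 h6 h7 hs hn.
by rewrite /has_values tu tv t3 t4 t6 t7 th th3 eu ev e3 e4 e6 e7 ep eq mulr0 addr0 subr0.
Qed.

Lemma values1 (rG : mx_representation C G 1) : ~~ (G \subset rker rG) ->
  has_values rG 1 (-1) 1 1 (-1) 1 (-1).
Proof.
move=> ker; have irrG : mx_irreducible rG by apply/mx_abs_irrW/linear_mx_abs_irr.
have nt : exists2 y, y \in G & rG y != 1%:M.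
  have [x Gx nx] := subsetPn ker; exists x => //.
  by apply: contraNneq nx => e; apply/rkerP.
have [u [v [c3 [c4 [c6 [c7 [p [q [s [a [b [d [e [f [g H]]]]]]]]]]]]]]] :=
  irr_PGL27_constraints gh_mem gk_mem gu_mem h8 k6 u7 ch ck cu cardG sumG irrG nt.
case: H => [[tu tv t3 t4 t6] [t7 th th3] [[hu hv h3] [h4 h6 h7]] hs hn].
have [[eu ev e3] [e4 e6 e7] ep eq] := degree1_values hu hv h3 h4 h6 h7 hs hn.
by rewrite /has_values tu tv t3 t4 t6 t7 th th3 eu ev e3 e4 e6 e7 ep eq mulr0 addr0 subr0.
Qed.

Variable iota : G2_embedding R G.
Local Notation rho := (varrho1 iota).

Lemma has_values_rsim n (rG : mx_representation C G n) m (rG' : mx_representation C G m) u v c3 c4 c6 c7 c8 :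
  mx_rsim rG rG' -> has_values rG' u v c3 c4 c6 c7 c8 -> has_values rG u v c3 c4 c6 c7 c8.
Proof.
move=> sim; have E x : x \in G -> \tr (rG x) = \tr (rG' x) by exact: mxtrace_rsim sim x.
by rewrite /has_values !E ?groupX.
Qed.

(** The squares of the class representatives are located among the classes by
the power conjugacies, which turns the formula for the second character into an
expression in the values of the first. *)
Lemma class_moment_values u v c3 c4 c6 c7 c8 m n : has_values rho u v c3 c4 c6 c7 c8 ->
  let psi (a b : int) : C := a%:~R ^+ m * ((a%:~R ^+ 2 - b%:~R) / 2 - a%:~R) ^+ n in
  class_moment iota m n =
    (psi 7 7 + 21 * psi u 7 + 28 * psi v 7 + 56 * psi c3 c3 + 42 * psi c4 u + 56 * psi c6 c3
     + 48 * psi c7 c7 + 84 * psi c8 c4) / 336.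
Proof.
case=> [[tu tv t3 t4] t6 t7 th th3] psi.
have H := mxtrace_power_conj rho _ gh_mem h8 ch; have K := mxtrace_power_conj rho _ gk_mem k6 ck.
have U := mxtrace_power_conj rho _ gu_mem u7 cu.
have X (x : gT) i j : (x ^+ i ^+ j = x ^+ (i * j))%g by rewrite expgM.
pose F x : C := \tr (rho x) ^+ m * \tr (varrho2 iota x) ^+ n.
have FE x a b : x \in G -> \tr (rho x) = a%:~R -> \tr (rho (x ^+ 2)%g) = b%:~R -> F x = psi a b.
  by move=> Gx ea eb; rewrite /F mxtrace_varrho2 // ea eb mulrC (mulrC 2^-1) mulrC.
have t1 : \tr (rho 1%g) = 7%:~R by rewrite repr_mx1 mxtrace1.
have e1 : F 1%g = psi 7 7 by apply: FE; rewrite ?expg1n.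
have eu : F (gh ^+ 4)%g = psi u 7 by apply: FE; rewrite ?groupX // X h8.
have ev : F (gk ^+ 3)%g = psi v 7 by apply: FE; rewrite ?groupX // X k6.
have e3 : F (gk ^+ 2)%g = psi c3 c3 by apply: FE; rewrite ?groupX // X K.
have e4 : F (gh ^+ 2)%g = psi c4 u by apply: FE; rewrite ?groupX // X.
have e6 : F gk = psi c6 c3 by exact: FE.
have e7 : F gu = psi c7 c7.
  apply: FE => //; rewrite -t7 -[in RHS](expg1 gu) [RHS]U [RHS]U; exact.
have eh : F gh = psi c8 c4 by exact: FE.
have eh3 : F (gh ^+ 3)%g = psi c8 c4 by apply: FE; rewrite ?groupX // X [LHS]H.
rewrite class_moment_average (sumG (F := F)); last first.
  by move=> x y Gx Gy; rewrite /F !mxtrace_repr_conj.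
rewrite e1 eu ev e3 e4 e6 e7 eh eh3 cardG; clearbody psi.
by move: (336%:R^-1 : C) => z; ring.
Qed.

Definition table_moment b m n : C :=
  \sum_(y <- character_table b) y.1%:R / 336 * (y.2.1%:~R ^+ m * y.2.2%:~R ^+ n).

Lemma class_moment_table (b : bool) m n :
  has_values rho (-1) (-1) 1 (if b then -1 else 3) (-1) 0 (if b then 1 else -1) ->
  class_moment iota m n = table_moment b m n.
Proof.
move=> /(class_moment_values m n) /= ->.
have psiE (x y z : int) : x ^+ 2 - y = 2 * (x + z) ->
    x%:~R ^+ m * ((x%:~R ^+ 2 - y%:~R) / 2 - x%:~R) ^+ n = x%:~R ^+ m * z%:~R ^+ n :> C.
  move=> e; congr (_ * _ ^+ n).
  have -> : x%:~R ^+ 2 - y%:~R = 2 * (x%:~R + z%:~R) :> C.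
    by rewrite -intrD -(intrM _ 2) -e intrB rmorphXn.
  by field.
rewrite (psiE 7 7 14) // (psiE (-1) 7 (-2)) // (psiE 1 1 (-1)) // (psiE (-1) 1 1) // (psiE 0 0 0) //.
rewrite (psiE (if b then -1 else 3) (-1) 2); last by case: b.
rewrite (psiE (if b then 1 else -1) (if b then -1 else 3) 0); last by case: b.
rewrite /table_moment /character_table !big_cons big_nil.
rewrite ![(_, _).1]/= ![(_, _).2]/=.
move: (7%:~R ^+ m) ((-1)%:~R ^+ m) (1%:~R ^+ m) (0%:~R ^+ m) ((if b then -1 else 3)%:~R ^+ m)
  ((if b then 1 else -1)%:~R ^+ m).
move: (14%:~R ^+ n) ((-1)%:~R ^+ n) ((-2)%:~R ^+ n) (1%:~R ^+ n) (0%:~R ^+ n) (2%:~R ^+ n).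
by move=> a1 a2 a3 a4 a5 a6 b1 b2 b3 b4 b5 b6; move: (336^-1 : C) => z; ring.
Qed.

Lemma class_moment_Sigma7 (s7 : mx_representation C G 7) m n : mx_irreducible s7 ->
  \tr (s7 (gk ^+ 3)%g) = -1 -> mx_rsim rho s7 -> class_moment iota m n = table_moment true m n.
Proof.
move=> irr7 tr7 sim; apply: class_moment_table.
by apply: has_values_rsim sim _; exact: values7.
Qed.

Lemma class_moment_Sigma16 (s1 : mx_representation C G 1) (s6 : mx_representation C G 6) m n :
  ~~ (G \subset rker s1) -> mx_irreducible s6 -> \tr (s6 (gh ^+ 4)%g) = -2 ->
  mx_rsim rho (dadd_grepr (Representation s1) (Representation s6)) ->
  class_moment iota m n = table_moment false m n.
Proof.
move=> ker1 irr6 v6 sim; apply: class_moment_table.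
apply: has_values_rsim sim _.
have [[u1 v1 c31 c41] c61 c71 c81 d81] := values1 ker1.
have [[u6 v6' c36 c46] c66 c76 c86 d86] := values6 irr6 v6.
have tE x : \tr (dadd_grepr (Representation s1) (Representation s6) x) = \tr (s1 x) + \tr (s6 x).
  exact: mxtrace_block.
rewrite /has_values !tE u1 u6 v1 v6' c31 c36 c41 c46 c61 c66 c71 c76 c81 c86 d81 d86.
by rewrite -!intrD.
Qed.
End CharacterTable.

(** * The Weyl group on the torus *)

(** Matrices as quadruples, on which products evaluate. *)
Definition mx4 (q : int * int * int * int) : 'M[int]_2 :=
  let: (a, b, c, d) := q in mx2 a b c d.
Definition mul4 (p q : int * int * int * int) : int * int * int * int :=
  let: (a, b, c, d) := p in let: (a', b', c', d') := q in
  (a * a' + b * c', a * b' + b * d', c * a' + d * c', c * b' + d * d').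
Definition weyl4 : seq (int * int * int * int) :=
  [:: (1, 0, 0, 1); (1, 0, 1, -1); (0, -1, -1, 0); (0, -1, 1, -1); (-1, 1, -1, 0); (-1, 1, 0, 1);
     (-1, 0, 0, -1); (-1, 0, -1, 1); (0, 1, 1, 0); (0, 1, -1, 1); (1, -1, 1, 0); (1, -1, 0, -1)].
Definition weyl : seq 'M[int]_2 := map mx4 weyl4.

Lemma mx4M p q : mx4 (mul4 p q) = mx4 p *m mx4 q.
Proof.
case: p q => [[[a b] c] d] [[[a' b'] c'] d']; apply/matrixP => i j.
rewrite !mxE big_ord_recl big_ord1 !mxE /=.
by case: i => [[|[|]] ?] //=; case: j => [[|[|]] ?].
Qed.
Lemma mx4_inj : injective mx4.
Proof.
move=> [[[a b] c] d] [[[a' b'] c'] d'] /matrixP h.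
have := (h 0 0, h 0 1, h 1 0, h 1 1); rewrite !mxE /=.
by case=> [[[-> ->] ->] ->].
Qed.
Lemma mx4_1 : mx4 (1, 0, 0, 1) = 1%:M.
Proof.
by apply/matrixP => i j; rewrite !mxE; case: i => [[|[|]] ?] //=; case: j => [[|[|]] ?].
Qed.

Lemma weyl_uniq : uniq weyl.
Proof. by rewrite map_inj_uniq; [vm_compute | exact: mx4_inj]. Qed.

Lemma weyl_cases (P : 'M[int]_2 -> Prop) :
  P (mx2 1 0 0 1) -> P (mx2 1 0 1 (-1)) -> P (mx2 0 (-1) (-1) 0) -> P (mx2 0 (-1) 1 (-1)) ->
  P (mx2 (-1) 1 (-1) 0) -> P (mx2 (-1) 1 0 1) ->
  P (mx2 (-1) 0 0 (-1)) -> P (mx2 (-1) 0 (-1) 1) -> P (mx2 0 1 1 0) -> P (mx2 0 1 (-1) 1) ->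
  P (mx2 1 (-1) 1 0) -> P (mx2 1 (-1) 0 (-1)) -> forall g, g \in weyl -> P g.
Proof.
move=> ? ? ? ? ? ? ? ? ? ? ? ? g /mapP[p + ->].
by do 11![rewrite in_cons => /predU1P[->//|]]; rewrite mem_seq1 => /eqP->.
Qed.

Lemma weyl_mul_perm g : g \in weyl -> perm_eq (map (fun h => g *m h) weyl) weyl.
Proof.
case/mapP => p pW ->; rewrite -map_comp (eq_map (g := mx4 \o mul4 p)); last first.
  by move=> q /=; rewrite mx4M.
rewrite map_comp perm_map //; move: p pW; apply/allP; by vm_compute.
Qed.
Lemma weyl_mulr_perm g : g \in weyl -> perm_eq (map (fun h => h *m g) weyl) weyl.
Proof.
case/mapP => p pW ->; rewrite -map_comp (eq_map (g := mx4 \o (fun q => mul4 q p))); last first.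
  by move=> q /=; rewrite mx4M.
rewrite map_comp perm_map //; move: p pW; apply/allP; by vm_compute.
Qed.

Lemma weyl_inv g : g \in weyl -> g \in unitmx /\ invmx g \in weyl.
Proof.
case/mapP => p pW ->.
have : has (fun q => mul4 p q == (1, 0, 0, 1)) weyl4 by move: p pW; apply/allP; vm_compute.
case/hasP => q qW /eqP pq; have e : mx4 p *m mx4 q = 1%:M by rewrite -mx4M pq mx4_1.
have [u _] := mulmx1_unit e; split=> //.
have -> : invmx (mx4 p) = mx4 q by rewrite -[RHS](mulKmx u) e mulmx1.
exact: map_f.
Qed.

Lemma D12_weyl g : D12 g <-> g \in weyl.
Proof.
split; last first.
  have t2 : D12 (mx4 (0, -1, -1, 0)) by exact: D12_T2.
  have t6 : D12 (mx4 (0, 1, -1, 1)) by exact: D12_T6.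
  have m p q : D12 (mx4 p) -> D12 (mx4 q) -> D12 (mx4 (mul4 p q)) by rewrite mx4M; exact: D12_mul.
  have a2 := m _ _ t6 t6; have a3 := m _ _ t6 a2; have a4 := m _ _ t6 a3; have a5 := m _ _ t6 a4.
  have b1 := m _ _ t2 t6; have b2 := m _ _ t2 a2; have b3 := m _ _ t2 a3; have b4 := m _ _ t2 a4.
  have b5 := m _ _ t2 a5; have a0 := m _ _ t6 a5.
  move: g; apply: weyl_cases; first [exact: a0|exact: t6|exact: a2|exact: a3
   |exact: a4|exact: a5|exact: t2|exact: b1|exact: b2|exact: b3|exact: b4|exact: b5].
elim=> {g} [||||].
- by apply: (map_f mx4 (x := (0, -1, -1, 0))).
- by apply: (map_f mx4 (x := (0, 1, -1, 1))).
- by rewrite -mx4_1; apply: map_f.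
- move=> g h _ gW _ hW; rewrite -(perm_mem (weyl_mul_perm gW)); exact: map_f.
by move=> g _ /weyl_inv[].
Qed.

Section Torus.
Variable R : realType.
Local Notation C := R[i].
Implicit Types w : torus R.

Lemma cval_neq0 (z : circle R) : cval z != 0.
Proof. by rewrite -normr_eq0 (eqP (cval_norm z)) oner_neq0. Qed.

Lemma circle_inj (z z' : circle R) : cval z = cval z' -> z = z'.
Proof. exact: val_inj. Qed.

Lemma torusP w w' : cval w.1 = cval w'.1 -> cval w.2 = cval w'.2 -> w = w'.
Proof. by case: w w' => [a b] [a' b'] /= /circle_inj -> /circle_inj ->. Qed.

Lemma expz_monomial (x y : C) (a b a' b' c d : int) : x != 0 -> y != 0 ->
  (x ^ a * y ^ b) ^ c * (x ^ a' * y ^ b') ^ d = x ^ (c * a + d * a') * y ^ (c * b + d * b').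
Proof.
move=> x0 y0; rewrite !expfzMl !exprz_exp !expfzDr // mulrACA.
by rewrite (mulrC a) (mulrC b) (mulrC a') (mulrC b').
Qed.

Lemma act_mul g h w : act (g *m h) w = act g (act h w).
Proof.
have n1 := cval_neq0 w.1; have n2 := cval_neq0 w.2.
have s2 (F : 'I_2 -> int) : \sum_i F i = F 0 + F 1 by rewrite big_ord_recl big_ord1; congr (_ + F _); exact: val_inj.
by apply: torusP; rewrite /= [LHS]/= !mxE !s2 expz_monomial.
Qed.

Lemma act_mx2 a b c d w : act (mx2 a b c d) w = (monomial a b w, monomial c d w).
Proof. by rewrite /act !mxE. Qed.

(** The eigenvalues of the 7-dimensional representation are 1, x, y, z and their
inverses, where x y z = 1; e1 and e2 are the elementary symmetric functions of
x, y, z of degrees 1 and 2. *)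
Definition tx w : C := cval w.1.
Definition ty w : C := (cval w.2)^-1.
Definition tz w : C := cval w.2 / cval w.1.
Definition e1 w : C := tx w + ty w + tz w.
Definition e2 w : C := (tx w)^-1 + (ty w)^-1 + (tz w)^-1.

Lemma chi1_e w : chi1 w = 1 + e1 w + e2 w.
Proof.
have n1 := cval_neq0 w.1; have n2 := cval_neq0 w.2.
rewrite /chi1 /e1 /e2 /tx /ty /tz; field.
by rewrite n1 n2.
Qed.

Lemma chi2_e w : chi2 w = chi1 w + e1 w * e2 w - 2.
Proof.
have n1 := cval_neq0 w.1; have n2 := cval_neq0 w.2.
rewrite /chi2 /e1 /e2 /tx /ty /tz; field.
by rewrite n1 n2.
Qed.

Lemma chi_act g w : g \in weyl -> chi1 (act g w) = chi1 w /\ chi2 (act g w) = chi2 w.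
Proof.
move=> gW; have n1 := cval_neq0 w.1; have n2 := cval_neq0 w.2.
suff: (e1 (act g w) = e1 w /\ e2 (act g w) = e2 w) \/ (e1 (act g w) = e2 w /\ e2 (act g w) = e1 w).
  by case=> -[h1 h2]; split; rewrite ?chi2_e !chi1_e h1 h2; ring.
have n12 : (cval w.1 != 0) && (cval w.2 != 0) by rewrite n1.
move: g gW; apply: weyl_cases; rewrite act_mx2 /e1 /e2 /tx /ty /tz /=;
  rewrite ?expr0z ?expr1z ?exprN1; move: (cval w.1) (cval w.2) n1 n2 n12 => x y n1 n2 n12;
  (left; split; field; exact n12) || (right; split; field; exact n12).
Qed.

(** Equal elementary symmetric functions mean equal triples up to order; the two
coordinates that the torus point needs are recorded. *)
Lemma sym3_eq (x y z x' y' z' : C) :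
  x + y + z = x' + y' + z' -> x * y + y * z + z * x = x' * y' + y' * z' + z' * x' ->
  x * y * z = x' * y' * z' ->
  [\/ x = x' /\ y = y' \/ x = x' /\ y = z', x = y' /\ y = x' \/ x = y' /\ y = z' |
     x = z' /\ y = x' \/ x = z' /\ y = y'].
Proof.
have root a b c a' b' c' : a + b + c = a' + b' + c' ->
    a * b + b * c + c * a = a' * b' + b' * c' + c' * a' -> a * b * c = a' * b' * c' ->
    (a - a') * (a - b') * (a - c') = 0 :> C.
  move=> h1 h2 h3.
  transitivity (a ^+ 3 - (a' + b' + c') * a ^+ 2 + (a' * b' + b' * c' + c' * a') * a - a' * b' * c').
    by ring.
  by rewrite -h1 -h2 -h3; ring.
have two a b a' b' : a + b = a' + b' -> a * b = a' * b' -> a = a' \/ a = b' :> C.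
  move=> h1 h2; have : (a - a') * (a - b') = 0.
    by transitivity (a ^+ 2 - (a' + b') * a + a' * b'); [ring|rewrite -h1 -h2; ring].
  by move/eqP; rewrite mulf_eq0 !subr_eq0 => /orP[/eqP|/eqP]; [left|right].
have rest a b c a' b' : a + b + c = a + a' + b' -> a * b + b * c + c * a = a * a' + a' * b' + b' * a ->
    b = a' \/ b = b' :> C.
  move=> h1 h2; have e1 : b + c = a' + b' by apply: (addrI a); rewrite !addrA.
  apply: (two b c) => //.
  transitivity ((a * b + b * c + c * a) - a * (b + c)); first by ring.
  by rewrite h2 e1; ring.
move=> h1 h2 h3; have /eqP := root _ _ _ _ _ _ h1 h2 h3.
rewrite !mulf_eq0 !subr_eq0 => /orP[/orP[]|] /eqP e; rewrite e in h1 h2 h3 *.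
- by apply: Or31; case: (rest _ _ _ _ _ h1 h2) => ->; [left|right].
- apply: Or32; have h1' : y' + y + z = y' + x' + z' by rewrite h1; ring.
  have h2' : y' * y + y * z + z * y' = y' * x' + x' * z' + z' * y' by rewrite h2; ring.
  by case: (rest _ _ _ _ _ h1' h2') => ->; [left|right].
apply: Or33; have h1' : z' + y + z = z' + x' + y' by rewrite h1; ring.
have h2' : z' * y + y * z + z * z' = z' * x' + x' * y' + y' * z' by rewrite h2; ring.
by case: (rest _ _ _ _ _ h1' h2') => ->; [left|right].
Qed.

Lemma e1_e2_separate w w' : e1 w = e1 w' -> e2 w = e2 w' -> exists2 g, g \in weyl & w = act g w'.
Proof.
have n1 := cval_neq0 w.1; have n2 := cval_neq0 w.2.
have n1' := cval_neq0 w'.1; have n2' := cval_neq0 w'.2.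
have p v : tx v * ty v * tz v = 1.
  have m1 := cval_neq0 v.1; have m2 := cval_neq0 v.2.
  by rewrite /tx /ty /tz; field; rewrite m1 m2.
have q v : e2 v = tx v * ty v + ty v * tz v + tz v * tx v.
  have m1 := cval_neq0 v.1; have m2 := cval_neq0 v.2.
  by rewrite /e2 /tx /ty /tz; field; rewrite m1 m2.
rewrite !q /e1 => h1 h2; have := sym3_eq h1 h2 (etrans (p w) (esym (p w'))).
have mem a b c d : mx2 a b c d \in weyl -> cval w.1 = cval w'.1 ^ a * cval w'.2 ^ b ->
    cval w.2 = cval w'.1 ^ c * cval w'.2 ^ d -> exists2 g, g \in weyl & w = act g w'.
  by move=> gW e e'; exists (mx2 a b c d) => //; rewrite act_mx2; apply: torusP.
have inv a b : a^-1 = b -> a = b^-1 :> C by move=> <-; rewrite invrK.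
have W p' : p' \in weyl4 -> mx4 p' \in weyl by apply: map_f.
rewrite /tx /ty /tz; case=> [[[a /invr_inj b]|[a /inv b]]|[[a /inv b]|[a /inv b]]|[[a /inv b]|[a /invr_inj b]]].
- by apply: (mem 1 0 0 1 (W (1, 0, 0, 1) isT)); rewrite ?a ?b ?expr0z ?expr1z ?exprN1; field; rewrite ?n1' ?n2'.
- by apply: (mem 1 0 1 (-1) (W (1, 0, 1, -1) isT)); rewrite ?a ?b ?expr0z ?expr1z ?exprN1; field; rewrite ?n1' ?n2'.
- by apply: (mem 0 (-1) (-1) 0 (W (0, -1, -1, 0) isT)); rewrite ?a ?b ?expr0z ?expr1z ?exprN1; field; rewrite ?n1' ?n2'.
- by apply: (mem 0 (-1) 1 (-1) (W (0, -1, 1, -1) isT)); rewrite ?a ?b ?expr0z ?expr1z ?exprN1; field; rewrite ?n1' ?n2'.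
- by apply: (mem (-1) 1 (-1) 0 (W (-1, 1, -1, 0) isT)); rewrite ?a ?b ?expr0z ?expr1z ?exprN1; field; rewrite ?n1' ?n2'.
by apply: (mem (-1) 1 0 1 (W (-1, 1, 0, 1) isT)); rewrite ?a ?b ?expr0z ?expr1z ?exprN1; field; rewrite ?n1' ?n2'.
Qed.

(** The two characters determine e1 + e2 and e1 e2, hence the unordered pair
{e1, e2}, hence the multiset {x, y, z} up to a global inversion; permutations
and inversion are exactly the Weyl group. *)
Lemma chi_separates w w' : chi1 w = chi1 w' -> chi2 w = chi2 w' -> exists2 g, g \in weyl & w = act g w'.
Proof.
move=> h1 h2; have s : e1 w + e2 w = e1 w' + e2 w'.
  by apply: (addrI 1); rewrite (addrA 1 (e1 w)) (addrA 1 (e1 w')) -!chi1_e.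
have p : e1 w * e2 w = e1 w' * e2 w'.
  by apply: (addrI (chi1 w)); apply: (addIr (- 2)); rewrite -chi2_e h1 -chi2_e.
have : (e1 w - e1 w') * (e1 w - e2 w') = 0.
  transitivity (e1 w ^+ 2 - (e1 w' + e2 w') * e1 w + e1 w' * e2 w'); first by ring.
  by rewrite -s -p; ring.
move/eqP; rewrite mulf_eq0 !subr_eq0 => /orP[]/eqP e.
  by apply: e1_e2_separate => //; move: s; rewrite e => /addrI.
pose v := act (mx2 (-1) 0 0 (-1)) w'.
have nW : mx2 (-1) 0 0 (-1) \in weyl by apply: (map_f mx4 (x := (-1, 0, 0, -1))).
have n1' := cval_neq0 w'.1; have n2' := cval_neq0 w'.2.
have v1 : e1 v = e2 w'.
  rewrite /v act_mx2 /e1 /e2 /tx /ty /tz /= ?expr0z ?exprN1; field; by rewrite n1' n2'.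
have v2 : e2 v = e1 w'.
  rewrite /v act_mx2 /e1 /e2 /tx /ty /tz /= ?expr0z ?exprN1; field; by rewrite n1' n2'.
have [||g gW ->] := @e1_e2_separate w v; first by rewrite v1.
  by rewrite v2; move: s; rewrite e addrC => /addIr.
exists (g *m mx2 (-1) 0 0 (-1)); last by rewrite act_mul.
by rewrite -(perm_mem (weyl_mul_perm gW)) map_f.
Qed.
End Torus.

Local Open Scope classical_set_scope.
Local Open Scope ring_scope.

(** * Finitely supported measures *)
Section DiscreteMeasure.
Context d (T : measurableType d) (R : realType).
Implicit Types (l : seq (R * T)) (D : set T) (f : T -> R).

Definition atom l k : R * T := nth (0, point) l k.
(** Weights are wrapped in an absolute value so that every list defines a
measure; the lemmas assume nonnegative weights, where this has no effect. *)
Definition atoms l : {measure set T -> \bar R} :=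
  msum (fun k => mscale (NngNum (normr_ge0 (atom l k).1)) \d_((atom l k).2)) (size l).

Definition nneg_weights l := all (fun x => 0 <= x.1) l.

Lemma atom_sum l (V : zmodType) (F : R * T -> V) :
  \sum_(k < size l) F (atom l k) = \sum_(x <- l) F x.
Proof. by rewrite (big_nth (0, point)) big_mkord. Qed.

Lemma atom_ge0 l (k : nat) : nneg_weights l -> `|(atom l k).1| = (atom l k).1.
Proof.
move=> h; rewrite ger0_norm // /atom; have [kl|kl] := ltnP k (size l); last by rewrite nth_default.
exact: (all_nthP _ h).
Qed.

Lemma ge0_integral_atoms l D (f : T -> \bar R) : nneg_weights l -> measurable D ->
  measurable_fun setT f -> (forall x, (0 <= f x)%E) ->
  (\int[atoms l]_(x in D) f x = \sum_(x <- l) (x.1%:E * (\d_(x.2) D * f x.2)))%E.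
Proof.
move=> l0 mD mf f0; have mfD : measurable_fun D f by exact: measurable_funTS.
rewrite ge0_integral_measure_sum //.
transitivity (\sum_(k < size l) ((atom l k).1%:E * (\d_((atom l k).2) D * f (atom l k).2)))%E.
  apply: eq_bigr => k _; rewrite ge0_integral_mscale //= integral_dirac //.
  by rewrite atom_ge0.
by rewrite (big_nth (0, point)) big_mkord.
Qed.

Lemma integral_atoms l D f : nneg_weights l -> measurable D -> measurable_fun setT f ->
  (\int[atoms l]_(x in D) (f x)%:E)%E = (\sum_(x <- l) x.1 * (\1_D x.2 * f x.2))%:E.
Proof.
move=> l0 mD mf; have mF : measurable_fun setT (EFin \o f) by exact/measurable_EFinP.
rewrite integralE !ge0_integral_atoms //; try exact: measurable_funepos; try exact: measurable_funeneg.
transitivity ((\sum_(x <- l) x.1 * (\1_D x.2 * Num.max (f x.2) 0))%:E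
            - (\sum_(x <- l) x.1 * (\1_D x.2 * Num.max (- f x.2) 0))%:E)%E.
  rewrite -!sumEFin; congr (_ - _)%E; apply: eq_bigr => x _.
    by rewrite funeposE diracE indicE -EFin_max !EFinM.
  by rewrite funenegE diracE indicE -EFinN -EFin_max !EFinM.
rewrite -EFinB -sumrB; congr EFin; apply: eq_bigr => x _.
rewrite -!mulrBr; congr (_ * (_ * _)).
by rewrite /Num.max /Order.max; case: ltrP => ?; case: ltrP => ?; lra.
Qed.

Lemma atoms_setE l A : nneg_weights l -> atoms l A = (\sum_(x <- l) x.1 * \1_A x.2)%:E.
Proof.
move=> l0; rewrite -atom_sum -sumEFin; apply: eq_bigr => k _.
transitivity (`|(atom l k).1|%:E * \d_((atom l k).2) A)%E; first by [].
by rewrite atom_ge0 // diracE indicE EFinM.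
Qed.
End DiscreteMeasure.

(** Integrability will always be obtained from boundedness; functions are
combined within the class of bounded measurable functions. *)
Section Measurability.
Variable R : realType.
Local Notation C := R[i].
Local Notation T := (torus R).

Lemma measurable_circle_coord : measurable_fun setT (@circle_coord R).
Proof. by move=> _ B mB; exists B. Qed.

Lemma measurable_circle d (X : measurableType d) (f : X -> circle R) :
  measurable_fun setT (fun x => complex.Re (cval (f x))) ->
  measurable_fun setT (fun x => complex.Im (cval (f x))) -> measurable_fun setT f.
Proof.
move=> mr mi _ B [D mD <-]; rewrite !setTI -comp_preimage.
have m : measurable_fun setT (@circle_coord R \o f) by apply: measurable_fun_pair.
by rewrite -[X in measurable X]setTI; exact: m.
Qed.

Definition bounded_mfun (f : T -> R) := measurable_fun setT f /\ exists M, forall w, `|f w| <= M.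

Lemma bmfun_cst c : bounded_mfun (fun=> c).
Proof. by split; [exact: measurable_cst|exists `|c|]. Qed.
Lemma bmfunD f g : bounded_mfun f -> bounded_mfun g -> bounded_mfun (fun w => f w + g w).
Proof.
move=> [mf [M hM]] [mg [N hN]]; split; first exact: measurable_funD.
by exists (M + N) => w; rewrite (le_trans (ler_normD _ _)) // lerD.
Qed.
Lemma bmfunM f g : bounded_mfun f -> bounded_mfun g -> bounded_mfun (fun w => f w * g w).
Proof.
move=> [mf [M hM]] [mg [N hN]]; split; first exact: measurable_funM.
by exists (M * N) => w; rewrite normrM ler_pM.
Qed.
Lemma bmfunN f : bounded_mfun f -> bounded_mfun (fun w => - f w).
Proof.
move=> /(bmfunM (bmfun_cst (-1))) h; rewrite (_ : (fun w => - f w) = (fun w => -1 * f w)) //.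
by apply/funext => w; rewrite mulN1r.
Qed.

Definition cbounded_mfun (f : T -> C) :=
  bounded_mfun (fun w => complex.Re (f w)) /\ bounded_mfun (fun w => complex.Im (f w)).

Lemma cbmfunD f g : cbounded_mfun f -> cbounded_mfun g -> cbounded_mfun (fun w => f w + g w).
Proof.
move=> [fr fi] [gr gi]; split.
  rewrite (_ : (fun w => _) = (fun w => complex.Re (f w) + complex.Re (g w))); first exact: bmfunD.
  by apply/funext => w; case: (f w) (g w) => [? ?] [? ?].
rewrite (_ : (fun w => _) = (fun w => complex.Im (f w) + complex.Im (g w))); first exact: bmfunD.
by apply/funext => w; case: (f w) (g w) => [? ?] [? ?].
Qed.
Lemma cbmfunM f g : cbounded_mfun f -> cbounded_mfun g -> cbounded_mfun (fun w => f w * g w).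
Proof.
move=> [fr fi] [gr gi]; split.
  rewrite (_ : (fun w => _) = (fun w => complex.Re (f w) * complex.Re (g w) +
     - (complex.Im (f w) * complex.Im (g w)))).
    by apply: bmfunD; [exact: bmfunM|apply: bmfunN; exact: bmfunM].
  by apply/funext => w; case: (f w) (g w) => [? ?] [? ?].
rewrite (_ : (fun w => _) = (fun w => complex.Re (f w) * complex.Im (g w) +
     complex.Im (f w) * complex.Re (g w))).
  by apply: bmfunD; exact: bmfunM.
by apply/funext => w; case: (f w) (g w) => [? ?] [? ?].
Qed.
Lemma cbmfun_cst c : cbounded_mfun (fun=> c).
Proof. by split; exact: bmfun_cst. Qed.
Lemma cbmfunX f n : cbounded_mfun f -> cbounded_mfun (fun w => f w ^+ n).
Proof.
move=> hf; elim: n => [|n ih]; first exact: cbmfun_cst.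
rewrite (_ : (fun w => _) = (fun w => f w * f w ^+ n)); first exact: cbmfunM.
by apply/funext => w; rewrite exprS.
Qed.

Lemma circle_norm (z : circle R) : complex.Re (cval z) ^+ 2 + complex.Im (cval z) ^+ 2 = 1.
Proof.
case: z => -[a b] /= /eqP; rewrite normc_def /= => /(congr1 (@complex.Re R)) /= h.
by rewrite -[LHS]sqr_sqrtr ?h ?expr1n // addr_ge0 // sqr_ge0.
Qed.

Lemma cvalV (z : circle R) : (cval z)^-1 = (cval z)^*%C.
Proof.
have n := cval_neq0 z; apply: (mulfI n); rewrite divff //.
have := circle_norm z; case: (cval z) => a b /= h.
by apply/eqP; rewrite eq_complex /= mulrN opprK -!expr2 h; apply/andP; split; apply/eqP; [|ring].
Qed.

Lemma cbmfun_circle (p : T -> circle R) : measurable_fun setT p ->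
  cbounded_mfun (fun w => cval (p w)) /\ cbounded_mfun (fun w => (cval (p w))^-1).
Proof.
move=> mp; have mc : measurable_fun setT (@circle_coord R \o p).
  by apply: measurableT_comp => //; exact: measurable_circle_coord.
have /measurable_fun_pairP[mr mi] := mc.
have b (w : T) : `|complex.Re (cval (p w))| <= 1 /\ `|complex.Im (cval (p w))| <= 1.
  have := circle_norm (p w); case: (cval (p w)) => a c /= h.
  by split; rewrite ler_norml; apply/andP; split; nra.
have br : bounded_mfun (fun w => complex.Re (cval (p w))) by split=> //; exists 1 => w; case: (b w).
have bi : bounded_mfun (fun w => complex.Im (cval (p w))) by split=> //; exists 1 => w; case: (b w).
split; first by [].
split.
  by rewrite (_ : (fun w => _) = (fun w => complex.Re (cval (p w)))) //;
    apply/funext => w; rewrite cvalV; case: (cval _).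
rewrite (_ : (fun w => _) = (fun w => - complex.Im (cval (p w)))); first exact: bmfunN.
by apply/funext => w; rewrite cvalV; case: (cval _).
Qed.
End Measurability.

(** * Uniqueness of finitely supported spectral measures *)
Section Uniqueness.
Variable R : realType.
Local Notation C := R[i].
Local Notation T := (torus R).

Lemma cbmfun_fst : cbounded_mfun (fun w : T => cval w.1) /\ cbounded_mfun (fun w : T => (cval w.1)^-1).
Proof. by apply: cbmfun_circle; exact: measurable_fst. Qed.
Lemma cbmfun_snd : cbounded_mfun (fun w : T => cval w.2) /\ cbounded_mfun (fun w : T => (cval w.2)^-1).
Proof. by apply: cbmfun_circle; exact: measurable_snd. Qed.

Lemma cbmfun_exp (f : T -> C) (a : int) : cbounded_mfun f -> cbounded_mfun (fun w => (f w)^-1) ->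
  cbounded_mfun (fun w => f w ^ a).
Proof.
move=> hf hi; case: a => n; first exact: cbmfunX.
rewrite (_ : (fun w => _) = (fun w => (f w)^-1 ^+ n.+1)); first exact: cbmfunX.
by apply/funext => w; rewrite exprVn.
Qed.

Lemma cbmfun_monomial a b : cbounded_mfun (fun w : T => cval (monomial a b w)).
Proof.
have [h1 i1] := cbmfun_fst; have [h2 i2] := cbmfun_snd.
by apply: cbmfunM; apply: cbmfun_exp.
Qed.

Lemma measurable_act g : measurable_fun setT (@act R g).
Proof.
have h a b : measurable_fun setT (@monomial R a b).
  by have [[? _] [? _]] := cbmfun_monomial a b; exact: measurable_circle.
exact: measurable_fun_pair.
Qed.

Lemma measurable_act_preimage g (A : set T) : measurable A -> measurable (act g @^-1` A).
Proof. by move=> mA; rewrite -[X in measurable X]setTI; exact: measurable_act. Qed.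

Lemma cbmfun_e1 : cbounded_mfun (@e1 R).
Proof.
have [h1 i1] := cbmfun_fst; have [h2 i2] := cbmfun_snd.
by do 2?[apply: cbmfunD]; rewrite //; apply: cbmfunM.
Qed.

Lemma e2_conj (w : T) : e2 w = (e1 w)^*%C.
Proof.
have c z : (cval z)^*%C = (cval z)^-1 :> C by rewrite cvalV.
have c' z : ((cval z)^-1)^*%C = cval z :> C by rewrite cvalV; case: (cval z) => a b /=; rewrite opprK.
by rewrite /e2 /e1 /tx /ty /tz !rmorphD /= rmorphM /= !c !c' invfM !invrK mulrC.
Qed.

Definition re_chi1 (w : T) : R := complex.Re (chi1 w).
Definition re_chi2 (w : T) : R := complex.Re (chi2 w).

Lemma chi1_real w : chi1 w = (re_chi1 w)%:C%C.
Proof.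
by rewrite /re_chi1 chi1_e e2_conj; case: (e1 w) => a b; apply/eqP; rewrite eq_complex /= !add0r subrr !eqxx.
Qed.
Lemma chi2_real w : chi2 w = (re_chi2 w)%:C%C.
Proof.
rewrite /re_chi2 chi2_e chi1_real e2_conj; case: (e1 w) => a b; apply/eqP; rewrite eq_complex /= eqxx /=.
by apply/eqP; ring.
Qed.

Lemma bmfun_re_chi1 : bounded_mfun re_chi1.
Proof.
have h2 : cbounded_mfun (@e2 R).
  have [h1 i1] := cbmfun_fst; have [h2 i2] := cbmfun_snd.
  rewrite (_ : @e2 R = (fun w => (cval w.1)^-1 + cval w.2 + (cval w.2)^-1 * cval w.1)).
    by do 2?[apply: cbmfunD]; rewrite //; apply: cbmfunM.
  by apply/funext => w; rewrite /e2 /tx /ty /tz invrK invfM invrK.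
rewrite (_ : re_chi1 = (fun w => complex.Re (1 + e1 w + e2 w))).
  have [] : cbounded_mfun (fun w : T => 1 + e1 w + e2 w); last by [].
  by apply: cbmfunD => //; apply: cbmfunD; [exact: cbmfun_cst|exact: cbmfun_e1].
by apply/funext => w; rewrite /re_chi1 chi1_e.
Qed.
Lemma bmfun_re_chi2 : bounded_mfun re_chi2.
Proof.
have h1 := bmfun_re_chi1; have [er ei] := cbmfun_e1.
rewrite (_ : re_chi2 = (fun w => (re_chi1 w + (complex.Re (e1 w) * complex.Re (e1 w) +
   complex.Im (e1 w) * complex.Im (e1 w))) + -2)).
  by apply: bmfunD; [apply: bmfunD => //; apply: bmfunD; exact: bmfunM|exact: bmfun_cst].
apply/funext => w; rewrite /re_chi2 chi2_e chi1_real e2_conj; case: (e1 w) => a b /=.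
by ring.
Qed.

Lemma re_chi_separates w w' : re_chi1 w = re_chi1 w' -> re_chi2 w = re_chi2 w' -> exists2 g, g \in weyl & w = act g w'.
Proof. by move=> h1 h2; apply: chi_separates; rewrite ?chi1_real ?chi2_real ?h1 ?h2. Qed.

Lemma re_chi_act g w : g \in weyl -> re_chi1 (act g w) = re_chi1 w /\ re_chi2 (act g w) = re_chi2 w.
Proof. by move=> gW; have [h1 h2] := chi_act w gW; rewrite /re_chi1 /re_chi2 h1 h2. Qed.

Definition pfun (s : seq (R * nat * nat)) (w : T) : R :=
  \sum_(t <- s) t.1.1 * (re_chi1 w ^+ t.1.2 * re_chi2 w ^+ t.2).
Definition polychar (f : T -> R) := exists s, forall w, f w = pfun s w.

Lemma polychar_cst c : polychar (fun=> c).
Proof. by exists [:: (c, 0, 0)] => w; rewrite /pfun big_seq1 !expr0 !mulr1. Qed.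
Lemma polychar_re_chi1 : polychar re_chi1.
Proof. by exists [:: (1, 1, 0)] => w; rewrite /pfun big_seq1 expr0 expr1 mul1r mulr1. Qed.
Lemma polychar_re_chi2 : polychar re_chi2.
Proof. by exists [:: (1, 0, 1)] => w; rewrite /pfun big_seq1 expr0 expr1 !mul1r. Qed.
Lemma polycharD f g : polychar f -> polychar g -> polychar (fun w => f w + g w).
Proof. by move=> [s hs] [t ht]; exists (s ++ t) => w; rewrite /pfun big_cat hs ht. Qed.
Lemma polycharM f g : polychar f -> polychar g -> polychar (fun w => f w * g w).
Proof.
move=> [s hs] [t ht].
exists [seq (a.1.1 * b.1.1, (a.1.2 + b.1.2)%N, (a.2 + b.2)%N) | a <- s, b <- t] => w.
rewrite hs ht /pfun big_allpairs_dep mulr_suml; apply: eq_bigr => a _.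
rewrite mulr_sumr; apply: eq_bigr => b _ /=.
by rewrite !exprD; ring.
Qed.

Lemma bmfunX f n : bounded_mfun f -> bounded_mfun (fun w : T => f w ^+ n).
Proof.
move=> hf; elim: n => [|n ih]; first exact: bmfun_cst.
rewrite (_ : (fun w => _) = (fun w => f w * f w ^+ n)); first exact: bmfunM.
by apply/funext => w; rewrite exprS.
Qed.

Lemma bmfun_sum (I : Type) (s : seq I) (F : I -> T -> R) :
  (forall i, bounded_mfun (F i)) -> bounded_mfun (fun w => \sum_(i <- s) F i w).
Proof.
move=> h; elim: s => [|i s ih].
  by rewrite (_ : (fun w => _) = fun=> 0); [exact: bmfun_cst|apply/funext => w; rewrite big_nil].
rewrite (_ : (fun w => _) = (fun w => F i w + \sum_(j <- s) F j w)); first exact: bmfunD.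
by apply/funext => w; rewrite big_cons.
Qed.

Lemma bmfun_pfun s : bounded_mfun (pfun s).
Proof.
apply: bmfun_sum => t; apply: bmfunM; first exact: bmfun_cst.
by apply: bmfunM; apply: bmfunX; [exact: bmfun_re_chi1|exact: bmfun_re_chi2].
Qed.

Lemma bmfun_integrable (mu : probability T R) f : bounded_mfun f -> mu.-integrable setT (EFin \o f).
Proof.
move=> [mf [M hM]]; apply: measurable_bounded_integrable => //.
  by rewrite ltey_eq fin_num_measure.
by exists M; split=> [|x Mx w _]; [exact: num_real|exact: le_trans (hM w) (ltW Mx)].
Qed.

Lemma Rintegral_sum (mu : probability T R) (I : Type) (s : seq I) (F : I -> T -> R) :
  (forall i, bounded_mfun (F i)) ->
  Rintegral mu setT (fun w => \sum_(i <- s) F i w) = \sum_(i <- s) Rintegral mu setT (F i).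
Proof.
move=> h; elim: s => [|i s ih].
  rewrite big_nil (_ : (fun w => _) = fun=> 0); last by apply/funext => w; rewrite big_nil.
  by rewrite Rintegral_cst // mul0r.
rewrite big_cons -ih -RintegralD //; try exact: bmfun_integrable; last first.
  by apply: bmfun_integrable; apply: bmfun_sum.
by apply: eq_Rintegral => w _; rewrite big_cons.
Qed.

Definition same_moments (mu nu : probability T R) := forall m n,
  Rintegral mu setT (fun w => re_chi1 w ^+ m * re_chi2 w ^+ n) =
  Rintegral nu setT (fun w => re_chi1 w ^+ m * re_chi2 w ^+ n).

Lemma Rintegral_pfun (mu nu : probability T R) s : same_moments mu nu ->
  Rintegral mu setT (pfun s) = Rintegral nu setT (pfun s).
Proof.
move=> h; have b m n : bounded_mfun (fun w => re_chi1 w ^+ m * re_chi2 w ^+ n).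
  by apply: bmfunM; apply: bmfunX; [exact: bmfun_re_chi1|exact: bmfun_re_chi2].
rewrite /pfun !Rintegral_sum; try by move=> t; apply: bmfunM; [exact: bmfun_cst|exact: b].
by apply: eq_bigr => t _; rewrite !RintegralZl ?h //; apply: bmfun_integrable; exact: b.
Qed.

Variables (ws : nat -> T) (n : nat).

(** A product of sums of two squares, one factor for each point. *)
Lemma vanishing_polychar k : exists2 Q, polychar Q &
  (forall w, 0 <= Q w) /\ (forall w, Q w = 0 <-> exists2 i, (i < k)%N & re_chi1 w = re_chi1 (ws i) /\ re_chi2 w = re_chi2 (ws i)).
Proof.
elim: k => [|k [Q pQ [Q0 Qv]]].
  exists (fun=> 1); first exact: polychar_cst.
  split=> // w; split=> [/eqP| [j]]; last by [].
  by rewrite oner_eq0.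
pose q w := (re_chi1 w + - re_chi1 (ws k)) * (re_chi1 w + - re_chi1 (ws k)) + (re_chi2 w + - re_chi2 (ws k)) * (re_chi2 w + - re_chi2 (ws k)).
exists (fun w => Q w * q w).
  apply: polycharM => //; apply: polycharD; apply: polycharM;
    apply: polycharD; first [exact: polychar_re_chi1|exact: polychar_re_chi2|exact: polychar_cst].
have q0 w : 0 <= q w by rewrite /q -!expr2 addr_ge0 // sqr_ge0.
split=> w; first by rewrite mulr_ge0.
split=> [/eqP| [j]].
  rewrite mulf_eq0 => /orP[/eqP/Qv[i ik e]|]; first by exists i => //; exact: ltnW.
  rewrite /q -!expr2 paddr_eq0 ?sqr_ge0 // !sqrf_eq0 !subr_eq0 => /andP[/eqP e /eqP e'].
  by exists k.
rewrite ltnS leq_eqVlt => /orP[/eqP->|jk] e; last by rewrite (Qv w).2 ?mul0r //; exists j.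
by case: e => e e'; rewrite /q e e' !subrr !mul0r addr0 mulr0.
Qed.

(** Newton interpolation: the value at a new point is corrected by a multiple of
the polynomial vanishing at the earlier ones; if that polynomial already
vanishes there, the new point has the characters of an earlier one. *)
Lemma interpolation (f : T -> R) k :
  (forall w w', re_chi1 w = re_chi1 w' -> re_chi2 w = re_chi2 w' -> f w = f w') ->
  exists2 r, polychar r & forall i, (i < k)%N -> r (ws i) = f (ws i).
Proof.
move=> fx; elim: k => [|k [r pr rE]]; first by exists (fun=> 0) => //; exact: polychar_cst.
have [Q pQ [Q0 Qv]] := vanishing_polychar k.
have r_inv s w w' : re_chi1 w = re_chi1 w' -> re_chi2 w = re_chi2 w' -> pfun s w = pfun s w'.
  by move=> e e'; apply: eq_bigr => t _; rewrite e e'.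
have [Qk|Qk] := eqVneq (Q (ws k)) 0.
  have /Qv[j jk [e e']] := Qk.
  exists r => // i; rewrite ltnS leq_eqVlt => /orP[/eqP->|]; last exact: rE.
  by case: pr rE => s rs rE; rewrite rs (r_inv s _ _ e e') -rs rE // (fx _ _ e e').
exists (fun w => r w + (f (ws k) - r (ws k)) / Q (ws k) * Q w).
  by apply: polycharD => //; apply: polycharM => //; exact: polychar_cst.
move=> i; rewrite ltnS leq_eqVlt => /orP[/eqP->|ik].
  by rewrite divfK // addrC subrK.
by rewrite (Qv (ws i)).2 ?mulr0 ?addr0 ?rE //; exists i.
Qed.

(** Moments determine the integrals of polynomials in the characters.  Applied
to a nonnegative polynomial vanishing on the orbits of the [ws i], which has
integral 0 against nu, this shows that mu, like nu, is carried by these orbits.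
There, the average over the Weyl group of the indicator of A agrees with a
polynomial in the characters, and its integral is the measure of A because both
measures are invariant. *)
Lemma finite_spectral_unique (mu nu : probability T R) :
  (forall g, g \in weyl -> forall A, measurable A -> mu (act g @^-1` A) = mu A) ->
  (forall g, g \in weyl -> forall A, measurable A -> nu (act g @^-1` A) = nu A) ->
  same_moments mu nu ->
  (forall Q, polychar Q -> (forall w, 0 <= Q w) -> (forall i, (i < n)%N -> Q (ws i) = 0) ->
     Rintegral nu setT Q = 0) ->
  forall A, measurable A -> mu A = nu A.
Proof.
move=> imu inu mom conc A mA.
pose F g (w : T) : R := 12^-1 * \1_(act g @^-1` A) w.
pose f w := \sum_(g <- weyl) F g w.
have bF g : bounded_mfun (F g).
  apply: bmfunM; first exact: bmfun_cst.
  split; first by apply: measurable_indic; exact: measurable_act_preimage.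
  by exists 1 => w; rewrite indicE; case: (_ \in _); rewrite /= ?normr1 ?normr0.
have bf : bounded_mfun f by exact: bmfun_sum.
have avg (la : probability T R) :
    (forall g, g \in weyl -> forall A, measurable A -> la (act g @^-1` A) = la A) ->
    la A = (Rintegral la setT f)%:E.
  move=> ila; rewrite /f Rintegral_sum // big_seq.
  rewrite (eq_bigr (fun=> 12^-1 * fine (la A))) => [|g gW]; last first.
    rewrite RintegralZl //; last first.
      apply: bmfun_integrable; have [mf _] := bF g.
      split; first by apply: measurable_indic; exact: measurable_act_preimage.
      by exists 1 => w; rewrite indicE; case: (_ \in _); rewrite /= ?normr1 ?normr0.
    rewrite /Rintegral integral_indic ?setIT //; last exact: measurable_act_preimage.
    by congr (_ * fine _); exact: ila.
  rewrite -big_seq big_const_seq count_predT iter_addr_0 -[size weyl]/12%N -[_ *+ 12]mulr_natl mulrA.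
  rewrite mulfV ?mul1r ?pnatr_eq0 //.
  by rewrite fineK // fin_num_measure.
have finv w w' : re_chi1 w = re_chi1 w' -> re_chi2 w = re_chi2 w' -> f w = f w'.
  move=> e e'; have [h hW ->] := re_chi_separates e e'; rewrite /f.
  have -> : \sum_(g <- weyl) F g w' = \sum_(g <- weyl) F (g *m h) w'.
    by rewrite -(perm_big _ (weyl_mulr_perm hW)) big_map.
  apply: eq_bigr => g _.
  rewrite /F !indicE; congr (_ * _%:R); congr nat_of_bool.
  by apply/idP/idP; rewrite !inE /= act_mul.
have [r pr rE] := interpolation n finv; have [Q pQ [Q0 Qv]] := vanishing_polychar n.
have rf w : Q w = 0 -> f w = r w.
  move=> /Qv[i ik [e e']]; rewrite (finv _ _ e e') -rE //.
  by case: pr => s rs; rewrite !rs /pfun; apply: eq_bigr => t _; rewrite e e'.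
have Qws i : (i < n)%N -> Q (ws i) = 0 by move=> ik; apply/Qv; exists i.
have br : bounded_mfun r by case: pr => s rs; rewrite (_ : r = pfun s); [exact: bmfun_pfun|exact/funext].
have bQ : bounded_mfun Q by case: pQ => s Qs; rewrite (_ : Q = pfun s); [exact: bmfun_pfun|exact/funext].
have same p : polychar p -> Rintegral mu setT p = Rintegral nu setT p.
  by case=> s ps; rewrite (_ : p = pfun s); [exact: Rintegral_pfun|exact/funext].
have repl (la : probability T R) : Rintegral la setT Q = 0 -> Rintegral la setT f = Rintegral la setT r.
  move=> iQ; rewrite /Rintegral; congr fine; apply: ae_eq_integral => //.
  - by apply/measurable_EFinP; case: bf.
  - by apply/measurable_EFinP; case: br.
  have : ae_eq la setT (EFin \o Q) (cst 0%E).
    apply/ae_eq_integral_abs => //; first by apply/measurable_EFinP; case: bQ.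
    have -> : (\int[la]_(x in setT) `|(EFin \o Q) x|)%E = (\int[la]_(x in setT) (Q x)%:E)%E.
      by apply: eq_integral => w _ /=; rewrite ger0_norm.
    rewrite -[LHS]fineK; first by rewrite -/(Rintegral la setT Q) iQ.
    exact/integrable_fin_num/bmfun_integrable.
  by apply: filterS => w /= h hw; have [/rf ->] := h hw.
by rewrite (avg mu imu) (avg nu inu) !repl ?same // conc.
Qed.
End Uniqueness.

(** * Densities on roots of unity *)
Section Expi.
Variable R : realType.
Local Notation C := R[i].
Local Notation T := (torus R).

Lemma expiD (x y : R) : cval (expi (x + y)) = cval (expi x) * cval (expi y).
Proof. by rewrite /= mulrDr cosD sinD; apply/eqP; rewrite eq_complex /= eqxx addrC eqxx. Qed.

Lemma expi0 : cval (expi (0 : R)) = 1.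
Proof. by rewrite /= mulr0 cos0 sin0. Qed.

Lemma expi1 : cval (expi (1 : R)) = 1.
Proof. by rewrite /= mulr1 mulrC mulr_natr cos2pi sin2pi. Qed.

Lemma expiN (x : R) : cval (expi (- x)) = (cval (expi x))^-1.
Proof.
by apply: (mulfI (cval_neq0 (expi x))); rewrite -expiD subrr expi0 divff // cval_neq0.
Qed.

Lemma expiX (x : R) (n : int) : cval (expi (n%:~R * x)) = cval (expi x) ^ n.
Proof.
have nat_case (m : nat) : cval (expi (m%:R * x)) = cval (expi x) ^+ m.
  elim: m => [|m ih]; first by rewrite mul0r expi0.
  by rewrite -natr1 mulrDl mul1r expiD ih exprSr.
case: n => m; first exact: nat_case.
by rewrite NegzE mulrNz mulNr expiN nat_case.
Qed.

Lemma expi_int (n : int) : cval (expi (n%:~R : R)) = 1.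
Proof. by rewrite -[n%:~R]mulr1 expiX expi1 exp1rz. Qed.

(** The angle is acos of the real part, or its reflection when the imaginary part
is negative. *)
Lemma expi_surj (z : circle R) : exists2 x, 0 <= x < 1 & expi x = z.
Proof.
have := circle_norm z; case Ez : (cval z) => [a b] /= ab.
have a1 : -1 <= a <= 1 by apply/andP; split; nra.
have pi0 := pi_gt0 R.
have p2 : 0 < 2 * pi :> R by rewrite mulr_gt0.
have pi2 : 2 * pi != 0 :> R by rewrite gt_eqF.
have ca : cos (acos a) = a by apply: acosK; rewrite in_itv.
have sa : sin (acos a) = `|b|.
  by rewrite sin_acos // -sqrtr_sqr; congr Num.sqrt; rewrite -ab; ring.
have h0 := acos_ge0 a1; have h1 := acos_lepi a1.
have [b0|b0] := leP 0 b.
  exists (acos a / (2 * pi)).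
    by apply/andP; split; [rewrite divr_ge0 // ltW|rewrite ltr_pdivrMr // mul1r; lra].
  apply: circle_inj => /=; rewrite Ez mulrC divfK // ca sa ger0_norm //.
have an : a != 1 by apply: contraTneq b0 => a_1; rewrite -leNgt; nra.
have h2 : 0 < acos a by apply: acos_gt0; case/andP: a1 => -> h; rewrite lt_neqAle an.
exists (1 - acos a / (2 * pi)).
  apply/andP; split; last by rewrite ltrBlDr ltrDl divr_gt0.
  by rewrite subr_ge0 ler_pdivrMr // mul1r; lra.
apply: circle_inj; rewrite addrC expiD expi1 mulr1 expiN cvalV /= Ez mulrC divfK // ca sa.
by rewrite ltr0_norm // opprK.
Qed.

Lemma angleK (z : circle R) : expi (angle z) = z.
Proof.
have [x x01 xz] := expi_surj z.
by have [] := @xgetPex _ 0 [set x | 0 <= x < 1 /\ expi x = z] (ex_intro _ x (conj x01 xz)).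
Qed.

(** Densities in the angles are functions on the torus: they do not depend on
the branch of the angle, and the expressions in monomials show that they are
measurable. *)
Lemma trig_monomial (a b : int) (w : T) t1 t2 : expi t1 = w.1 -> expi t2 = w.2 ->
  cos (2 * pi * (a%:~R * t1 + b%:~R * t2)) = complex.Re (cval (monomial a b w)) /\
  sin (2 * pi * (a%:~R * t1 + b%:~R * t2)) = complex.Im (cval (monomial a b w)).
Proof.
move=> h1 h2; have e : cval (expi (a%:~R * t1 + b%:~R * t2)) = cval (monomial a b w).
  by rewrite expiD !expiX h1 h2.
by rewrite -e.
Qed.

Definition J_torus (w : T) : R :=
  let c a b := complex.Re (cval (monomial a b w)) in
  8 * pi ^+ 2 * (c 2 1 + c 1 (-3) + c 3 (-2) - c 1 2 - c 3 (-1) - c 2 (-3)).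
Definition K_torus (w : T) : R :=
  let s a b := complex.Im (cval (monomial a b w)) in
  4 * (s 1 1 - s 2 (-1) - s (-1) 2) ^+ 2.

Lemma J_monomials (w : T) t1 t2 : expi t1 = w.1 -> expi t2 = w.2 -> J t1 t2 = J_torus w.
Proof.
move=> h1 h2; have c a b := (trig_monomial a b h1 h2).1.
rewrite /J_torus -!c /J; congr (_ * (_ + _ + _ - _ - _ - _)); congr (cos (_ * _)); ring.
Qed.
Lemma K_monomials (w : T) t1 t2 : expi t1 = w.1 -> expi t2 = w.2 -> K t1 t2 = K_torus w.
Proof.
move=> h1 h2; have c a b := (trig_monomial a b h1 h2).2.
rewrite /K_torus -!c /K; congr (_ * (_ - _ - _) ^+ 2); congr (sin (_ * _)); ring.
Qed.

Lemma bmfun_Re a b : bounded_mfun (fun w : T => complex.Re (cval (monomial a b w))).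
Proof. by have [] := cbmfun_monomial R a b. Qed.
Lemma bmfun_Im a b : bounded_mfun (fun w : T => complex.Im (cval (monomial a b w))).
Proof. by have [] := cbmfun_monomial R a b. Qed.

Lemma bmfun_J : bounded_mfun J_torus.
Proof.
apply: bmfunM; first exact: bmfun_cst.
by do 5?[apply: bmfunD]; try apply: bmfunN; exact: bmfun_Re.
Qed.
Lemma bmfun_K : bounded_mfun K_torus.
Proof.
apply: bmfunM; first exact: bmfun_cst.
apply: bmfunX; do 2?[apply: bmfunD]; try apply: bmfunN; exact: bmfun_Im.
Qed.

Definition pt (k q r : nat) : T := (expi (q%:R / k%:R), expi (r%:R / k%:R)).

Lemma monomial_pt k q r (a b : int) :
  cval (monomial a b (pt k q r)) = cval (expi ((a * q%:Z + b * r%:Z)%:~R / k%:R)).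
Proof.
rewrite [LHS]/= -!expiX -expiD; congr (cval (expi _)).
by rewrite intrD !intrM mulrDl !mulrA.
Qed.

Lemma expi_mod k (z : int) : (0 < k)%N ->
  expi (z%:~R / k%:R : R) = expi (`|(z %% k)%Z|%:R / k%:R).
Proof.
move=> k0; have k0' : k%:R != 0 :> R by rewrite pnatr_eq0 -lt0n.
apply: circle_inj; rewrite {1}(divz_eq z k) intrD intrM mulrDl -pmulrn mulfK // expiD expi_int mul1r.
by congr (cval (expi (_ / _))); rewrite -[(z %% k)%Z in LHS]gez0_abs ?modz_ge0 //; case: (k) k0.
Qed.

Definition grid k : seq (R * T) :=
  [seq ((k%:R ^- 2 : R), pt k q r) | q <- iota 0 k, r <- iota 0 k].

Lemma nneg_grid k : nneg_weights (grid k).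
Proof. by apply/allP => _ /allpairsP[p [_ _ ->]] /=; rewrite invr_ge0 exprn_ge0. Qed.

Lemma d_E k (A : set (circle R)) : measurable A ->
  @d_ R k A = (k%:R^-1 * \sum_(q <- iota 0 k) \1_A (expi (q%:R / k%:R)))%:E.
Proof.
move=> mA; rewrite /d_ /mscale /= /msum EFinM; congr (_ * _)%E.
have -> : iota 0 k = index_iota 0 k by rewrite /index_iota subn0.
rewrite -sumEFin big_mkord; apply: eq_bigr => q _.
by rewrite indicE.
Qed.

Lemma grid_sum k (F : R * T -> R) : \sum_(x <- grid k) F x =
  \sum_(q <- iota 0 k) \sum_(r <- iota 0 k) F (k%:R ^- 2, pt k q r).
Proof. by rewrite /grid big_allpairs_dep. Qed.

Lemma product_dE k (X : set T) : measurable X -> (@d_ R k \x @d_ R k)%E X = atoms (grid k) X.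
Proof.
apply: product_measure_unique => A B mA mB.
rewrite atoms_setE ?nneg_grid // grid_sum.
have -> : (@d_ R k A * @d_ R k B = (k%:R^-1 * \sum_(q <- iota 0 k) \1_A (expi (q%:R / k%:R)) : R)%:E *
  (k%:R^-1 * \sum_(r <- iota 0 k) \1_B (expi (r%:R / k%:R)) : R)%:E)%E.
  by congr (_ * _)%E; apply: d_E.
rewrite -EFinM; congr EFin.
rewrite mulrACA big_distrlr /= mulr_sumr; apply: eq_bigr => q _; rewrite mulr_sumr.
apply: eq_bigr => r _; rewrite -invfM -expr2; congr (_ * _).
by rewrite !indicE in_setX /=; case: (_ \in A); case: (_ \in B); rewrite /= ?mulr1 ?mulr0 ?mul1r.
Qed.

Lemma ddE k (F : R -> R -> R) (Fw : T -> R) A : measurable A -> bounded_mfun Fw ->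
  (forall w t1 t2, expi t1 = w.1 -> expi t2 = w.2 -> F t1 t2 = Fw w) ->
  dd k F A = (\sum_(q <- iota 0 k) \sum_(r <- iota 0 k)
    k%:R ^- 2 * (\1_A (pt k q r) * F (q%:R / k%:R) (r%:R / k%:R)))%:E.
Proof.
move=> mA [mF _] FE; rewrite /dd.
transitivity (\int[atoms (grid k)]_(w in A) (Fw w)%:E)%E.
  transitivity (\int[atoms (grid k)]_(w in A) (F (angle w.1) (angle w.2))%:E)%E.
    by apply: eq_measure_integral => B mB _; exact: product_dE.
  by apply: eq_integral => w _; rewrite (FE w) ?angleK.
rewrite integral_atoms ?nneg_grid // grid_sum; congr EFin.
by do 2!(apply: eq_bigr => ? _); rewrite /= (FE (pt k _ _) _ _ erefl erefl).
Qed.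
End Expi.

Section GridDensities.
Variable R : realType.
Local Notation C := R[i].
Local Notation T := (torus R).

(** Values of J and K on roots of unity: frequencies are reduced modulo k, and
the reduced cosines and sines are tabulated. *)
Definition cos_root (k j : nat) : R := complex.Re (cval (expi (j%:R / k%:R : R))).
Definition sin_root (k j : nat) : R := complex.Im (cval (expi (j%:R / k%:R : R))).
Definition modn_of_int (k : nat) (z : int) : nat := `|(z %% k)%Z|%N.

Lemma modn_of_int_lt k z : (0 < k)%N -> (modn_of_int k z < k)%N.
Proof.
move=> k0; rewrite /modn_of_int -ltz_nat gez0_abs; first by rewrite ltz_pmod.
by rewrite modz_ge0 //; case: (k) k0.
Qed.

Lemma expi_half : cval (expi (1 / 2 : R)) = -1.
Proof.
rewrite /= (_ : 2 * pi * (1 / 2) = pi); last by field.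
by rewrite cospi sinpi; apply/eqP; rewrite eq_complex /= oppr0 !eqxx.
Qed.

Lemma expi_halfD (x : R) : cval (expi (x + 1 / 2)) = - cval (expi x).
Proof. by rewrite expiD expi_half mulrN1. Qed.

Lemma expi_root k j : (0 < k)%N -> cval (expi (j%:R / k%:R : R)) = cval (expi (1 / k%:R : R)) ^+ j.
Proof. by move=> k0; rewrite -[RHS](expiX _ j) -pmulrn mulrA mulr1. Qed.

(** Twice the cosines of the multiples of 2 pi / 6, and the sines of the
multiples of 2 pi / 4. *)
Definition table6 : seq int := [:: 2; 1; -1; -2; -1; 1].
Definition table4 : seq int := [:: 0; 1; 0; -1].

Lemma cos6 j : (j < 6)%N -> 2 * cos_root 6 j = (table6`_j)%:~R.
Proof.
pose z := cval (expi (1 / 6%:R : R)).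
have z3 : z ^+ 3 = -1.
  by rewrite /z -expi_root // -expi_half; congr (cval (expi _)); field.
have c0 : 0 < complex.Re z.
  apply: cos_gt0_pihalf; have := pi_gt0 R; lra.
have n1 := circle_norm (expi (1 / 6%:R : R)).
have Re1 : complex.Re z = 1 / 2.
  move: z3 c0 n1; rewrite -/z; case: z => c s /eqP; rewrite eq_complex => /andP[/eqP + _] c0 /= n1.
  move=> /= h3; have h4 : (c + 1) * (2 * c - 1) ^+ 2 = 0.
    transitivity ((c * (c * c - s * s) - s * (c * s + s * c)) + 3 * c * (c ^+ 2 + s ^+ 2) - 3 * c + 1).
      by ring.
    by rewrite h3 n1; ring.
  move/eqP: h4; rewrite mulf_eq0 gt_eqF /=; last by rewrite addr_gt0 // ltr01.
  rewrite sqrf_eq0 => /eqP h; have c0' : 0 < c by exact: c0.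
  by lra.
have Re2 : complex.Re (z ^+ 2) = - (1 / 2).
  move: Re1 n1; rewrite -/z; case: z {z3 c0} => c s /= -> h.
  move: h => /= h; nra.
have zj i : cos_root 6 i = complex.Re (z ^+ i) by rewrite /cos_root expi_root.
have zS i : cos_root 6 (i + 3) = - cos_root 6 i.
  by rewrite !zj exprD z3 mulrN1; case: (z ^+ i).
have h0 : cos_root 6 0 = 1 by rewrite zj expr0.
have h1 : cos_root 6 1 = 1 / 2 by rewrite zj expr1.
have h2 : cos_root 6 2 = - (1 / 2) by rewrite zj.
have h3 : cos_root 6 3 = -1 by rewrite (zS 0) h0.
have h4 : cos_root 6 4 = - (1 / 2) by rewrite (zS 1) h1.
have h5 : cos_root 6 5 = 1 / 2 by rewrite (zS 2) h2 opprK.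
case: j => [|[|[|[|[|[|j]]]]]] // _; rewrite ?h0 ?h1 ?h2 ?h3 ?h4 ?h5 /table6 /nth; lra.
Qed.

Lemma sin4 j : (j < 4)%N -> sin_root 4 j = (table4`_j)%:~R.
Proof.
have h1 : sin_root 4 1 = 1.
  by rewrite /sin_root /= (_ : 2 * pi * (1 / 4%:R) = pi / 2) ?sin_pihalf //; field.
have h0 : sin_root 4 0 = 0 by rewrite /sin_root mul0r expi0.
have hS i : sin_root 4 (i + 2) = - sin_root 4 i.
  rewrite /sin_root (_ : (i + 2)%:R / 4%:R = i%:R / 4%:R + 1 / 2); last by rewrite natrD; field.
  by rewrite expi_halfD; case: (cval _).
have h2 : sin_root 4 2 = 0 by rewrite (hS 0) h0 oppr0.
have h3 : sin_root 4 3 = -1 by rewrite (hS 1) h1.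
case: j => [|[|[|[|j]]]] // _; rewrite ?h0 ?h1 ?h2 ?h3 /table4 /nth; lra.
Qed.

Lemma cos7_sym j : (j <= 7)%N -> cos_root 7 (7 - j) = cos_root 7 j.
Proof.
move=> j7; rewrite /cos_root (_ : (7 - j)%:R / 7%:R = 1 + - (j%:R / 7%:R)); last first.
  by rewrite natrB //; field.
by rewrite expiD expi1 mul1r expiN cvalV; case: (cval _).
Qed.

(** The seventh roots of unity sum to zero since the first one is not 1. *)
Lemma expi7_sum : \sum_(j < 7) cval (expi (1 / 7%:R : R)) ^+ j = 0.
Proof.
set z := cval _; have z7 : z ^+ 7 = 1 by rewrite /z -expi_root // divff ?pnatr_eq0 // expi1.
have z1 : z != 1.
  rewrite eq_complex negb_and; apply/orP; right.
  rewrite gt_eqF //; apply: sin_gt0_pi; have := pi_gt0 R; lra.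
have := subrX1 z 7; rewrite z7 subrr => /esym/eqP.
by rewrite mulf_eq0 subr_eq0 (negPf z1) => /eqP.
Qed.

Lemma cos7_sum : cos_root 7 1 + cos_root 7 2 + cos_root 7 3 = - (1 / 2).
Proof.
have /(congr1 (@complex.Re R)) := expi7_sum; rewrite raddf_sum.
rewrite (eq_bigr (fun j : 'I_7 => cos_root 7 j)) => [|j _]; last by rewrite /cos_root expi_root.
rewrite !big_ord_recl big_ord0 /= /bump /=.
rewrite (@cos7_sym 3 isT) (@cos7_sym 2 isT) (@cos7_sym 1 isT).
have -> : cos_root 7 0 = 1 by rewrite /cos_root mul0r expi0.
lra.
Qed.

Definition signed_frequencies (q r : int) : seq (int * int) :=
  [:: (1, 2 * q + r); (1, q - 3 * r); (1, 3 * q - 2 * r);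
      (-1, q + 2 * r); (-1, 3 * q - r); (-1, 2 * q - 3 * r)].

Lemma Re_monomial_pt k q r a b : (0 < k)%N ->
  complex.Re (cval (monomial a b (pt R k q r))) = cos_root k (modn_of_int k (a * q%:Z + b * r%:Z)).
Proof. by move=> k0; rewrite monomial_pt expi_mod. Qed.
Lemma Im_monomial_pt k q r a b : (0 < k)%N ->
  complex.Im (cval (monomial a b (pt R k q r))) = sin_root k (modn_of_int k (a * q%:Z + b * r%:Z)).
Proof. by move=> k0; rewrite monomial_pt expi_mod. Qed.

Lemma J_grid k (q r : nat) : (0 < k)%N -> J (q%:R / k%:R : R) (r%:R / k%:R) =
  8 * pi ^+ 2 * \sum_(x <- signed_frequencies q r) x.1%:~R * cos_root k (modn_of_int k x.2).
Proof.
move=> k0; rewrite (@J_monomials _ (pt R k q r)) // /J_torus !Re_monomial_pt //.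
rewrite /signed_frequencies !big_cons big_nil /=.
rewrite !mul1r !mulNr !mul1r.
congr (_ * _); rewrite addr0; move: cos_root modn_of_int => f g; ring.
Qed.

Definition J6 (q r : int) : int := \sum_(x <- signed_frequencies q r) x.1 * table6`_(modn_of_int 6 x.2).

Lemma J_grid6 (q r : nat) : J (q%:R / 6%:R : R) (r%:R / 6%:R) = 4 * pi ^+ 2 * (J6 q r)%:~R.
Proof.
rewrite J_grid // /J6 (_ : 8 * pi ^+ 2 = 4 * pi ^+ 2 * 2); last by ring.
rewrite -(mulrA (4 * _)); congr (_ * _).
rewrite rmorph_sum mulr_sumr; apply: eq_bigr => x _.
by rewrite mulrCA cos6 ?modn_of_int_lt // rmorphM.
Qed.

Definition K4 (q r : int) : int :=
  table4`_(modn_of_int 4 (q + r)) - table4`_(modn_of_int 4 (2 * q - r)) - table4`_(modn_of_int 4 (2 * r - q)).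

Lemma K_grid4 (q r : nat) : K (q%:R / 4%:R : R) (r%:R / 4%:R) = 4 * (K4 q r)%:~R ^+ 2.
Proof.
rewrite (@K_monomials _ (pt R 4 q r)) // /K_torus !Im_monomial_pt // !sin4 ?modn_of_int_lt //.
congr (4 * _ ^+ 2); rewrite /K4 !rmorphB /=.
by rewrite !mul1r !mulN1r (addrC (- q%:Z)).
Qed.

(** The multiplicity of cos(2 pi i / 7) in J, for i up to 3, as cosine is even. *)
Definition J7 (i : nat) (q r : int) : int :=
  \sum_(x <- signed_frequencies q r) if minn (modn_of_int 7 x.2) (7 - modn_of_int 7 x.2) == i then x.1 else 0.

(** On the seventh roots of unity the expansion of J in cosines c_i of 2 pi i / 7
is a multiple of c1 + c2 + c3 - 3, which is -7/2. *)
Lemma J7_shape : all (fun q : nat => all (fun r : nat =>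
  [&& J7 0 q r == -3 * J7 1 q r, J7 2 q r == J7 1 q r & J7 3 q r == J7 1 q r]) (iota 0 7)) (iota 0 7).
Proof. by rewrite /J7 unlock; vm_compute. Qed.

(** The factor is 8 pi^2 times -7/2. *)
Lemma J_grid7 (q r : nat) : (q < 7)%N -> (r < 7)%N ->
  J (q%:R / 7%:R : R) (r%:R / 7%:R) = - 28 * pi ^+ 2 * (J7 1 q r)%:~R.
Proof.
move=> q7 r7; rewrite J_grid //.
have -> : \sum_(x <- signed_frequencies q r) x.1%:~R * cos_root 7 (modn_of_int 7 x.2) =
    (J7 0 q r)%:~R * cos_root 7 0 + (J7 1 q r)%:~R * cos_root 7 1
    + (J7 2 q r)%:~R * cos_root 7 2 + (J7 3 q r)%:~R * cos_root 7 3.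
  rewrite /J7 !rmorph_sum !mulr_suml -!big_split /=; apply: eq_bigr => x _.
  have := @modn_of_int_lt 7 x.2 isT; move: (modn_of_int 7 x.2) => j j7.
  have h4 := @cos7_sym 3 isT; have h5 := @cos7_sym 2 isT; have h6 := @cos7_sym 1 isT.
  by case: j j7 => [|[|[|[|[|[|[|j]]]]]]] // _; rewrite /= ?h4 ?h5 ?h6 !mul0r ?add0r ?addr0.
have /allP/(_ q) := J7_shape; rewrite mem_iota => /(_ q7)/allP/(_ r).
rewrite mem_iota => /(_ r7)/and3P[/eqP -> /eqP -> /eqP ->].
have -> : cos_root 7 0 = 1 by rewrite /cos_root mul0r expi0.
have -> : cos_root 7 3 = - (1 / 2) - cos_root 7 1 - cos_root 7 2 by rewrite -cos7_sum; ring.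
by rewrite rmorphM /=; field.
Qed.
End GridDensities.

(** * The formula as a sum over Weyl orbits *)

(** Measures on the grid (Z/k)^2 are lists of integer weights, equal when the
total weights at each grid point agree. *)
Definition grid_index k : seq (nat * nat) := [seq (q, r) | q <- iota 0 k, r <- iota 0 k].
Definition weight_at (l : seq (int * (nat * nat))) p : int := \sum_(x <- l | x.2 == p) x.1.
Definition same_weights k l l' :=
  [&& all (fun x => x.2 \in grid_index k) l, all (fun x => x.2 \in grid_index k) l' &
      all (fun p => weight_at l p == weight_at l' p) (grid_index k)].

Definition grid_weights k (f : nat -> nat -> int * (nat * nat)) :=
  [seq f q r | q <- iota 0 k, r <- iota 0 k].
(** The terms of the formula supported on twelfth roots of unity, scaled by
336 * 108 so that all weights are integers; a grid point of (Z/k)^2 is embedded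
in (Z/12)^2 by multiplication by 12 / k.  For instance the first weight comes
from J = 4 pi^2 J6 and 336 * 108 * 16 / (1152 * 6^2) = 14; the last list is
d^(1). *)
Definition grid12 (b : bool) : seq (int * (nat * nat)) :=
  grid_weights 6 (fun q r => (14 * J6 q r ^+ 2, (2 * q, 2 * r)%N)) ++
  grid_weights 4 (fun q r => (189 * (if b then 4 - K4 q r ^+ 2 else K4 q r ^+ 2), (3 * q, 3 * r)%N)) ++
  grid_weights 3 (fun q r => (1008, (4 * q, 4 * r)%N)) ++
  grid_weights 2 (fun q r => (252 * (if b then 4 else 7), (6 * q, 6 * r)%N)) ++
  grid_weights 1 (fun q r => (-1656, (12 * q, 12 * r)%N)) ++
  [:: (-1008, (0, 0)%N); (-1008, (4, 8)%N); (-1008, (8, 4)%N)].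
(** The term with density J^2 on the seventh roots of unity, scaled by 84. *)
Definition grid7 : seq (int * (nat * nat)) :=
  grid_weights 7 (fun q r => (J7 1 q r ^+ 2, (1 * q, 1 * r)%N)).

Definition act_index k (p : int * int * int * int) (q : nat * nat) : nat * nat :=
  let: (a, b, c, d) := p in
  (modn_of_int k (a * q.1%:Z + b * q.2%:Z), modn_of_int k (c * q.1%:Z + d * q.2%:Z)).
Definition orbit_weights k (m : int) (cls : seq (nat * (nat * nat))) : seq (int * (nat * nat)) :=
  [seq (m * x.1%:Z, act_index k p x.2) | x <- cls, p <- weyl4].
(** Class sizes with points of (Z/12)^2 where the characters take the values of
the classes of order 1, 2, 3, 4, 6. *)
Definition class_points12 (b : bool) : seq (nat * (nat * nat)) :=
  [:: (1, (0, 0)); (49, (6, 0)); (56, (0, 4)); (42, if b then (3, 9) else (0, 3)); (56, (2, 8))]%N.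

Lemma same_weights12 b : same_weights 12 (grid12 b) (orbit_weights 12 9 (class_points12 b)).
Proof. by rewrite /same_weights /weight_at /grid12 /J6 unlock; case: b; vm_compute. Qed.
Lemma same_weights7 : same_weights 7 grid7 (orbit_weights 7 1 [:: (1, (1, 5))]%N).
Proof. by rewrite /same_weights /weight_at /grid7 /J7 unlock; vm_compute. Qed.

Section OrbitFormula.
Variable R : realType.
Local Notation T := (torus R).
Variables (A : set T) (mA : measurable A).
Local Notation ind w := (\1_A (w : T) : R).

Definition dirac_sum k (l : seq (int * (nat * nat))) : R :=
  \sum_(x <- l) x.1%:~R * ind (pt R k x.2.1 x.2.2).

Lemma dirac_sum_cat k l l' : dirac_sum k (l ++ l') = dirac_sum k l + dirac_sum k l'.
Proof. exact: big_cat. Qed.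

Lemma dirac_sum_weight k l : all (fun x => x.2 \in grid_index k) l ->
  dirac_sum k l = \sum_(p <- grid_index k) (weight_at l p)%:~R * ind (pt R k p.1 p.2).
Proof.
move=> /allP lk; have ug : uniq (grid_index k).
  by apply: allpairs_uniq; rewrite ?iota_uniq // => -[a b] [].
under eq_bigr => p _ do rewrite /weight_at rmorph_sum mulr_suml.
rewrite (exchange_big_dep xpredT) //= [RHS]big_seq [LHS]big_seq; apply: eq_bigr => x xl.
rewrite big_mkcond (bigD1_seq x.2) ?lk //= eqxx big1 ?addr0 // => p px.
by rewrite eq_sym (negPf px).
Qed.

Lemma same_weights_sum k l l' : same_weights k l l' -> dirac_sum k l = dirac_sum k l'.
Proof.
case/and3P=> hl hl' /allP h; rewrite !dirac_sum_weight // big_seq [RHS]big_seq.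
by apply: eq_bigr => p /h /eqP ->.
Qed.

Lemma pt_scale m k q r : (0 < m)%N -> (0 < k)%N -> pt R k q r = pt R (m * k) (m * q) (m * r).
Proof.
move=> m0 k0; have m0' : m%:R != 0 :> R by rewrite pnatr_eq0 -lt0n.
have k0' : k%:R != 0 :> R by rewrite pnatr_eq0 -lt0n.
by rewrite /pt !natrM; congr (expi _, expi _); field; rewrite k0'.
Qed.

Lemma on_grid_sum m k (c : nat -> nat -> int) : (0 < m)%N -> (0 < k)%N ->
  dirac_sum (m * k) (grid_weights k (fun q r => (c q r, (m * q, m * r)%N))) =
  \sum_(q <- iota 0 k) \sum_(r <- iota 0 k) (c q r)%:~R * ind (pt R k q r).
Proof.
move=> m0 k0; rewrite /dirac_sum /grid_weights big_allpairs_dep.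
by do 2!(apply: eq_bigr => ? _); rewrite /= -pt_scale.
Qed.

(** A density term becomes a list of integer weights once the density is known
to be integral on the grid up to the factor s. *)
Lemma dd_on_grid m k (F : R -> R -> R) (Fw : T -> R) (a s : R) (c : nat -> nat -> int) :
  (0 < m)%N -> (0 < k)%N -> bounded_mfun Fw ->
  (forall w t1 t2, expi t1 = w.1 -> expi t2 = w.2 -> F t1 t2 = Fw w) ->
  (forall q r, (q < k)%N -> (r < k)%N -> a / k%:R ^+ 2 * F (q%:R / k%:R) (r%:R / k%:R) = s * (c q r)%:~R) ->
  (a%:E * dd k F A)%E =
    (s * dirac_sum (m * k) (grid_weights k (fun q r => (c q r, (m * q, m * r)%N))))%:E.
Proof.
move=> m0 k0 bF FE FC; rewrite (ddE k mA bF FE) on_grid_sum // -EFinM; congr EFin.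
rewrite !mulr_sumr !big_seq; apply: eq_bigr => q; rewrite mem_iota => /= qk.
rewrite !mulr_sumr !big_seq; apply: eq_bigr => r; rewrite mem_iota => /= rk.
by rewrite [RHS]mulrA -FC //; ring.
Qed.

Lemma product_on_grid m k (a s : R) (c : int) : (0 < m)%N -> (0 < k)%N ->
  a / k%:R ^+ 2 = s * c%:~R ->
  (a%:E * (@d_ R k \x @d_ R k)%E A)%E =
    (s * dirac_sum (m * k) (grid_weights k (fun q r => (c, (m * q, m * r)%N))))%:E.
Proof.
move=> m0 k0 ac; rewrite product_dE // on_grid_sum //.
rewrite (_ : atoms _ _ = (\sum_(x <- grid R k) x.1 * ind x.2)%:E); last first.
  by apply: atoms_setE; exact: nneg_grid.
rewrite grid_sum -EFinM; congr EFin.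
rewrite !mulr_sumr; apply: eq_bigr => q _; rewrite !mulr_sumr; apply: eq_bigr => r _.
by rewrite !mulrA -ac.
Qed.

Lemma d3_index_sum (V : nmodType) (F : nat -> nat -> V) :
  \sum_(q | @d3_index 1 q) F q.1 q.2 = F 0 0 + F 1 2 + F 2 1.
Proof.
rewrite big_mkcond /= -(pair_bigA _ (fun i j : 'I_(3 * 1) => if (3 %| i + j)%N then F i j else 0)) /=.
transitivity (\sum_(i < 3) \sum_(j < 3) (if (3 %| i + j)%N then F i j else 0)); first by [].
by rewrite !big_ord_recl !big_ord0 /= !addr0 !add0r addrA.
Qed.

Lemma card_d3_index : #|@d3_index 1| = 3%N.
Proof. by rewrite -sum1_card (d3_index_sum (fun _ _ => 1%N)). Qed.

Lemma d3_sum : d3 1 A = (3^-1 * (ind (pt R 3 0 0) + ind (pt R 3 1 2) + ind (pt R 3 2 1)))%:E.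
Proof.
rewrite /d3 card_d3_index EFinM; congr (_ * _)%E.
rewrite -(d3_index_sum (fun q r => ind (pt R 3 q r))) -sumEFin; apply: eq_bigr => q _.
by rewrite diracE.
Qed.

Lemma act_pt k p (q : nat * nat) : (0 < k)%N ->
  act (mx4 p) (pt R k q.1 q.2) = pt R k (act_index k p q).1 (act_index k p q).2.
Proof.
case: p => [[[a b] c] d] k0; rewrite act_mx2 /pt /=.
by congr (_, _); apply: circle_inj; rewrite monomial_pt expi_mod.
Qed.

(** The mass of A for the measure attached to a list of class sizes and torus
points: each class size is divided by the group order 336 and by the order 12 of
the Weyl group.  A point fixed by some Weyl elements is counted repeatedly. *)
Definition orbit_sum (cls : seq (nat * T)) : R :=
  \sum_(x <- cls) \sum_(g <- weyl) x.1%:R / (336 * 12) * ind (act g x.2).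

Lemma orbit_weights_sum k m cls : (0 < k)%N -> dirac_sum k (orbit_weights k m cls) =
  m%:~R * (336 * 12) * orbit_sum [seq (x.1, pt R k x.2.1 x.2.2) | x <- cls].
Proof.
move=> k0; rewrite /dirac_sum /orbit_weights big_allpairs_dep /orbit_sum big_map mulr_sumr.
apply: eq_bigr => x _; rewrite /weyl big_map mulr_sumr; apply: eq_bigr => p _.
rewrite act_pt //= intrM -pmulrn; move: (m%:~R : R) (x.1%:R : R) (\1_A _ : R) => u v i.
by field.
Qed.

Lemma D12_sum w : (\sum_(g \in D12) (\d_(act g w) A : \bar R))%E = (\sum_(g <- weyl) ind (act g w))%:E.
Proof.
have -> : D12 = [set` weyl] by apply/seteqP; split=> g /= /D12_weyl.
rewrite -fsbig_seq ?weyl_uniq // -sumEFin; apply: eq_bigr => g _.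
by rewrite diracE.
Qed.

Definition class_points (b : bool) (mu t : circle R) : seq (nat * T) :=
  [seq (x.1, pt R 12 x.2.1 x.2.2) | x <- class_points12 b] ++ [:: (48%N, pt R 7 1 5); (84%N, (mu, t))].

Lemma orbit_sum_cat l l' : orbit_sum (l ++ l') = orbit_sum l + orbit_sum l'.
Proof. exact: big_cat. Qed.

Lemma orbit_sum1 n w : orbit_sum [:: (n, w)] =
  n%:R / (336 * 12) * \sum_(g <- weyl) ind (act g w).
Proof. by rewrite /orbit_sum (big_seq1 _ (n, w)) mulr_sumr. Qed.

Definition density4 (b : bool) (x y : R) : R := if b then 16 - K x y else K x y.

(** In the scaled grid measures, the class weight |C| / (336 * 12) becomes
9 |C| on (Z/12)^2 and, for the 48 elements of order 7, 1 on (Z/7)^2. *)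
Lemma epsPGL27_orbits b mu t :
  epsPGL27 (density4 b) (if b then 4 else 7) mu t A = (orbit_sum (class_points b mu t))%:E.
Proof.
have [s sE] : exists s : R, s = (336 * 108)^-1 by exists (336 * 108)^-1.
have pi0 : pi != 0 :> R by rewrite gt_eqF // pi_gt0.
have sqI (n : int) : (n ^+ 2)%:~R = n%:~R ^+ 2 :> R by rewrite rmorphXn.
have subI (n : int) : (4 - n ^+ 2)%:~R = 4 - n%:~R ^+ 2 :> R by rewrite rmorphB rmorphXn.
rewrite /epsPGL27.
rewrite (@dd_on_grid 1 7 _ (fun w => J_torus w ^+ 2) _ 84^-1 (fun q r => J7 1 q r ^+ 2)) //; first last.
- move=> q r q7 r7; rewrite J_grid7 // sqI; move: ((J7 1 q r)%:~R : R) => m.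
  by move: (pi : R) pi0 => p p0; field.
- by move=> w t1 t2 h1 h2; rewrite (J_monomials h1 h2).
- by apply: bmfunX; exact: bmfun_J.
rewrite (@dd_on_grid 2 6 _ (fun w => J_torus w ^+ 2) _ s (fun q r => 14 * J6 q r ^+ 2)) //; first last.
- move=> q r q7 r7; rewrite J_grid6 // intrM sqI; move: ((J6 q r)%:~R : R) => m.
  by rewrite sE; move: (pi : R) pi0 => p p0; field.
- by move=> w t1 t2 h1 h2; rewrite (J_monomials h1 h2).
- by apply: bmfunX; exact: bmfun_J.
rewrite (@dd_on_grid 3 4 _ (fun w => if b then 16 - K_torus w else K_torus w) _ s
   (fun q r => 189 * (if b then 4 - K4 q r ^+ 2 else K4 q r ^+ 2))) //; first last.
- move=> q r q7 r7; rewrite /density4 K_grid4 intrM; case: b; rewrite ?subI ?sqI; move: ((K4 q r)%:~R : R) => m.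
    by rewrite sE; field.
  by rewrite sE; field.
- by move=> w t1 t2 h1 h2; rewrite /density4 (K_monomials h1 h2).
- case: b; last exact: bmfun_K.
  by apply: bmfunD; [exact: bmfun_cst|apply: bmfunN; exact: bmfun_K].
rewrite (@product_on_grid 4 3 _ s 1008) //; last by rewrite sE; field.
rewrite (@product_on_grid 6 2 _ s (252 * (if b then 4 else 7))) //; last first.
  by rewrite rmorphM; case: b => /=; rewrite sE; field.
rewrite -(mulNe (23 / 504)%:E) -EFinN.
rewrite (@product_on_grid 12 1 _ s (-1656)) //; last by rewrite sE; field.
rewrite d3_sum D12_sum -?EFinM -?EFinN -?EFinD; congr EFin.
have h12 := same_weights_sum (same_weights12 b); rewrite orbit_weights_sum // /grid12 5!dirac_sum_cat in h12.
have h7 := same_weights_sum same_weights7; rewrite orbit_weights_sum // /grid7 in h7.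
have hd3 : dirac_sum 12 [:: (-1008, (0, 0)%N); (-1008, (4, 8)%N); (-1008, (8, 4)%N)] =
    - 1008 * (ind (pt R 3 0 0) + ind (pt R 3 1 2) + ind (pt R 3 2 1)).
  rewrite (@pt_scale 4 3) // (@pt_scale 4 3 1) // (@pt_scale 4 3 2) //.
  by rewrite /dirac_sum !big_cons big_nil addr0 !mulrDr addrA rmorphN.
have o2 : orbit_sum [:: (48%N, pt R 7 1 5); (84%N, (mu, t))] =
    48 * orbit_sum [seq (x.1, pt R 7 x.2.1 x.2.2) | x <- [:: (1, (1, 5))]%N]
    + 1 / 48 * \sum_(g <- weyl) ind (act g (mu, t)).
  rewrite -[[:: _; _]]/([:: (48%N, pt R 7 1 5)] ++ [:: (84%N, (mu, t))]) orbit_sum_cat.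
  rewrite [map _ _]/= !orbit_sum1.
  by move: (\sum_(g <- weyl) _) (\sum_(g <- weyl) _) => u v; field.
rewrite /class_points orbit_sum_cat o2; move: h12 h7; rewrite hd3 sE.
rewrite -[(1 * 7)%N]/7%N -[(2 * 6)%N]/12%N -[(3 * 4)%N]/12%N -[(4 * 3)%N]/12%N
  -[(6 * 2)%N]/12%N -[(12 * 1)%N]/12%N.
move: (dirac_sum 7 _) (dirac_sum 12 (grid_weights 6 _)) (dirac_sum 12 (grid_weights 4 _))
  (dirac_sum 12 (grid_weights 3 _)) (dirac_sum 12 (grid_weights 2 _)) (dirac_sum 12 (grid_weights 1 _)).
move: (ind (pt R 3 0 0) + ind (pt R 3 1 2) + ind (pt R 3 2 1)) (\sum_(g <- weyl) _)
  (orbit_sum _) (orbit_sum _) => u v o7 o12 d7 d6 d4 d3 d2 d1 h12.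
have {}h12 : d6 + (d4 + (d3 + (d2 + (d1 + -1008 * u)))) = 9 * (336 * 12) * o12 by [].
have -> : d6 = 9 * (336 * 12) * o12 - d4 - d3 - d2 - d1 + 1008 * u by rewrite -h12; ring.
by move=> ->; rewrite mulr1z mul1r; field.
Qed.
End OrbitFormula.

Lemma mckay_class_moment (R : realType) (gT : finGroupType) (G : {group gT})
    (iota : G2_embedding R G) m n : mckay_moment iota m n = class_moment iota m n.
Proof. by rewrite /mckay_moment mckay_moment_average class_moment_average. Qed.

(** * The joint spectral measure *)
Section Normalised.
Context d (T : measurableType d) (R : realType).
Definition normalised (mu : {measure set T -> \bar R}) (mu1 : mu setT = 1%E) : set T -> \bar R := mu.
HB.instance Definition _ mu mu1 := Measure.on (@normalised mu mu1).
HB.instance Definition _ mu mu1 := Measure_isProbability.Build _ _ _ (@normalised mu mu1) mu1.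
End Normalised.

Section OrbitMeasure.
Variable R : realType.
Local Notation C := R[i].
Local Notation T := (torus R).
Variable cls : seq (nat * T).
Hypothesis cls_total : (\sum_(x <- cls) x.1 = 336)%N.

Definition orbit_atoms : seq (R * T) :=
  [seq (x.1%:R / (336 * 12), act g x.2) | x <- cls, g <- weyl].

Lemma orbit_atoms_ge0 : nneg_weights orbit_atoms.
Proof.
apply/allP => _ /allpairsP[p [_ _ ->]] /=; apply: divr_ge0; first exact: ler0n.
by rewrite -natrM; exact: ler0n.
Qed.

Lemma orbit_atomsE A : atoms orbit_atoms A = (orbit_sum A cls)%:E.
Proof. by rewrite atoms_setE ?orbit_atoms_ge0 // /orbit_atoms big_allpairs_dep. Qed.

Lemma sum_weyl_const (c : R) : \sum_(g <- weyl) c = 12 * c.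
Proof.
rewrite big_const_seq count_predT iter_addr_0 -[size weyl]/12%N.
by rewrite -[_ *+ 12]mulr_natl.
Qed.

Lemma orbit_sum_invariant (f : T -> R) : (forall g w, g \in weyl -> f (act g w) = f w) ->
  \sum_(x <- orbit_atoms) x.1 * f x.2 = \sum_(x <- cls) x.1%:R / 336 * f x.2.
Proof.
move=> fi; rewrite /orbit_atoms big_allpairs_dep; apply: eq_bigr => x _.
rewrite big_seq (eq_bigr (fun=> x.1%:R / (336 * 12) * f x.2)) => [|g gW]; last by rewrite fi.
rewrite -big_seq sum_weyl_const; move: (x.1%:R : R) (f _) => u v; by field.
Qed.

Lemma orbit_atoms_setT : atoms orbit_atoms setT = 1%E.
Proof.
rewrite atoms_setE ?orbit_atoms_ge0 //; congr EFin.
rewrite (orbit_sum_invariant (f := \1_setT)) => [|g w _]; last by rewrite !indicT.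
under eq_bigr do rewrite indicT mulr1.
by rewrite -mulr_suml -natr_sum cls_total divff ?pnatr_eq0.
Qed.

Definition orbit_measure : probability T R := normalised orbit_atoms_setT.

Lemma orbit_measureE A : orbit_measure A = (orbit_sum A cls)%:E.
Proof. exact: orbit_atomsE. Qed.

Lemma orbit_measure_integral (f : T -> R) : measurable_fun setT f ->
  (forall g w, g \in weyl -> f (act g w) = f w) ->
  Rintegral orbit_measure setT f = \sum_(x <- cls) x.1%:R / 336 * f x.2.
Proof.
move=> mf fi; rewrite /Rintegral.
transitivity (fine (\int[atoms orbit_atoms]_(x in setT) (f x)%:E)%E).
  by congr fine; apply: eq_measure_integral.
rewrite integral_atoms ?orbit_atoms_ge0 //= -orbit_sum_invariant //.
by apply: eq_bigr => x _; rewrite indicT mul1r.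
Qed.

Lemma orbit_measure_act g A : g \in weyl -> orbit_measure (act g @^-1` A) = orbit_measure A.
Proof.
move=> gW; rewrite !orbit_measureE; congr EFin; apply: eq_bigr => x _.
rewrite -!mulr_sumr; congr (_ * _).
rewrite -[in RHS](perm_big _ (weyl_mul_perm gW)) [RHS]big_map; apply: eq_bigr => h _.
rewrite !indicE; congr (nat_of_bool _)%:R.
by apply/idP/idP; rewrite !inE /= act_mul.
Qed.

(** The characters of the torus are real valued, so a complex moment is the real
moment of their real parts. *)
Lemma cintegral_chi (mu : probability T R) m n :
  cintegral mu (fun w => chi1 w ^+ m * chi2 w ^+ n) =
  (Rintegral mu setT (fun w => re_chi1 w ^+ m * re_chi2 w ^+ n))%:C%C.
Proof.
have E w : chi1 w ^+ m * chi2 w ^+ n = (re_chi1 w ^+ m * re_chi2 w ^+ n)%:C%C.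
  by rewrite chi1_real chi2_real rmorphM !rmorphXn.
rewrite /cintegral.
rewrite (_ : (fun w => complex.Re _) = (fun w => re_chi1 w ^+ m * re_chi2 w ^+ n)); last first.
  by apply/funext => w; rewrite E.
rewrite (_ : (fun w => complex.Im _) = (fun=> 0)); last first.
  by apply/funext => w; rewrite E.
by rewrite Rintegral_cst // mul0r.
Qed.

Lemma measurable_re_chi m n : measurable_fun setT (fun w : T => re_chi1 w ^+ m * re_chi2 w ^+ n).
Proof.
have [] // : bounded_mfun (fun w : T => re_chi1 w ^+ m * re_chi2 w ^+ n).
by apply: bmfunM; apply: bmfunX; [exact: bmfun_re_chi1|exact: bmfun_re_chi2].
Qed.

Lemma orbit_measure_moment m n :
  cintegral orbit_measure (fun w => chi1 w ^+ m * chi2 w ^+ n) =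
  \sum_(x <- cls) x.1%:R / 336 * (chi1 x.2 ^+ m * chi2 x.2 ^+ n).
Proof.
have x_inv g (w : T) : g \in weyl -> re_chi1 (act g w) ^+ m * re_chi2 (act g w) ^+ n = re_chi1 w ^+ m * re_chi2 w ^+ n.
  by move=> gW; have [-> ->] := re_chi_act w gW.
rewrite cintegral_chi (orbit_measure_integral (measurable_re_chi m n) x_inv).
rewrite rmorph_sum; apply: eq_bigr => x _.
by rewrite chi1_real chi2_real -!rmorphXn -!rmorphM /= rmorphM fmorph_div /= !rmorph_nat.
Qed.

Lemma orbit_measure_spectral (gT : finGroupType) (G : {group gT}) (iota : G2_embedding R G) :
  (forall m n, class_moment iota m n = \sum_(x <- cls) x.1%:R / 336 * (chi1 x.2 ^+ m * chi2 x.2 ^+ n)) ->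
  is_joint_spectral_measure iota orbit_measure.
Proof.
move=> mom; have spec : has_spectral_moments iota orbit_measure.
  split=> [g /D12_weyl gW A _|m n]; first exact: orbit_measure_act.
  by rewrite mckay_class_moment mom orbit_measure_moment.
split=> // nu [nu_inv nu_mom] A mA.
apply: (@finite_spectral_unique R (fun i => (nth (0%N, point) cls i).2) (size cls)) => //.
- by move=> g gW B mB; apply: nu_inv => //; exact/D12_weyl.
- by move=> g gW B _; exact: orbit_measure_act.
- move=> m n; have := (nu_mom m n).1; rewrite (nu_mom m n).2 mom -orbit_measure_moment !cintegral_chi.
  by case.
move=> Q [s Qs] Q0 Qw; have Q_inv g w : g \in weyl -> Q (act g w) = Q w.
  by move=> gW; rewrite !Qs; apply: eq_bigr => t _; have [-> ->] := re_chi_act w gW.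
have mQ : measurable_fun setT Q.
  by rewrite (_ : Q = pfun s); [have [] := bmfun_pfun s|exact/funext].
rewrite orbit_measure_integral //.
rewrite big_seq big1 // => x /(nthP (0%N, point))[j jn <-].
by rewrite Qw // mulr0.
Qed.
End OrbitMeasure.

(** * Characters at the class points *)
Section ClassPoints.
Variable R : realType.
Local Notation C := R[i].
Local Notation T := (torus R).

(** Inverses are supplied as powers, so that the characters become polynomials in
one root of unity. *)
Lemma chi_inv (w : T) (a a' b b' : C) : cval w.1 = a -> cval w.2 = b -> a * a' = 1 -> b * b' = 1 ->
  chi1 w = 1 + a + a' + b + b' + a * b' + a' * b /\
  chi2 w = chi1 w + 1 + a * b + a' * b' + a ^+ 2 * b' + a' ^+ 2 * b + a * b' ^+ 2 + a' * b ^+ 2.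
Proof.
move=> wa wb aa bb.
have inv (x x' : C) : x * x' = 1 -> x^-1 = x'.
  move=> e; have x0 : x != 0 by apply: contra_eq_neq e => ->; rewrite mul0r eq_sym oner_neq0.
  by apply: (mulfI x0); rewrite divff.
by rewrite /chi2 /chi1 wa wb -!exprVn (inv _ _ aa) (inv _ _ bb).
Qed.

(** The relation is the twelfth cyclotomic polynomial; it follows from z^6 = -1
after cancelling the factor z^2 + 1. *)
Lemma expi12 : exists z : C, z ^+ 4 = z ^+ 2 - 1 /\ forall j, cval (expi (j%:R / 12%:R)) = z ^+ j.
Proof.
pose z : C := cval (expi (1 / 12%:R : R)).
have zE j : cval (expi (j%:R / 12%:R)) = z ^+ j by exact: expi_root.
exists z; split=> //.
have z6 : z ^+ 6 = -1 by rewrite -zE -expi_half; congr (cval (expi _)); field.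
have z2 : z ^+ 2 + 1 != 0.
  rewrite -zE addr_eq0 eq_complex negb_and; apply/orP; right.
  rewrite /= oppr0 gt_eqF //; apply: sin_gt0_pi; have := pi_gt0 R; lra.
apply: (mulfI z2); have -> : (z ^+ 2 + 1) * z ^+ 4 = z ^+ 6 + z ^+ 4 by ring.
by rewrite z6; ring.
Qed.

Lemma chi_pt12 q r (a b : int) :
  (forall z : C, z ^+ 4 = z ^+ 2 - 1 ->
   let x := z ^+ q in let x' := z ^+ (12 - q) in let y := z ^+ r in let y' := z ^+ (12 - r) in
   [/\ x * x' = 1, y * y' = 1, 1 + x + x' + y + y' + x * y' + x' * y = a%:~R &
   a%:~R + 1 + x * y + x' * y' + x ^+ 2 * y' + x' ^+ 2 * y + x * y' ^+ 2 + x' * y ^+ 2 = b%:~R]) ->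
  chi1 (pt R 12 q r) = a%:~R /\ chi2 (pt R 12 q r) = b%:~R.
Proof.
have [z [z4 zE]] := expi12; case/(_ z z4) => xx yy e1 e2.
by have [-> ->] := chi_inv (zE q : cval (pt R 12 q r).1 = _) (zE r) xx yy; rewrite -e2 -e1.
Qed.

Lemma chi_order1 : chi1 (pt R 12 0 0) = 7%:~R /\ chi2 (pt R 12 0 0) = 14%:~R.
Proof. by apply: chi_pt12 => z z4 /=; split; ring: z4. Qed.
Lemma chi_order2 : chi1 (pt R 12 6 0) = (-1)%:~R /\ chi2 (pt R 12 6 0) = (-2)%:~R.
Proof. by apply: chi_pt12 => z z4 /=; split; ring: z4. Qed.
Lemma chi_order3 : chi1 (pt R 12 0 4) = 1%:~R /\ chi2 (pt R 12 0 4) = (-1)%:~R.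
Proof. by apply: chi_pt12 => z z4 /=; split; ring: z4. Qed.
Lemma chi_order4 : chi1 (pt R 12 3 9) = (-1)%:~R /\ chi2 (pt R 12 3 9) = 2%:~R.
Proof. by apply: chi_pt12 => z z4 /=; split; ring: z4. Qed.
Lemma chi_order4' : chi1 (pt R 12 0 3) = 3%:~R /\ chi2 (pt R 12 0 3) = 2%:~R.
Proof. by apply: chi_pt12 => z z4 /=; split; ring: z4. Qed.
Lemma chi_order6 : chi1 (pt R 12 2 8) = (-1)%:~R /\ chi2 (pt R 12 2 8) = 1%:~R.
Proof. by apply: chi_pt12 => z z4 /=; split; ring: z4. Qed.

Lemma chi_order7 : chi1 (pt R 7 1 5) = 0%:~R /\ chi2 (pt R 7 1 5) = 0%:~R.
Proof.
have [z [z6 zE]] : exists z : C, z ^+ 6 = - (1 + z + z ^+ 2 + z ^+ 3 + z ^+ 4 + z ^+ 5) /\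
    forall j, cval (expi (j%:R / 7%:R)) = z ^+ j.
  exists (cval (expi (1 / 7%:R : R))); split=> [|j]; last exact: expi_root.
  by have := expi7_sum R; rewrite !big_ord_recl big_ord0 /= /bump /= => h; apply/eqP; rewrite -subr_eq0 -h; apply/eqP; ring.
have w1 : cval (pt R 7 1 5).1 = z ^+ 1 by exact: zE.
have [||c1 c2] := chi_inv (a' := z ^+ 6) (b' := z ^+ 2) w1 (zE 5%N).
- by ring: z6.
- by ring: z6.
- by rewrite c2 c1; split; ring: z6.
Qed.

Lemma prim8_exp4 (z : C) : 8.-primitive_root z -> z ^+ 4 = -1.
Proof.
move=> z8; have : (z ^+ 4) ^+ 2 = 1 by rewrite -exprM (prim_expr_order z8).
by move/eqP; rewrite sqrf_eq1 -(prim_order_dvd z8) => /orP[|/eqP].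
Qed.

Lemma chi_order8 (mu t : circle R) : 8.-primitive_root (cval mu) -> cval t = cval mu ^+ 3 ->
  chi1 (mu, t) = 1%:~R /\ chi2 (mu, t) = 0%:~R.
Proof.
move=> /prim8_exp4; set z := cval mu => z4 tE.
have [||c1 c2] := @chi_inv (mu, t) z (- z ^+ 3) (z ^+ 3) (- z) erefl tE; try by ring: z4.
by rewrite c2 c1; split; ring: z4.
Qed.

Lemma chi_order8' (mu t : circle R) : 8.-primitive_root (cval mu) -> cval t = -1 ->
  chi1 (mu, t) = (-1)%:~R /\ chi2 (mu, t) = 0%:~R.
Proof.
move=> /prim8_exp4; set z := cval mu => z4 tE.
have [||c1 c2] := @chi_inv (mu, t) z (- z ^+ 3) (-1) (-1) erefl tE; try by ring: z4.
by rewrite c2 c1; split; ring: z4.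
Qed.
End ClassPoints.

(** * The two embeddings *)
Section FinalAssembly.
Variable R : realType.
Local Notation C := R[i].

Lemma class_points_total b (mu t : circle R) : (\sum_(x <- class_points b mu t) x.1 = 336)%N.
Proof. by case: b; rewrite /class_points /= !big_cons big_nil. Qed.

Lemma chi_class_points b (mu t : circle R) m n : 8.-primitive_root (cval mu) ->
  cval t = (if b then cval mu ^+ 3 else -1) ->
  \sum_(x <- class_points b mu t) x.1%:R / 336 * (chi1 x.2 ^+ m * chi2 x.2 ^+ n) = table_moment R b m n.
Proof.
move=> mu8 tE; rewrite /class_points /table_moment /character_table.
have [p1 p1'] := chi_order1 R; have [p2 p2'] := chi_order2 R; have [p3 p3'] := chi_order3 R.
have [p6 p6'] := chi_order6 R; have [p7 p7'] := chi_order7 R.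
have [p4 p4'] : chi1 (pt R 12 (if b then (3, 9) else (0, 3))%N.1 (if b then (3, 9) else (0, 3))%N.2)
      = (if b then -1 else 3)%:~R /\
    chi2 (pt R 12 (if b then (3, 9) else (0, 3))%N.1 (if b then (3, 9) else (0, 3))%N.2) = 2%:~R.
  by case: b {tE}; [exact: chi_order4|exact: chi_order4'].
have [p8 p8'] : chi1 (mu, t) = (if b then 1 else -1)%:~R /\ chi2 (mu, t) = 0%:~R.
  case: b tE p4 p4' => tE _ _; [exact: (chi_order8 mu8 tE)|exact: (chi_order8' mu8 tE)].
rewrite [X in \sum_(x <- X) _]/= !big_cons !big_nil ![(_, _).1]/= ![(_, _).2]/=.
by rewrite p1 p1' p2 p2' p3 p3' p4 p4' p6 p6' p7 p7' p8 p8'.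
Qed.

Lemma spectral_orbits b (iota : G2_embedding R PGL27) (mu t : circle R) :
  8.-primitive_root (cval mu) -> cval t = (if b then cval mu ^+ 3 else -1) ->
  (forall m n, class_moment iota m n = table_moment R b m n) ->
  exists2 eps : probability (torus R) R, is_joint_spectral_measure iota eps &
    forall A : set (torus R), measurable A ->
      eps A = epsPGL27 (@density4 R b) (if b then 4 else 7) mu t A.
Proof.
move=> mu8 tE mom; exists (orbit_measure (class_points_total b mu t)).
  by apply: orbit_measure_spectral => m n; rewrite mom chi_class_points.
by move=> A mA; rewrite orbit_measureE epsPGL27_orbits.
Qed.
End FinalAssembly.

Theorem theorem4p4 (R : realType) (iota : G2_embedding R PGL27)
    (mu t : circle R) (mu8 : 8.-primitive_root (cval mu)) :
  (varrho1_is_Sigma7' iota -> cval t = cval mu ^+ 3 ->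
     exists2 eps : probability (torus R) R,
       is_joint_spectral_measure iota eps &
       forall A : set (torus R), measurable A ->
         eps A = epsPGL27 (fun x y => 16 - K x y) 4 mu t A) /\
  (varrho1_is_Sigma1'_Sigma61 iota -> cval t = - 1 ->
     exists2 eps : probability (torus R) R,
       is_joint_spectral_measure iota eps &
       forall A : set (torus R), measurable A ->
         eps A = epsPGL27 (@K R) 7 mu t A).
Proof.
have [h8 k6 u7] := orders_PGL27; have [ch ck cu] := conj_PGL27.
have [t21 c21] := inv21_PGL27; have [t28 c28] := inv28_PGL27.
split.
  case=> s7 [irr7 tr7] sim tE; apply: (@spectral_orbits R true iota mu t mu8 tE) => m n.
  apply: (class_moment_Sigma7 gh_mem gk_mem gu_mem h8 k6 u7 ch ck cu card_PGL27 (@sum_PGL27 _)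
     m n irr7 _ sim).
  exact: (tr7 _ (groupX 3 gk_mem) t28 c28).
case=> s1 [s6 [[ker1 _] [irr6 v6] sim]] tE; apply: (@spectral_orbits R false iota mu t mu8 tE) => m n.
apply: (class_moment_Sigma16 gh_mem gk_mem gu_mem h8 k6 u7 ch ck cu card_PGL27 (@sum_PGL27 _)
     m n ker1 irr6 _ sim).
exact: (v6 _ (groupX 4 gh_mem) t21 c21).
Qed.
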